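(* Let $D=\max\{|\mathbf{F}|:\mathbf{F}\in\mathcal{F}\}$. Then $\mathbf{K}$ admits a big Ramsey structure $\mathbf{K}'$ in a finite relational language $\mathcal{L}'\supseteq\mathcal{L}$, and $\mathcal{L}'$ can be taken to have relation symbols of arity at most $\max\{2(D-1),4\}$.
   Context: $\mathcal{L}=\{U_i:i<k^{\mathsf{u}}\}\cup\{R_i:i<k\}$ is a finite relational language ($U_i$ unary, $R_i$ binary) with conventions: each vertex satisfies exactly one $U_i$; $R_i(a,a)$ never; distinct $a,b$ satisfy exactly one $R_i(a,b)$ (write $R(a,b)=i$); an involution $\mathrm{Flip}$ of $k$ fixing $0$ with $R_i(a,b)\iff R_{\mathrm{Flip}(i)}(b,a)$; $R=0$ means ''no relation''. A structure is irreducible if $R(a,b)\neq0$ for all distinct $a,b$. $\mathcal{F}$ is a finite set of finite irreducible $\mathcal{L}$-structures, $\mathcal{K}=\mathrm{Forb}(\mathcal{F})$ (finite structures into which no member of $\mathcal{F}$ embeds), and $\mathbf{K}$ is a Fra\''iss\'e limit of $\mathcal{K}$. Big Ramsey degree of $\mathbf{A}\in\mathcal{K}$: least $\ell$ such that for all $r<\omega$ and $\chi:\mathrm{Emb}(\mathbf{A},\mathbf{K})\to r$ there is $\eta\in\mathrm{Emb}(\mathbf{K},\mathbf{K})$ with $|\chi[\{\eta\circ f:f\in\mathrm{Emb}(\mathbf{A},\mathbf{K})\}]|\le\ell$. For a structure $\mathbf{M}$ and injection $f:S\to\mathbf{M}$, $\mathbf{M}\cdot f$ is the structure on $S$ making $f$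 an embedding. A big Ramsey structure for $\mathbf{K}$ is an $\mathcal{L}'$-structure $\mathbf{K}'$, $\mathcal{L}'\supseteq\mathcal{L}$, with: (1) its $\mathcal{L}$-reduct is $\mathbf{K}$; (2) each $\mathbf{A}\in\mathcal{K}$ has finitely many $\mathcal{L}'$-expansions (same underlying set) that embed into $\mathbf{K}'$, forming the set $\mathbf{K}'(\mathbf{A})$; (3) each $\mathbf{A}\in\mathcal{K}$ has big Ramsey degree $|\mathbf{K}'(\mathbf{A})|$; (4) for each $\mathbf{A}$, the map $f\mapsto\mathbf{K}'\cdot f$ from $\mathrm{Emb}(\mathbf{A},\mathbf{K})$ to $\mathbf{K}'(\mathbf{A})$ attains all $|\mathbf{K}'(\mathbf{A})|$ values on $\{\eta\circ f:f\in\mathrm{Emb}(\mathbf{A},\mathbf{K})\}$ for every $\eta\in\mathrm{Emb}(\mathbf{K},\mathbf{K})$. *)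

(* Defs.v *)
From mathcomp Require Import all_boot all_classical.
Set Implicit Arguments.
Unset Strict Implicit.
Unset Printing Implicit Defensive.

Local Open Scope classical_set_scope.
Local Open Scope card_scope.

Record language := Language {
  symb : finType;
  arity : symb -> nat;
  arity_gt0 : forall s, 0 < arity s }.

Definition structure (L : language) (T : Type) : Type :=
  forall s : symb L, set ((arity s).-tuple T).

Record finstr (L : language) := FinStr {
  carrier :> finType;
  interp : structure L carrier }.
Arguments interp {L} f s : rename.

Record emb (L : language) (S T : Type) (A : structure L S) (B : structure L T) :=
  Emb {
    emb_fun :> S -> T;
    emb_inj : injective emb_fun;
    emb_rel : forall (s : symb L) (t : (arity s).-tuple S),
      A s t <-> B s (map_tuple emb_fun t) }.

Arguments emb_inj {L S T A B} e.
Arguments emb_rel {L S T A B} e s t.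

Lemma emb_comp_rel (L : language) (S T V : Type) (A : structure L S)
    (B : structure L T) (C : structure L V) (g : emb B C) (f : emb A B)
    (s : symb L) (t : (arity s).-tuple S) :
  A s t <-> C s (map_tuple (g \o f) t).
Proof.
have -> : map_tuple (g \o f) t = map_tuple g (map_tuple f t).
  by apply: val_inj; rewrite /= map_comp.
exact: (iff_trans (emb_rel f s t) (emb_rel g s _)).
Qed.

Definition emb_comp (L : language) (S T V : Type) (A : structure L S)
    (B : structure L T) (C : structure L V) (g : emb B C) (f : emb A B) :
  emb A C :=
  Emb (inj_comp (emb_inj g) (emb_inj f)) (emb_comp_rel g f).

(* M . f; for injective f, the unique structure making f an embedding. *)
Definition pullback (L : language) (S T : Type) (M : structure L T)
    (f : S -> T) : structure L S :=
  fun s t => M s (map_tuple f t).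

(* Up to renaming of symbols, every finite language containing L is the
   disjoint union of L with a finite language E. *)
Definition lang_ext_arity (L E : language) (s : symb L + symb E) : nat :=
  match s with inl s => arity s | inr s => arity s end.

Lemma lang_ext_arity_gt0 (L E : language) (s : symb L + symb E) :
  0 < lang_ext_arity s.
Proof. by case: s => s; exact: arity_gt0. Qed.

Definition lang_ext (L E : language) : language :=
  Language (@lang_ext_arity_gt0 L E).

Definition reduct (L E : language) (T : Type)
    (M : structure (lang_ext L E) T) : structure L T :=
  fun s => M (inl s).

Definition fin_class (L : language) := forall T : finType, structure L T -> Prop.

Definition automorphism (L : language) (V : Type) (K : structure L V)
    (h : emb K K) : Prop := forall y, exists x, h x = y.

(* V is not required to be infinite. *)
Definition fraisse_limit (L : language) (C : fin_class L) (V : Type)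
    (K : structure L V) : Prop :=
  [/\ countable [set: V],
      (forall (T : finType) (A : structure L T), C T A <-> inhabited (emb A K))
    & (forall (T : finType) (A : structure L T) (f g : emb A K),
         exists h : emb K K, automorphism h /\ forall x, h (f x) = g x)].

Definition big_ramsey_bound (L : language) (T V : Type) (A : structure L T)
    (K : structure L V) (l : nat) : Prop :=
  forall (r : nat) (chi : emb A K -> 'I_r),
    exists eta : emb K K,
      [set chi (emb_comp eta f) | f in [set: emb A K]] #<= `I_l.

Definition big_ramsey_degree (L : language) (T V : Type) (A : structure L T)
    (K : structure L V) (l : nat) : Prop :=
  big_ramsey_bound A K l /\ forall m, big_ramsey_bound A K m -> l <= m.

(* K'(A) *)
Definition expansions (L E : language) (T V : Type)
    (K' : structure (lang_ext L E) V) (A : structure L T) :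
  set (structure (lang_ext L E) T) :=
  [set A' | reduct A' = A /\ inhabited (emb A' K')].

Definition big_ramsey_structure (L E : language) (C : fin_class L) (V : Type)
    (K : structure L V) (K' : structure (lang_ext L E) V) : Prop :=
  [/\ reduct K' = K,
      (forall (T : finType) (A : structure L T), C T A ->
         finite_set (expansions K' A)),
      (forall (T : finType) (A : structure L T), C T A ->
         exists n, expansions K' A #= `I_n /\ big_ramsey_degree A K n)
    & (forall (T : finType) (A : structure L T), C T A ->
         forall eta : emb K K,
           [set pullback K' (emb_comp eta f) | f in [set: emb A K]]
           = expansions K' A)].

(* There are k.+1 binary symbols: at least R_0 is present. *)
Definition binlang_arity (ku k : nat) (s : 'I_ku + 'I_k.+1) : nat :=
  match s with inl _ => 1 | inr _ => 2 end.

Lemma binlang_arity_gt0 (ku k : nat) (s : 'I_ku + 'I_k.+1) :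
  0 < binlang_arity s.
Proof. by case: s. Qed.

Definition binlang (ku k : nat) : language :=
  Language (@binlang_arity_gt0 ku k).

Definition Urel (ku k : nat) (T : Type) (A : structure (binlang ku k) T)
    (i : 'I_ku) (a : T) : Prop := A (inl i) [tuple a].

Definition Rrel (ku k : nat) (T : Type) (A : structure (binlang ku k) T)
    (i : 'I_k.+1) (a b : T) : Prop := A (inr i) [tuple a; b].

Definition conventions (ku k : nat) (Flip : 'I_k.+1 -> 'I_k.+1) (T : Type)
    (A : structure (binlang ku k) T) : Prop :=
  [/\ (forall a, exists! i, Urel A i a),
      (forall i a, ~ Rrel A i a a),
      (forall a b, a <> b -> exists! i, Rrel A i a b)
    & (forall i a b, Rrel A i a b <-> Rrel A (Flip i) b a)].

Definition irreducible (ku k : nat) (T : Type)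
    (A : structure (binlang ku k) T) : Prop :=
  forall a b, a <> b -> ~ Rrel A ord0 a b.

(* The finite set of forbidden structures is given as a family indexed by J. *)
Definition Forb (ku k : nat) (Flip : 'I_k.+1 -> 'I_k.+1) (J : finType)
    (F : J -> finstr (binlang ku k)) : fin_class (binlang ku k) :=
  fun T A => conventions Flip A /\
    forall j, ~ inhabited (emb (interp (F j)) A).

(* Main.v *)
(* Idea.  A countable structure in Forb(F) is coded by a diary: each vertex is a
   word, and the relation between two vertices is the letter of the later one at
   the coding level of the earlier one; the other events of the diary forbid
   configurations of nodes.  There is a generic diary in which every legal event
   recurs, and it satisfies a Ramsey theorem for copies of finite diaries.  The
   one-step pigeonhole principle is proved by a forcing-like argument: a maximal
   consistent set of decisions, a polarized partition lemma over a large index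
   set, and the infinite Ramsey theorem to avoid clashes between conditions;
   fusion then gives the Ramsey theorem itself.

   A copy of K is described by a diary that can be compressed to its relevant
   levels, and the compressed diary of a finite tuple is determined by the order
   of its relevant levels and the letters at them.  Hence colourings can be made
   to depend on this finite data only, which bounds big Ramsey degrees from
   above.  The same fact shows that every copy of K contains a copy whose
   compressed diary has words of bounded length, so by compactness there is a
   diary of K with a minimal set of finite types.  By minimality all its types
   recur in every copy, and its data is the big Ramsey structure; it relates two
   tuples of length max(D - 1, 2), hence the arity. *)
Require Import Defs.
From HB Require Import structures.
From mathcomp Require Import all_boot all_classical.
From mathcomp Require Import zify.
Set Implicit Arguments.
Unset Strict Implicit.
Unset Printing Implicit Defensive.
Local Open Scope nat_scope.

(** * Histories *)

(** Padding a word by [l0] costs nothing: its false bit escapes every [Forbid], its relation [0]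
    yields a free amalgam, and an irreducible obstruction lies on one side of a free amalgam. All
    constructions may therefore pad, and only nodes actually used need care.

    In general, coding a vertex may rule out structures elsewhere, and then the relevant levels
    would not determine what is allowed. In the diary built for $\mathbf{K}$ a vertex is coded only
    after every unrealized tuple of nodes has been forbidden explicitly. An obstruction created by
    coding contains the coded vertex, so tuples with $D-1$ entries suffice; naming a splitting level
    takes two vertices. This gives [wid], and each symbol compares data attached to two such tuples.

    In the one-step pigeonhole principle, all extensions whose last level is a given level of the
    generic diary must get their colour at once. That level dictates the nodes of its event, which
    these extensions share; the remaining nodes vary freely. Hence only the latter are indexed by a
    large set. *)

Record str (ku k : nat) (T : Type) :=
  Str { un : T -> 'I_ku; re : T -> T -> 'I_k.+1 }.

Record setup := Setup {
  s_ku : nat;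
  s_k : nat;
  flip : 'I_s_k.+1 -> 'I_s_k.+1;
  flip0 : flip ord0 = ord0;
  fidx : Type;
  fcar : fidx -> finType;
  fstr : forall j, str s_ku s_k (fcar j);
  firr : forall j a b, re (fstr j) a b = ord0 -> a = b;
  wid : nat;
  wid1 : 1 < wid;
  fcard : forall j, #|fcar j| <= wid.+1 }.

Section Structures.
Variable S : setup.

Definition bstr (T : Type) := str (s_ku S) (s_k S) T.

Definition pull (T' T : Type) (B : bstr T) (f : T' -> T) : bstr T' :=
  Str (un B \o f) (fun a b => re B (f a) (f b)).

Definition hom (T' T : Type) (A : bstr T') (B : bstr T) (f : T' -> T) :=
  (forall a, un B (f a) = un A a) /\ (forall a b, re B (f a) (f b) = re A a b).

(* An ℱ-structure mapped by [hom] is embedded as soon as [re B a a = ord0]. *)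
Definition forb (T : Type) (B : bstr T) :=
  forall j, ~ exists f : fcar j -> T, hom (fstr j) B f.

Definition addv (T : Type) (B : bstr T) (u : 'I_(s_ku S))
    (r : T -> 'I_(s_k S).+1) : bstr (option T) :=
  Str (fun a => if a is Some t then un B t else u)
      (fun a b => match a, b with
        | Some t, Some t' => re B t t'
        | Some t, None => r t
        | None, Some t => flip (r t)
        | None, None => ord0 end).

(** The Boolean says whether a [Forbid] at that level binds the vertex; the second entry is the
    relation to the vertex coded there. At [Noop] levels both are free and can carry splits. *)
Definition letter : Type := (bool * 'I_(s_k S).+1)%type.
HB.instance Definition _ := Finite.copy letter (bool * 'I_(s_k S).+1)%type.
Definition l0 : letter := (false, ord0).
(* Words are reversed: the most recent letter comes first. *)
Definition word : Type := seq letter.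
HB.instance Definition _ := Countable.copy word (seq letter).

Definition constr : Type :=
  ({ffun 'I_(wid S) -> 'I_(s_ku S)} *
   {ffun 'I_(wid S) -> {ffun 'I_(wid S) -> 'I_(s_k S).+1}})%type.
HB.instance Definition _ := Finite.copy constr
  ({ffun 'I_(wid S) -> 'I_(s_ku S)} *
   {ffun 'I_(wid S) -> {ffun 'I_(wid S) -> 'I_(s_k S).+1}})%type.

(* Entries of the tuple may repeat, so that [c] stands for an irreducible
   structure of size at most [wid S]. *)
Definition realize (c : constr) (T : Type) (B : bstr T) (f : 'I_(wid S) -> T) :=
  (forall i, un B (f i) = c.1 i) /\
  (forall i j, re B (f i) (f j) = c.2 i j /\ (c.2 i j = ord0 -> f i = f j)).

Inductive event :=
| Noop
| Forbid of constr & {ffun 'I_(wid S) -> word}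
| Code of 'I_(s_ku S) & word.

Definition event_enc (e : event) :
  unit + (constr * {ffun 'I_(wid S) -> word}) + ('I_(s_ku S) * word) :=
  match e with
  | Noop => inl (inl tt)
  | Forbid c ka => inl (inr (c, ka))
  | Code u y => inr (u, y)
  end.
Definition event_dec
    (x : unit + (constr * {ffun 'I_(wid S) -> word}) + ('I_(s_ku S) * word)) :=
  match x with
  | inl (inl _) => Noop
  | inl (inr (c, ka)) => Forbid c ka
  | inr (u, y) => Code u y
  end.
Lemma event_encK : cancel event_enc event_dec.
Proof. by case. Qed.
HB.instance Definition _ := Countable.copy event (can_type event_encK).

Definition emap (h : word -> word) (e : event) : event :=
  match e with
  | Noop => Noop
  | Forbid c ka => Forbid c [ffun i => h (ka i)]
  | Code u y => Code u (h y)
  end.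

(* [allowed es B la]: after the history [es], later vertices sitting above the
   nodes [la] may form the structure [B]. *)
Fixpoint allowed (es : seq event) (T : Type) (B : bstr T) (la : T -> word) : Prop :=
  if es is e :: es' then
    match e with
    | Noop => allowed es' B (behead \o la)
    | Forbid c ka => allowed es' B (behead \o la) /\
        ~ exists f, realize c B f /\
            forall i, behead (la (f i)) = ka i /\ (head l0 (la (f i))).1
    | Code u y => allowed es' (addv B u (fun t => (head l0 (la t)).2))
        (fun a => if a is Some t then behead (la t) else y)
    end
  else forb B.

Lemma str_eq (T : Type) (B B' : bstr T) :
  (forall a, un B a = un B' a) -> (forall a b, re B a b = re B' a b) -> B = B'.
Proof.
case: B B' => [u r] [u' r'] /= /funext -> rr.
by congr Str; apply/funext => a; apply/funext => b.
Qed.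

Lemma pull_addv (T' T : Type) (B : bstr T) (f : T' -> T) u r :
  addv (pull B f) u (r \o f) = pull (addv B u r) (omap f).
Proof. by apply: str_eq => [[]|[?|] []]. Qed.

Lemma pull_pull (T'' T' T : Type) (B : bstr T) (f : T' -> T) (g : T'' -> T') :
  pull (pull B f) g = pull B (f \o g).
Proof. by []. Qed.

Lemma forb_pull (T' T : Type) (B : bstr T) (f : T' -> T) :
  forb B -> forb (pull B f).
Proof. by move=> FB j [g [g1 g2]]; apply: (FB j); exists (f \o g). Qed.

Lemma realize_pull (T' T : Type) (B : bstr T) (f : T' -> T) c g :
  realize c (pull B f) g -> realize c B (f \o g).
Proof.
move=> [g1 g2]; split=> // i j; have [e1 e2] := g2 i j; split=> //=.
by move=> /e2 ->.
Qed.

Lemma allowed_pull es (T' T : Type) (B : bstr T) la (f : T' -> T) :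
  allowed es B la -> allowed es (pull B f) (la \o f).
Proof.
elim: es T' T B la f => [|e es IH] T' T B la f /=; first exact: forb_pull.
case: e => [|c ka|u y]; first exact: (IH _ _ _ (behead \o la)).
- move=> [al nr]; split; first exact: (IH _ _ _ (behead \o la)).
  by move=> [g [/realize_pull g1 g2]]; apply: nr; exists (f \o g).
- move=> /(IH (option T') _ _ _ (omap f)) al.
  rewrite (pull_addv B f u (fun t => (head l0 (la t)).2)).
  by congr (allowed es _ _): al; apply/funext => -[].
Qed.

Lemma allowed_cons e es (T : Type) (B : bstr T) la :
  allowed (e :: es) B la -> allowed es B (behead \o la).
Proof.
case: e => [|c ka|u y] //=; first by case.
move=> /(allowed_pull (fun t => Some t)).
by congr (allowed es _ _); exact: str_eq.
Qed.

Lemma allowed_cat ds es (T : Type) (B : bstr T) la :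
  allowed (ds ++ es) B la -> allowed es B (drop (size ds) \o la).
Proof.
elim: ds la => [|e ds IH] la /=.
  by congr allowed; apply/funext => t /=; rewrite drop0.
move=> /allowed_cons /IH; congr allowed; apply/funext => t /=.
by case: (la t).
Qed.

(* Free amalgamation: an irreducible obstruction lies on one of the two sides. *)
Lemma clique_side (I T T1 T2 : Type) (f1 : T1 -> T) (f2 : T2 -> T) (f : I -> T) :
  (forall a, (exists x, f1 x = a) \/ (exists x, f2 x = a)) ->
  (forall i j, ~ (exists x, f1 x = f i) -> ~ (exists x, f2 x = f j) -> f i = f j) ->
  (exists g : I -> T1, f1 \o g = f) \/ (exists g : I -> T2, f2 \o g = f).
Proof.
move=> cov sep.
have [h1|] := pselect (forall i, exists x, f1 x = f i).
  by left; have [g gP] := choice h1; exists g; apply/funext.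
move=> /existsNP [i0 n1]; right.
suff h2 : forall j, exists x, f2 x = f j.
  by have [g gP] := choice h2; exists g; apply/funext.
move=> j; apply: contrapT => n2.
have e := sep _ _ n1 n2; rewrite -e in n2.
by case: (cov (f i0)).
Qed.

(** Coded vertices belong to both sides (hence [omap f1] and [omap f2]), so the induction keeps its
    shape. Every obstruction, from [forb] or from a [Forbid], is irreducible and sits on one side by
    [clique_side]. *)
Lemma allowed_amalgam es (T T1 T2 : Type) (B : bstr T) la
    (f1 : T1 -> T) (f2 : T2 -> T) :
  (forall a, (exists x, f1 x = a) \/ (exists x, f2 x = a)) ->
  (forall a b, ~ (exists x, f1 x = a) -> ~ (exists x, f2 x = b) ->
     re B a b = ord0) ->
  allowed es (pull B f1) (la \o f1) -> allowed es (pull B f2) (la \o f2) ->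
  allowed es B la.
Proof.
elim: es T T1 T2 B la f1 f2 => [|e es IH] T T1 T2 B la f1 f2 cov sep /=.
  move=> F1 F2 j [f [hu hr]].
  have sep' : forall a b, ~ (exists x, f1 x = f a) -> ~ (exists x, f2 x = f b) ->
      f a = f b.
    by move=> a b n1 n2; congr f; apply: (@firr S j); rewrite -hr; exact: sep.
  have [[g gE]|[g gE]] := clique_side cov sep'; subst f.
    by apply: (F1 j); exists g.
  by apply: (F2 j); exists g.
case: e => [|c ka|u y].
- exact: IH.
- move=> [a1 n1] [a2 n2]; split; first exact: (IH _ _ _ _ _ f1 f2).
  move=> [f [[hu hr] hl]].
  have sep' : forall a b, ~ (exists x, f1 x = f a) -> ~ (exists x, f2 x = f b) ->
      f a = f b.
    by move=> a b m1 m2; apply: (hr a b).2; rewrite -(hr a b).1; exact: sep.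
  have inj : forall i j, c.2 i j = ord0 -> f i = f j by move=> i j /(hr i j).2.
  (* A lift of a realization may separate entries that [f] identifies, which [realize] excludes;
     [ok] takes one lift per point of the image. *)
  have ok : forall (T0 : Type) (f0 : T0 -> T) (g : 'I_(wid S) -> T0), f0 \o g = f ->
      exists g', f0 \o g' = f /\ forall i j, f i = f j -> g' i = g' j.
    move=> T0 f0 g gE.
    have pre : forall t : T, exists x : option T0,
        forall i, f i = t -> exists2 z, x = Some z & f0 z = t.
      move=> t; have [[i fi]|ni] := pselect (exists i, f i = t).
        by exists (Some (g i)) => _ _; exists (g i); rewrite // -fi -gE.
      by exists None => i fi; case: ni; exists i.
    have [q qP] := choice pre.
    exists (fun i => odflt (g i) (q (f i))); split.
      by apply/funext => i /=; have [z -> /= ->] := qP (f i) i erefl.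
    move=> i j fij; have [z zE _] := qP (f i) i erefl.
    by rewrite -fij zE.
  have [[g /ok [g' [gE gi]]]|[g /ok [g' [gE gi]]]] :=
    clique_side cov sep'.
  + apply: n1; exists g'; split; last by move=> i; have := hl i; rewrite -gE.
    split=> [i|i j]; first by rewrite -hu -gE.
    have [e1 e2] := hr i j; split; first by rewrite -e1 -gE.
    by move=> /e2; exact: gi.
  + apply: n2; exists g'; split; last by move=> i; have := hl i; rewrite -gE.
    split=> [i|i j]; first by rewrite -hu -gE.
    have [e1 e2] := hr i j; split; first by rewrite -e1 -gE.
    by move=> /e2; exact: gi.
- set la' := fun a => _.
  move=> a1 a2; apply: (IH _ _ _ _ _ (omap f1) (omap f2)).
  + by move=> [t|]; [have [[x <-]|[x <-]] := cov t; [left|right]; exists (Some x)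
      |left; exists None].
  + move=> [a|] [b|] //= n1 n2.
    * by apply: sep => -[x xE]; [apply: n1|apply: n2]; exists (Some x); rewrite /= xE.
    * by case: n2; exists None.
    * by case: n1; exists None.
  + move: a1; rewrite (pull_addv B f1 u (fun t => (head l0 (la t)).2)).
    by congr allowed; apply/funext => -[].
  + move: a2; rewrite (pull_addv B f2 u (fun t => (head l0 (la t)).2)).
    by congr allowed; apply/funext => -[].
Qed.

Lemma allowed_void es (T T' : Type) (B : bstr T) (B' : bstr T') la la' :
  (T' -> False) -> allowed es B la -> allowed es B' la'.
Proof.
move=> T'0 /(allowed_pull (fun x : T' => match T'0 x with end)).
by congr allowed; [apply: str_eq|apply/funext] => x; case: (T'0 x).
Qed.

Definition vstr : bstr void := Str (fun x : void => match x with end) (fun _ _ => ord0).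
Definition valid es := allowed es vstr (fun=> [::]).

Lemma valid_allowed es (T : Type) (B : bstr T) la : allowed es B la -> valid es.
Proof. exact: allowed_void. Qed.

Definition zpad (n : nat) (s : word) : word := nseq n l0 ++ s.

(* Letters [l0] never create new obstructions. *)
Lemma allowed_mix ds es (T : Type) (B : bstr T) (la' : T -> word) (P : T -> Prop) :
  (forall t, ~ P t -> exists s, la' t = zpad (size ds) s) ->
  allowed es B (drop (size ds) \o la') ->
  allowed (ds ++ es) (pull B (fun x : {t | P t} => sval x)) (fun x => la' (sval x)) ->
  allowed (ds ++ es) B la'.
Proof.
elim: ds la' => [|e ds IH] la' /= hz.
  by move=> al _; congr (allowed es _ _): al; apply/funext => t /=; rewrite drop0.
move=> al alP.
have IH' : allowed (ds ++ es) B (behead \o la').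
  apply: IH.
  - move=> t /hz [s ls]; exists s => /=; by rewrite ls.
  - by congr (allowed es _ _): al; apply/funext => t /=; case: (la' t).
  - exact: (@allowed_cons e).
case: e alP => [|c ka|u y] alP //.
- split=> //; move=> [f [fr fl]]; case: alP => _; apply.
  have fP i : P (f i).
    apply: contrapT => /hz [s ls]; have := (fl i).2.
    by rewrite ls.
  exists (fun i => exist _ (f i) (fP i)); split; last by move=> i; exact: (fl i).
  have [r1 r2] := fr; split=> // i j; have [e1 e2] := r2 i j; split=> // /e2 e.
  exact: eq_exist.
(* One side is the points of [P] with the coded vertex, the other all points without it. A point
   outside [P] carries [l0], hence relation [0] to the coded vertex. *)
- apply: (@allowed_amalgam _ _ _ _ _ _ (omap (fun x : {t | P t} => sval x)) Some).
  + by move=> [t|]; [right; exists t|left; exists None].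
  + move=> [a|] [b|] //= n1 n2.
    * by case: n2; exists b.
    * have na : ~ P a by move=> Pa; apply: n1; exists (Some (exist _ a Pa)).
      by have [s ->] := hz _ na.
    * by case: n2; exists b.
  + move: alP; rewrite -(pull_addv B (fun x : {t | P t} => sval x) u
      (fun t => (head l0 (la' t)).2)).
    by congr allowed; apply/funext => -[].
  + by congr (allowed (ds ++ es) _ _): IH'; exact: str_eq.
Qed.

(** Failure comes from a single irreducible witness: a forbidden structure with at most [(wid S).+1]
    points, or a realized constraint with at most [wid S]. Undoing a [Code] event only deletes the
    points lying on the coded vertex. *)
Lemma not_allowed_local es (T : Type) (B : bstr T) la : ~ allowed es B la ->
  exists (X : finType) (f : X -> T), [/\ #|X| <= (wid S).+1,
    forall a b, re B (f a) (f b) = ord0 -> f a = f b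
    & ~ allowed es (pull B f) (la \o f)].
Proof.
elim: es T B la => [|e es IH] T B la /=.
  move=> /existsNP [j /contrapT [f [hu hr]]]; exists (fcar j), f; split.
  - exact: fcard.
  - by move=> a b; rewrite hr => /firr ->.
  - by move=> /(_ j); apply; exists id; split=> [a|a b] /=; rewrite ?hu ?hr.
case: e => [|c ka|u y].
- by move=> /IH [X [f [h1 h2 h3]]]; exists X, f.
- move=> nal.
  have [al|/IH [X [f [h1 h2 h3]]]] := pselect (allowed es B (behead \o la)); last first.
    by exists X, f; split=> // -[].
  have [f [[hu hr] hl]] : exists f, realize c B f /\
      forall i, behead (la (f i)) = ka i /\ (head l0 (la (f i))).1.
    by apply: contrapT => ne; exact: nal.
  pose f' : 'I_(wid S) -> {classic T} := f.
  pose s := undup (codom f').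
  have us : uniq s by exact: undup_uniq.
  have fs i : f' i \in s by rewrite mem_undup codom_f.
  pose g i : seq_sub s := SeqSub (fs i).
  exists (seq_sub s), (fun x : seq_sub s => ssval x); split.
  - rewrite card_seq_sub //; apply: leq_trans (leq_trans (size_undup _) _) (leqnSn _).
    by rewrite size_codom card_ord.
  - move=> [a as_] [b bs] /=; move: as_ bs; rewrite !mem_undup.
    move=> /codomP [i ->] /codomP [j ->]; rewrite /f' (hr i j).1.
    exact: (hr i j).2.
  - move=> [_]; apply; exists g; split; last by move=> i; exact: hl.
    split=> [i|i j]; first exact: hu.
    have [e1 e2] := hr i j; split=> // /e2 e; apply: val_inj; exact: e.
- move=> /IH [X [f [h1 h2 h3]]].
  pose Y := {x : X | f x}.
  have fY (y0 : Y) : exists t, f (val y0) = Some t.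
    by case: y0 => x /=; case: (f x) => // t _; exists t.
  have [g gP] := choice fY.
  exists Y, g; split.
  - by apply: leq_trans h1; rewrite card_sig; exact: max_card.
  - move=> a b e; apply: Some_inj; rewrite -!gP; apply: h2.
    by rewrite !gP.
  - move=> al; apply: h3.
    pose q (x : X) : option Y := insub x.
    have qP x : omap g (q x) = f x.
      rewrite /q; case: insubP => [y0 _ <-|] /=; first by rewrite gP.
      by case: (f x).
    move: al; rewrite (pull_addv B g u (fun t => (head l0 (la t)).2)).
    move=> /(allowed_pull q); rewrite pull_pull.
    have -> : omap g \o q = f by apply/funext => x /=; rewrite qP.
    congr allowed; apply/funext => x /=; rewrite -qP.
    by case: (q x).
Qed.

End Structures.
Arguments Noop {S}.
Arguments l0 {S}.

(** * Diaries and their embeddings *)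

Lemma dep_choice (T : Type) (P : nat -> T -> Prop) (R : nat -> T -> T -> Prop) x0 :
  P 0 x0 -> (forall n x, P n x -> exists y, P n.+1 y /\ R n x y) ->
  exists f, f 0 = x0 /\ forall n, P n (f n) /\ R n (f n) (f n.+1).
Proof.
move=> P0 st.
have ex (nx : nat * T) : exists y, P nx.1 nx.2 -> P nx.1.+1 y /\ R nx.1 nx.2 y.
  have [p|np] := pselect (P nx.1 nx.2); last by exists nx.2.
  by have [y yP] := st _ _ p; exists y.
have [g gP] := choice ex.
pose f := fix f n := if n is n'.+1 then g (n', f n') else x0.
have fP n : P n (f n).
  by elim: n => [|n IH] //=; exact: (gP (n, f n) IH).1.
by exists f; split=> // n; split; [exact: fP|exact: (gP (n, f n) (fP n)).2].
Qed.

Section Diaries.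
Variable S : setup.
Local Notation word := (word S).
Local Notation event := (event S).
Implicit Types (ev : nat -> event) (N : nat -> nat) (h : word -> word).

Fixpoint hist ev n : seq event := if n is n'.+1 then ev n' :: hist ev n' else [::].

Definition sfx (T : Type) (s s' : seq T) := exists d, s' = d ++ s.

Definition padto (n : nat) (s : word) : word := zpad (n - size s) s.

Definition wfe n (e : event) : Prop :=
  match e with
  | Noop => True
  | Forbid c ka => forall i, size (ka i) = n
  | Code u y => size y = n
  end.

Definition wfev ev := forall n, wfe n (ev n).

(* The first [J] levels of the diary [ev] are copied into [ev']; [h] acts on
   all words, not only on those used by some vertex. *)
Definition pemb J ev ev' N h :=
  [/\ forall i j, i < j -> j < J -> N i < N j,
      forall s, size s < J -> size (h s) = N (size s),
      forall l s, (size s).+1 < J -> sfx (l :: h s) (h (l :: s)),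
      forall i, i < J -> ev' (N i) = emap h (ev i)
    & forall i, i < J -> forall (T : Type) (B : bstr S T) (la : T -> word),
        (forall x, size (la x) = i) ->
        (allowed (hist ev i) B la <-> allowed (hist ev' (N i)) B (h \o la))].

Definition demb ev ev' N h := forall J, pemb J ev ev' N h.

Definition agr J N h N' h' :=
  (forall i, i < J -> N i = N' i) /\ (forall s, size s < J -> h s = h' s).

Lemma agr_refl J N h : agr J N h N h. Proof. by []. Qed.

Lemma agr_trans J N h N' h' N'' h'' :
  agr J N h N' h' -> agr J N' h' N'' h'' -> agr J N h N'' h''.
Proof. by move=> [a b] [c d]; split=> ? ?; [rewrite a ?c|rewrite b ?d]. Qed.

Lemma agr_le J J' N h N' h' : J <= J' -> agr J' N h N' h' -> agr J N h N' h'.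
Proof.
by move=> le [a b]; split=> ? /leq_trans /(_ le); [exact: a|exact: b].
Qed.

Lemma emap_eq h h' n (e : event) : wfe n e ->
  (forall s, size s = n -> h s = h' s) -> emap h e = emap h' e.
Proof.
case: e => [|c ka|u y] //= w E; last by rewrite E.
by congr Forbid; apply/ffunP => i; rewrite !ffunE E.
Qed.

Lemma emap_comp h h' (e : event) : emap h (emap h' e) = emap (h \o h') e.
Proof. by case: e => //= c ka; congr Forbid; apply/ffunP => i; rewrite !ffunE. Qed.

Lemma emap_id (e : event) : emap id e = e.
Proof. by case: e => //= c ka; congr Forbid; apply/ffunP => i; rewrite !ffunE. Qed.

Lemma wfe_map h n m (e : event) : wfe n e ->
  (forall s, size s = n -> size (h s) = m) -> wfe m (emap h e).
Proof.
case: e => [|c ka|u y] //= w E; last by rewrite E.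
by move=> i; rewrite ffunE E.
Qed.

Lemma hist_cat ev m n : m <= n ->
  exists ds, hist ev n = ds ++ hist ev m /\ size ds = n - m.
Proof.
elim: n => [|n IH]; first by rewrite leqn0 => /eqP ->; exists [::].
rewrite leq_eqVlt => /predU1P [->|]; first by exists [::]; rewrite subnn.
rewrite ltnS => le; have [ds [e z]] := IH le.
by exists (ev n :: ds); rewrite /= e z subSn.
Qed.

Lemma eq_hist ev ev' n : (forall i, i < n -> ev i = ev' i) -> hist ev n = hist ev' n.
Proof.
elim: n => [|n IH] //= E; rewrite E // IH // => i ltin.
by apply: E; exact: ltnW.
Qed.

Lemma sfx_refl (T : Type) (s : seq T) : sfx s s. Proof. by exists [::]. Qed.

Lemma sfx_trans (T : Type) (s s' s'' : seq T) : sfx s s' -> sfx s' s'' -> sfx s s''.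
Proof. by move=> [d ->] [d' ->]; exists (d' ++ d); rewrite catA. Qed.

Lemma sfx_drop (T : Type) (s s' : seq T) : sfx s s' -> drop (size s' - size s) s' = s.
Proof. by move=> [d ->]; rewrite size_cat addnK drop_size_cat. Qed.

Lemma sfx_padto n (s : word) : sfx s (padto n s).
Proof. by exists (nseq (n - size s) l0). Qed.

Lemma size_padto n (s : word) : size s <= n -> size (padto n s) = n.
Proof. by move=> le; rewrite /padto size_cat size_nseq subnK. Qed.

Lemma sfx_size (T : Type) (s s' : seq T) : sfx s s' -> size s <= size s'.
Proof. by move=> [d ->]; rewrite size_cat leq_addl. Qed.

Lemma allowed_down ev m n (T : Type) (B : bstr S T) (la la' : T -> word) :
  m <= n -> (forall x, size (la x) = m) -> (forall x, size (la' x) = n) ->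
  (forall x, sfx (la x) (la' x)) ->
  allowed (hist ev n) B la' -> allowed (hist ev m) B la.
Proof.
move=> le z z' sf; have [ds [-> zd]] := hist_cat ev le.
move=> /allowed_cat; congr allowed; apply/funext => x /=.
by rewrite zd -(z x) -(z' x) sfx_drop.
Qed.

(** Going up, only the points that do not continue by [l0] have to be checked. *)
Lemma allowed_up ev m n (T : Type) (B : bstr S T) (la la' : T -> word)
    (P : T -> Prop) :
  m <= n -> (forall x, size (la x) = m) -> (forall x, size (la' x) = n) ->
  (forall x, sfx (la x) (la' x)) ->
  (forall x, ~ P x -> la' x = padto n (la x)) ->
  allowed (hist ev m) B la ->
  allowed (hist ev n) (pull B (fun x : {t | P t} => sval x)) (fun x => la' (sval x)) ->
  allowed (hist ev n) B la'.
Proof.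
move=> le z z' sf zp al; have [ds [-> zd]] := hist_cat ev le => alP.
apply: allowed_mix alP.
  by move=> x /zp ->; exists (la x); rewrite /padto z zd.
congr (allowed _ B _): al; apply/funext => x /=.
by rewrite zd -(z x) -(z' x) sfx_drop.
Qed.

Lemma allowed_pad ev m n (T : Type) (B : bstr S T) (la : T -> word) :
  valid (hist ev n) ->
  m <= n -> (forall x, size (la x) = m) ->
  allowed (hist ev m) B la -> allowed (hist ev n) B (padto n \o la).
Proof.
move=> v le z al.
apply: (@allowed_up ev m n _ _ la _ (fun=> False)) => //.
- by move=> x /=; rewrite size_padto ?z.
- by move=> x; exact: sfx_padto.
- by apply: allowed_void v => -[].
Qed.

Lemma pemb_le J J' ev ev' N h : J <= J' -> pemb J' ev ev' N h -> pemb J ev ev' N h.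
Proof.
move=> le [a b c d e]; split.
- by move=> i j ij jJ; apply: a => //; exact: leq_trans le.
- by move=> s sJ; apply: b; exact: leq_trans le.
- by move=> l s sJ; apply: c; exact: leq_trans le.
- by move=> i iJ; apply: d; exact: leq_trans le.
- by move=> i iJ; apply: e; exact: leq_trans le.
Qed.

Lemma eq_pemb J ev ev1 ev' N h N' h' : wfev ev ->
  (forall i, i < J -> ev i = ev1 i) ->
  agr J N h N' h' -> pemb J ev ev' N h -> pemb J ev1 ev' N' h'.
Proof.
move=> w evE [aN ah] [a b c d e]; split.
- by move=> i j ij jJ; rewrite -!aN ?a //; exact: ltn_trans jJ.
- by move=> s sJ; rewrite -aN // -ah // b.
- move=> l s sJ; rewrite -(ah (l :: s)) // -(ah s); last exact: ltnW.
  exact: c.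
- move=> i iJ; rewrite -aN // d // -evE //; apply: (emap_eq (n := i)) => //.
  by move=> s si; rewrite ah // si.
- move=> i iJ T B la z; rewrite -aN // -(@eq_hist ev ev1); last first.
    by move=> j ji; apply: evE; exact: ltn_trans iJ.
  have -> : h' \o la = h \o la by apply/funext => x /=; rewrite ah // z.
  exact: e.
Qed.

Lemma pemb_sfx J ev ev' N h s s' : pemb J ev ev' N h -> sfx s s' -> size s' < J ->
  sfx (h s) (h s').
Proof.
move=> [_ _ c _ _] [d ->]; elim: d => [|l d IH] /= lt; first exact: sfx_refl.
have [d' E] := c l (d ++ s) lt.
apply: sfx_trans (IH (ltnW lt)) _.
by exists (d' ++ [:: l]); rewrite /= E -catA.
Qed.

Lemma pemb_inj J ev ev' N h s s' : pemb J ev ev' N h -> size s = size s' ->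
  size s < J -> h s = h s' -> s = s'.
Proof.
move=> [_ b c _ _]; elim: s s' => [|l s IH] [|l' s'] //= [zz] lt hh.
have [d E] := c l s lt; have := c l' s'; rewrite -zz => /(_ lt) [d' E'].
move: hh; rewrite E E' => hh.
have zd : size d = size d'.
  have := congr1 size hh; rewrite !size_cat /= !b ?zz -?zz; try exact: ltnW.
  by move/addIn.
move/eqP: hh; rewrite eqseq_cat // => /andP [_ /eqP [-> hh]].
by congr cons; apply: IH => //; exact: ltnW.
Qed.

Lemma pemb_id ev : demb ev ev id id.
Proof.
move=> J; split=> //.
- by move=> l s _; exact: sfx_refl.
- by move=> i _; rewrite emap_id.
Qed.

Lemma pemb_comp J ev ev' ev'' N h N' h' : pemb J ev ev' N h ->
  demb ev' ev'' N' h' -> pemb J ev ev'' (N' \o N) (h' \o h).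
Proof.
move=> [a b c d e] D.
have Nm i j : i < j -> N' i < N' j by case: (D j.+1) => a' _ _ _ _ ij; exact: a'.
split.
- by move=> i j ij jJ /=; exact/Nm/a.
- move=> s sJ /=; have [_ b' _ _ _] := D (size (h s)).+1.
  by rewrite b' // b.
- move=> l s sJ /=; have [_ _ c' _ _] := D (size (h (l :: s))).+1.
  apply: sfx_trans (pemb_sfx (D _) (c l s sJ) _); last exact: ltnSn.
  apply: c'; rewrite ltnS; exact: (sfx_size (c l s sJ)).
- move=> i iJ /=; have [_ _ _ d' _] := D (N i).+1.
  by rewrite d' // d // emap_comp.
- move=> i iJ T B la z; rewrite (e i iJ) //.
  have [_ _ _ _ e'] := D (N i).+1.
  by rewrite (e' (N i)) //= => x; rewrite b // z.
Qed.

Lemma demb_comp ev ev' ev'' N h N' h' : demb ev ev' N h ->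
  demb ev' ev'' N' h' -> demb ev ev'' (N' \o N) (h' \o h).
Proof. by move=> D D' J; exact: pemb_comp. Qed.

(** An embedding must send [l :: s] above [l :: h s]. This is the part of the image that is fixed in
    advance, and [base N i] is its length at level [i]. *)
Definition cfor h (s : word) : word := if s is l :: s' then l :: h s' else [::].
Definition base N i := if i is i'.+1 then (N i').+1 else 0.

Lemma size_cfor J ev ev' N h s : pemb J ev ev' N h -> size s = J ->
  size (cfor h s) = base N J.
Proof.
by move=> [_ b _ _ _]; case: s => [|l s] zJ; rewrite -zJ //= b // -zJ.
Qed.

(** Each side processes one more event, [ev i'] or its copy. As [h] is injective on a level, a
    [Forbid] tuple is met on one side exactly when it is met on the other. *)
Lemma forced_iff i ev ev' N h (T : Type) (B : bstr S T) (la : T -> word) :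
  wfev ev -> pemb i ev ev' N h -> (forall x, size (la x) = i) ->
  allowed (hist ev i) B la <-> allowed (hist ev' (base N i)) B (cfor h \o la).
Proof.
case: i => [|i] w p z //=.
have [_ b _ d e] := p; rewrite d //.
have e' := e i (ltnSn i).
have tl : behead \o (cfor h \o la) = h \o (behead \o la).
  by apply/funext => x /=; have := z x; case: (la x).
have hd x : head l0 (cfor h (la x)) = head l0 (la x).
  by have := z x; case: (la x).
have zb x : size ((behead \o la) x) = i.
  by rewrite /= size_behead z.
have := w i; case E : (ev i) => [|c ka|u y] /= wi.
- by rewrite tl; exact: e'.
- rewrite tl -(e' _ _ _ zb).
  suff -> : (exists f, realize c B f /\ (forall j, behead (cfor h (la (f j))) =
      [ffun j0 => h (ka j0)] j /\ (head l0 (cfor h (la (f j)))).1)) <->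
      (exists f, realize c B f /\ (forall j, behead (la (f j)) = ka j /\
      (head l0 (la (f j))).1)) by [].
  split=> -[f [r fl]]; exists f; split=> // j; have [f1 f2] := fl j.
    move: f1 f2; rewrite ffunE hd => f1 f2; split=> //.
    have := congr1 (fun g => g (f j)) tl => /= tlj; rewrite tlj in f1.
    by apply: (pemb_inj p _ _ f1); rewrite ?wi -?[size _]/(size ((behead \o la) (f j))) ?zb.
  rewrite ffunE hd; split=> //; rewrite -f1.
  by have := congr1 (fun g => g (f j)) tl.
- rewrite (e' _ _ (fun a => if a is Some t then behead (la t) else y)); last first.
    by case=> [x|] //; exact: zb.
  have -> : (fun t => (head l0 ((cfor h \o la) t)).2) =
            (fun t => (head l0 (la t)).2) by apply/funext => x /=; rewrite hd.
  have -> : (fun a : option T => if a is Some t then behead ((cfor h \o la) t) else h y)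
     = h \o (fun a => if a is Some t then behead (la t) else y).
    by apply/funext => -[x|] //=; have := congr1 (fun g => g x) tl.
  by [].
Qed.

(** Only the upward implication for [allowed] has to be supplied; the converse is [allowed_down] to
    level [base N i] followed by [forced_iff]. *)
Lemma pemb_extend i ev ev' N h m t : wfev ev -> pemb i ev ev' N h ->
  base N i <= m ->
  (forall s, size s = i -> size (t s) = m /\ sfx (cfor h s) (t s)) ->
  ev' m = emap t (ev i) ->
  (forall (T : Type) (B : bstr S T) (la : T -> word), (forall x, size (la x) = i) ->
    allowed (hist ev' (base N i)) B (cfor h \o la) ->
    allowed (hist ev' m) B (t \o la)) ->
  pemb i.+1 ev ev' (fun j => if j == i then m else N j)
    (fun s => if size s == i then t s else h s).
Proof.
move=> w p le tP evm al; have [a b c d e] := p; split.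
- move=> j j' jj'; rewrite ltnS leq_eqVlt => /predU1P [ji|ji]; last first.
    by rewrite !ltn_eqF ?(ltn_trans jj' ji) // a.
  subst j'; rewrite eqxx ltn_eqF //; case: i le jj' a {w p b c d e al evm tP} => //= i le + a.
  rewrite ltnS leq_eqVlt => /predU1P [->|ji] //.
  by apply: leq_trans le; rewrite ltnS ltnW // a.
- move=> s; rewrite ltnS leq_eqVlt => /predU1P [si|si].
    by rewrite si eqxx (tP s si).1.
  by rewrite ltn_eqF // b.
- move=> l s; rewrite ltnS leq_eqVlt => /predU1P [si|si] /=.
    rewrite si eqxx ltn_eqF -?si //.
    by have := (tP (l :: s) si).2.
  by rewrite (ltn_eqF (ltnW si)) (ltn_eqF si); exact: c.
- move=> j; rewrite ltnS leq_eqVlt => /predU1P [->|ji].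
    rewrite eqxx evm; apply: (emap_eq (n := i)) => // s ->.
    by rewrite eqxx.
  rewrite ltn_eqF // d //; apply: (emap_eq (n := j)) => // s ->.
  by rewrite ltn_eqF.
- move=> j; rewrite ltnS leq_eqVlt => /predU1P [->|ji] T B la z.
    rewrite eqxx.
    have -> : (fun s => if size s == i then t s else h s) \o la = t \o la.
      by apply/funext => x /=; rewrite z eqxx.
    rewrite (forced_iff B w p z); split; first exact: al.
    apply: allowed_down => //.
    + by move=> x; exact: (size_cfor p).
    + by move=> x; exact: (tP _ (z x)).1.
    + by move=> x; exact: (tP _ (z x)).2.
  rewrite ltn_eqF //.
  have -> : (fun s => if size s == i then t s else h s) \o la = h \o la.
    by apply/funext => x /=; rewrite z ltn_eqF.
  exact: e.
Qed.

Lemma agr_upd i N h m t :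
  agr i N h (fun j => if j == i then m else N j)
    (fun s => if size s == i then t s else h s).
Proof. by split=> [j|s] lt; rewrite ltn_eqF. Qed.

(** No stage changes anything below its own level, so the diagonal map agrees with each stage as far
    as that stage reaches. [Inv] is recorded for the finite stages, from which properties of the
    limit are read off. *)
Lemma pemb_limit ev ev' J0 N0 h0 (Inv : nat -> (nat -> nat) -> (word -> word) -> Prop) :
  wfev ev -> pemb J0 ev ev' N0 h0 -> Inv J0 N0 h0 ->
  (forall i N h, J0 <= i -> pemb i ev ev' N h -> agr J0 N0 h0 N h -> Inv i N h ->
     exists N' h', [/\ pemb i.+1 ev ev' N' h', agr i N h N' h' & Inv i.+1 N' h']) ->
  exists N h, [/\ demb ev ev' N h, agr J0 N0 h0 N h
    & forall i, J0 <= i -> exists N' h', [/\ agr i N' h' N h & Inv i N' h']].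
Proof.
move=> w p0 I0 st.
pose P n (x : (nat -> nat) * (word -> word)) :=
  [/\ pemb (J0 + n) ev ev' x.1 x.2, agr J0 N0 h0 x.1 x.2 & Inv (J0 + n) x.1 x.2].
pose R n (x y : (nat -> nat) * (word -> word)) := agr (J0 + n) x.1 x.2 y.1 y.2.
have [||f [_ fP]] := @dep_choice _ P R (N0, h0).
- by rewrite /P addn0.
- move=> n [N h] [/= p ag iv].
  have [N' [h' [p' ag' iv']]] := st _ _ _ (leq_addr n J0) p ag iv.
  exists (N', h'); split; last exact: ag'.
  split; rewrite ?addnS //=; apply: agr_trans ag _.
  by apply: agr_le ag'; exact: leq_addr.
have mono n k : agr (J0 + n) (f n).1 (f n).2 (f (n + k)).1 (f (n + k)).2.
  elim: k => [|k IH]; first by rewrite addn0.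
  apply: agr_trans IH _; rewrite addnS.
  apply: agr_le (fP (n + k)).2; by rewrite leq_add2l leq_addr.
pose N i := (f i.+1).1 i; pose h s := (f (size s).+1).2 s.
have ag n : agr (J0 + n) (f n).1 (f n).2 N h.
  split=> [i lt|s lt].
    rewrite /N; have [le|le] := leqP n i.+1.
      by have [-> //] := mono n (i.+1 - n); rewrite subnKC.
    have [q _] := mono i.+1 (n - i.+1); rewrite subnKC in q; last exact: ltnW.
    by rewrite q // addnS ltnS leq_addl.
  rewrite /h; have [le|le] := leqP n (size s).+1.
    by have [_ -> //] := mono n ((size s).+1 - n); rewrite subnKC.
  have [_ q] := mono (size s).+1 (n - (size s).+1); rewrite subnKC in q; last exact: ltnW.
  by rewrite q // addnS ltnS leq_addl.
exists N, h; split.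
- move=> J; apply: (@pemb_le _ (J0 + J)); first exact: leq_addl.
  by apply: (eq_pemb w) (ag J) _ => //; case: (fP J) => -[].
- have [[_ a0 _] _] := fP 0; apply: agr_trans a0 _.
  by have := ag 0; rewrite addn0.
- move=> i le; exists (f (i - J0)).1, (f (i - J0)).2.
  have [[_ _ iv] _] := fP (i - J0); have := ag (i - J0).
  by rewrite subnKC // in iv *.
Qed.

End Diaries.

(** * The generic diary and partition lemmas *)

Lemma inj_unbounded (f : nat -> nat) : injective f -> forall M, exists j, M <= f j.
Proof.
move=> fi M; apply: contrapT => /forallNP nle.
have lt j : f j < M by rewrite ltnNge; apply/negP; exact: nle.
have sub : {subset map f (iota 0 M.+1) <= iota 0 M}.
  by move=> _ /mapP [j _ ->]; rewrite mem_iota /= lt.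
have := uniq_leq_size _ sub; rewrite map_inj_uniq // iota_uniq => /(_ isT).
by rewrite size_map !size_iota ltnn.
Qed.

Section Generic.
Variable S : setup.

(** Step [m] tries the event coded by [m], padded to length [m]. The number paired with the event
    only serves to make every event be tried infinitely often. *)
Definition gstep m (h : seq (event S)) : event S :=
  if (unpickle m : option (event S * nat)) is Some (e, _) then
    if `[< wfe m (emap (@padto S m) e) /\ valid (emap (@padto S m) e :: h) >]
    then emap (@padto S m) e else Noop
  else Noop.

Fixpoint ghist m := if m is m'.+1 then gstep m' (ghist m') :: ghist m' else [::].

Definition gen m := gstep m (ghist m).

Lemma hist_gen m : hist gen m = ghist m.
Proof. by elim: m => //= m ->. Qed.

Lemma valid_gen m : valid ([::] : seq (event S)) -> valid (hist gen m).
Proof.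
move=> v0; rewrite hist_gen; elim: m => //= m IH.
rewrite {1}/gstep; case: (unpickle m) => [[e j]|] //=.
by case: ifP => // /asboolP [].
Qed.

Lemma wfev_gen : wfev gen.
Proof.
move=> m; rewrite /gen /gstep; case: (unpickle m) => [[e j]|] //=.
by case: ifP => // /asboolP [].
Qed.

Lemma valid_padto ev n m (e : event S) : valid (hist ev m) -> n <= m ->
  wfe n e -> valid (e :: hist ev n) -> valid (emap (@padto S m) e :: hist ev m).
Proof.
move=> v le; case: e => [|c ka|u w] wE //.
  (* [wid S] is positive, so the empty structure realizes no constraint. *)
  move=> _; split=> //; move=> [f _].
  by have := f (Ordinal (ltnW (wid1 S))).
rewrite /valid /= => al.
have q := @allowed_pad S ev n m _ _ _ v le _ al.
have {}q := q (fun a => match a with Some z => match z with end | None => wE end).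
by congr (allowed _ _ _): q; apply/funext => -[[]|].
Qed.

Lemma gen_often n (e : event S) m0 : valid ([::] : seq (event S)) ->
  wfe n e -> valid (e :: hist gen n) ->
  exists m, [/\ m0 <= m, n <= m & gen m = emap (@padto S m) e].
Proof.
move=> v0 w ve.
have [j] := @inj_unbounded (fun j => pickle (e, j)) (fun i j q =>
  congr1 snd (pcan_inj (@pickleK _) q)) (maxn m0 n).
rewrite geq_max => /andP [le0 le].
exists (pickle (e, j)); split=> //.
rewrite /gen /gstep pickleK; case: asboolP => // -[]; split.
  apply: wfe_map w _ => s ss; by rewrite size_padto ?ss.
rewrite -hist_gen; apply: valid_padto ve => //; exact: valid_gen.
Qed.

End Generic.

(** * Partition lemmas on the natural numbers and on large sets *)

Section Combinatorics.

Lemma pigeonhole_often (C : finType) (k : nat -> C) :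
  exists c, forall N, exists2 n, N <= n & k n = c.
Proof.
apply: contrapT => /forallNP nc.
have bd c : exists N, forall n, N <= n -> k n <> c.
  have /existsNP [N nN] := nc c; exists N => n le kn.
  by apply: nN; exists n.
have [b bP] := choice bd.
by have := bP (k (\max_c b c)) _ (leq_bigmax _).
Qed.

Lemma often_increasing (P : nat -> Prop) :
  (forall N, exists2 n, N <= n & P n) ->
  exists e : nat -> nat, (forall i j, i < j -> e i < e j) /\ forall n, P (e n).
Proof.
move=> often.
have [n0 _ P0] := often 0.
have [||e [_ eP]] := @dep_choice _ (fun _ => P) (fun _ x y => x < y) n0 => //.
  by move=> _ x _; have [y lt Py] := often x.+1; exists y.
exists e; split=> [|n]; last exact: (eP n).1.
by apply: (@homo_ltn _ e (fun x y => x < y)) => [x y z|i]; [exact: ltn_trans|exact: (eP i).2].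
Qed.

Lemma incr_le (f : nat -> nat) i j : (forall i j, i < j -> f i < f j) ->
  (f i < f j) = (i < j).
Proof.
move=> fi; case: (ltngtP i j) => [/fi -> //|ji|->]; last by rewrite ltnn.
by apply/negbTE; rewrite -leqNgt ltnW // fi.
Qed.

Lemma ramsey d (C : finType) (c : seq nat -> C) :
  exists f : nat -> nat, (forall i j, i < j -> f i < f j) /\
    exists c0, forall s, sorted ltn s -> size s = d -> c (map f s) = c0.
Proof.
elim: d c => [|d IH] c.
  by exists id; split=> //; exists (c [::]) => -[].
pose incr (g : nat -> nat) := forall i j, i < j -> g i < g j.
pose R (_ : nat) (g g' : nat -> nat) := (exists f, incr f /\ g' = g \o succn \o f) /\
  exists c0, forall s, sorted ltn s -> size s = d -> c (g 0 :: map g' s) = c0.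
have [||g [_ gP]] := @dep_choice _ (fun _ => incr) R id => //.
  move=> n g gi.
  have [f [fi [c0 fc]]] := IH (fun s => c (g 0 :: map (g \o succn) s)).
  exists (g \o succn \o f); split; first by move=> i j /fi lt; apply: gi; rewrite /= ltnS.
  split; first by exists f.
  by exists c0 => s ss sd; rewrite -(fc s) // -map_comp.
have gi n : incr (g n) := (gP n).1.
pose a n := g n 0.
have sub n m x : exists y, (n.+1 <= n.+1 + m) /\ g (n.+1 + m) x = g n.+1 y.
  elim: m x => [|m IHm] x; first by exists x; rewrite addn0.
  have [_ [[f [_ gE]] _]] := gP (n.+1 + m).
  have [y [_ yE]] := IHm (f x).+1.
  by exists y; rewrite leq_addr addnS gE /= yE.
have ai : incr a.
  apply: (@homo_ltn _ a (fun x y => x < y)) => [x y z|i]; first exact: ltn_trans.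
  have [_ [[f [_ gE]] _]] := gP i.
  by rewrite /a gE /=; exact: gi.
have col n : exists c0, forall s, sorted ltn s -> size s = d ->
    (forall x, x \in s -> n < x) -> c (a n :: map a s) = c0.
  have [_ [_ [c0 cP]]] := gP n; exists c0 => s ss sd sn.
  have ex m : exists y, n < m -> a m = g n.+1 y.
    have [lt|] := boolP (n < m); last by exists 0.
    have [y [_ yE]] := sub n (m - n.+1) 0; exists y => _.
    by rewrite -yE subnKC.
  have [y yP] := choice ex.
  have -> : map a s = map (g n.+1) (map y s).
    by rewrite -map_comp; apply/eq_in_map => x /sn /yP.
  apply: cP; last by rewrite size_map.
  apply: (homo_sorted_in (P := [in s])) ss; last by apply/allP.
  move=> x x' xs xs' lt.
  have : g n.+1 (y x) < g n.+1 (y x') by rewrite -!yP ?sn // ai.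
  by rewrite incr_le //; exact: gi.
have [k kP] := choice col.
have [c0 often] := pigeonhole_often k.
have [e [ei ec]] := often_increasing often.
exists (a \o e); split; first by move=> i j /ei /ai.
exists c0 => -[|x s] //= ps [sd]; rewrite -(ec x) -(kP (e x) (map e s)).
- by rewrite -map_comp.
- by rewrite sorted_map; apply: sub_sorted (path_sorted ps) => ? ? /ei.
- by rewrite size_map.
- move=> _ /mapP [z zs ->]; apply: ei.
  by have /allP := order_path_min ltn_trans ps; exact.
Qed.

(** The large set is an iterated power set. If all fibres of [F] on [Y -> bool] were countable, then
    [Y -> bool] would inject into [Y]; so some fibre is infinite and supplies the last coordinate,
    and induction applies to the common value [F0]. *)
Lemma polarized q : exists (Z : Type) (z0 : Z), forall f : seq Z -> nat,
  exists a : nat -> nat -> Z, (forall i, injective (a i)) /\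
    exists c, forall g : nat -> nat, f (mkseq (fun i => a i (g i)) q) = c.
Proof.
elim: q => [|q [Z [z0 IH]]].
  exists nat, 0 => f; exists (fun _ n => n); split; first by move=> i n n'.
  by exists (f [::]).
pose Y : Type := ((seq Z -> nat) * nat)%type.
exists (Z + (Y -> bool))%type, (inl z0) => f.
pose F (b : Y -> bool) (s : seq Z) := f (rcons (map inl s) (inr b)).
have [F0 [be [bi bF]]] : exists F0, exists be : nat -> (Y -> bool),
    injective be /\ forall n, F (be n) = F0.
  apply: contrapT => /forallNP nF.
  have cnt F0 : exists ka : (Y -> bool) -> nat,
      {in [set b | F b = F0]%classic &, injective ka}.
    apply/countable_injP.
    have [/finite_set_countable //|/infiniteP] := pselect (finite_set [set b | F b = F0]%classic).
    move=> /ppcard_leP [be]; case: (nF F0); exists be; split.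
      by apply: in2TT; exact: (@inj _ _ _ be).
    by move=> n; exact: (@funS _ _ _ _ be n).
  have [ka kaP] := choice cnt.
  pose e b : Y := (F b, ka (F b) b).
  have ei : injective e.
    move=> b b' [eF ek]; apply: (kaP (F b)); rewrite ?inE //; last by rewrite {2}eF.
  (* Cantor's diagonal set for the injection [e]. *)
  pose D (y : Y) : bool := `[< exists b, e b = y /\ ~~ b y >].
  case DD: (D (e D)).
    have /asboolP [b [/ei ->]] := DD; by rewrite DD.
  have /negP := negbT DD; apply; apply/asboolP; exists D; by rewrite DD.
have [a [ai [c ac]]] := IH F0.
exists (fun i n => if i == q then inr (be n) else inl (a i n)); split.
  by move=> i; case: eqP => _ n n' => [[/bi]|[/ai]].
exists c => g; rewrite -(ac g) -(bF (g q)) /F /mkseq -map_comp.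
rewrite -addn1 iotaD map_cat /= eqxx cats1; congr (f (rcons _ _)).
apply/eq_in_map => i; rewrite mem_iota /= add0n => lt.
by rewrite ltn_eqF.
Qed.

(** By Ramsey, whether two names coincide depends only on the coordinatewise comparison of the two
    grid points. A coincidence is then copied to three points in the same relative position, and
    transitivity gives a coincidence at a single point, where the names are distinct. *)
Lemma no_clash (I : eqType) n k (be : seq nat -> 'I_k -> I) M :
  (forall u, size u = n -> injective (be u)) ->
  exists b : nat -> nat -> nat, (forall i, injective (b i)) /\
    forall u u', size u = n -> size u' = n ->
      all (fun m => m < M) u -> all (fun m => m < M) u' ->
    forall j j', be (mkseq (fun i => b i (nth 0 u i)) n) j =
      be (mkseq (fun i => b i (nth 0 u' i)) n) j' -> j = j'.
Proof.
move=> bi.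
pose T := (({ffun 'I_n -> 'I_(n.*2)} * {ffun 'I_n -> 'I_(n.*2)}) * ('I_k * 'I_k))%type.
pose pt (A : seq nat) (v : {ffun 'I_n -> 'I_(n.*2)}) : seq nat :=
  [seq nth 0 A (v i) | i <- enum 'I_n].
pose c (A : seq nat) : {ffun T -> bool} :=
  [ffun x : T => be (pt A x.1.1) x.2.1 == be (pt A x.1.2) x.2.2].
have [f [fi [c0 fc]]] := ramsey n.*2 c.
(* Coordinate [i] takes its values in its own block of length [W], so that the order between
   different coordinates is fixed. The 4 makes room for the values 0, 1, 2 used below and for one
   successor. *)
pose W := M + 4.
pose b i m := f (i * W + m).
have gr (y : nat -> nat) : mkseq (fun i => b i (y i)) n =
    [seq b i (y i) | i : 'I_n <- enum 'I_n].
  by rewrite /mkseq -val_enum_ord -map_comp.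
have key (u u' x x' : nat -> nat) : (forall i, i < n -> [/\ u i + 1 < W, u' i + 1 < W,
      x i + 1 < W & x' i + 1 < W]) ->
    (forall i, i < n -> (u i < u' i) = (x i < x' i) /\ (u' i < u i) = (x' i < x i)) ->
    forall j j', (be (mkseq (fun i => b i (u i)) n) j == be (mkseq (fun i => b i (u' i)) n) j') =
      (be (mkseq (fun i => b i (x i)) n) j == be (mkseq (fun i => b i (x' i)) n) j').
  move=> bd cmp j j'.
  have h0 (i : 'I_n) : i.*2 < n.*2 by rewrite ltn_double.
  have h1 (i : 'I_n) : i.*2.+1 < n.*2 by rewrite ltn_Sdouble.
  pose v : {ffun 'I_n -> 'I_(n.*2)} := [ffun i : 'I_n =>
    if u' i < u i then Ordinal (h1 i) else Ordinal (h0 i)].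
  pose v' : {ffun 'I_n -> 'I_(n.*2)} := [ffun i : 'I_n =>
    if u i < u' i then Ordinal (h1 i) else Ordinal (h0 i)].
  (* Two grid points become one increasing tuple with two slots per coordinate; where they agree,
     the second slot gets the dummy value [(y i).+1]. *)
  pose A (y y' : nat -> nat) := mkseq (fun e => let i := e./2 in
    let lo := minn (y i) (y' i) in
    let hi := if y i == y' i then (y i).+1 else maxn (y i) (y' i) in
    i * W + (if odd e then hi else lo)) n.*2.
  have srt (y y' : nat -> nat) : (forall i, i < n -> y i + 1 < W /\ y' i + 1 < W) ->
      sorted ltn (A y y').
    move=> yb; rewrite /A /mkseq.
    apply: (homo_sorted_in (P := [in iota 0 n.*2]) (e := ltn)); last exact: iota_ltn_sorted.
    - move=> e e' en0 en0' lt.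
      have en : e < n.*2 by move: en0; rewrite -topredE /= mem_iota.
      have en' : e' < n.*2 by move: en0'; rewrite -topredE /= mem_iota.
      have hn : e./2 < n by lia.
      have hn' : e'./2 < n by lia.
      have [b1 b2] := yb _ hn; have [b3 b4] := yb _ hn'.
      have [eq|ne] := eqVneq e./2 e'./2.
        have o1 : odd e = false by lia.
        have o2 : odd e' = true by lia.
        rewrite -eq o1 o2; set i := e./2.
        by case: eqP => [->|]; lia.
      have lt2 : e./2 < e'./2 by lia.
      have lt3 : (e./2).+1 * W <= e'./2 * W by rewrite leq_mul2r lt2 orbT.
      rewrite mulSn in lt3; set i := e./2 in b1 b2 lt3 *; set i' := e'./2 in b3 b4 lt3 *.
      by case: (odd e); case: (odd e'); do ?case: ifP => _; lia.
    - by apply/allP.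
  have sz (y y' : nat -> nat) : size (A y y') = n.*2 by rewrite size_mkseq.
  have nA (y y' : nat -> nat) e : e < n.*2 -> nth 0 (map f (A y y')) e = f (nth 0 (A y y') e).
    by move=> lt; rewrite (nth_map 0) // sz.
  have pv (y y' : nat -> nat) : (forall i, i < n -> (u i < u' i) = (y i < y' i) /\ (u' i < u i) = (y' i < y i)) ->
      pt (map f (A y y')) v = mkseq (fun i => b i (y i)) n /\
      pt (map f (A y y')) v' = mkseq (fun i => b i (y' i)) n.
    move=> cm; rewrite /pt !gr; split.
      apply: eq_map => i /=; rewrite /b ffunE (cm i (ltn_ord i)).2.
      case: ltnP => /= le; rewrite nA // nth_mkseq // /= ?uphalf_double ?odd_double ?doubleK /=; congr (f (_ + _)).
        by case: eqP; lia.
      by lia.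
    apply: eq_map => i /=; rewrite /b ffunE (cm i (ltn_ord i)).1.
    case: ltnP => /= le; rewrite nA // nth_mkseq // /= ?uphalf_double ?odd_double ?doubleK /=; congr (f (_ + _)).
      by case: eqP; lia.
    by lia.
  have e1 := fc (A u u') (srt u u' _) (sz _ _).
  have e2 := fc (A x x') (srt x x' _) (sz _ _).
  have {e1 e2} : c (map f (A u u')) = c (map f (A x x')).
    by rewrite e1 ?e2 // => i /bd [].
  move=> /ffunP /(_ ((v, v'), (j, j'))); rewrite !ffunE /=.
  have [-> ->] := pv u u' (fun i _ => conj erefl erefl).
  by have [-> ->] := pv x x' cmp.
exists b; split.
  move=> i m m' /eqP; rewrite /b; case: (ltngtP m m') => // lt.
    by have := fi (i * W + m) (i * W + m'); rewrite ltn_add2l => /(_ lt); case: ltngtP.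
  by have := fi (i * W + m') (i * W + m); rewrite ltn_add2l => /(_ lt); case: ltngtP.
move=> u u' zu zu' bu bu' j j' /eqP E.
pose w := nth 0 u; pose w' := nth 0 u'.
(* In every coordinate the pairs [(w, w')], [(x, 1)], [(x, z)] and [(1, z)] compare alike. *)
pose x i := if w i < w' i then 0 else if w' i < w i then 2 else 1.
pose z i := if w i < w' i then 2 else if w' i < w i then 0 else 1.
have bd i : i < n -> w i < M /\ w' i < M.
  move=> lt; split; [apply: (allP bu)|apply: (allP bu')]; apply: mem_nth; by rewrite ?zu ?zu'.
have t1 : be (mkseq (fun i => b i (x i)) n) j = be (mkseq (fun i => b i 1) n) j'.
  apply/eqP; rewrite -(key w w' x (fun=> 1) _ _ j j') ?E // => i lt.
    by have [b1 b2] := bd i lt; rewrite /x /W; case: (ltngtP (w i) (w' i)) => _; split; lia.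
  by rewrite /x; case: (ltngtP (w i) (w' i)).
have t2 : be (mkseq (fun i => b i (x i)) n) j = be (mkseq (fun i => b i (z i)) n) j'.
  apply/eqP; rewrite -(key w w' x z _ _ j j') ?E // => i lt.
    by have [b1 b2] := bd i lt; rewrite /x /z /W; case: (ltngtP (w i) (w' i)) => _; split; lia.
  by rewrite /x /z; case: (ltngtP (w i) (w' i)).
have t3 : be (mkseq (fun i => b i 1) n) j = be (mkseq (fun i => b i (z i)) n) j'.
  apply/eqP; rewrite -(key w w' (fun=> 1) z _ _ j j') ?E // => i lt.
    by have [b1 b2] := bd i lt; rewrite /z /W; case: (ltngtP (w i) (w' i)) => _; split; lia.
  by rewrite /z; case: (ltngtP (w i) (w' i)).
apply: (bi (mkseq (fun i => b i 1) n)); first by rewrite size_mkseq.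
by rewrite t3 -t2 t1.
Qed.

End Combinatorics.

(** * The pigeonhole principle *)

Section Words.
Variable S : setup.
Local Notation word := (word S).
Local Notation event := (event S).

Definition words n : seq word := map val (enum {: n.-tuple (letter S)}).

Lemma mem_words n s : (s \in words n) = (size s == n).
Proof.
apply/mapP/eqP => [[t _ ->]|E]; first exact: size_tuple.
by exists (tcast E (in_tuple s)); rewrite ?mem_enum //= val_tcast.
Qed.

Definition occ (e : event) : pred word :=
  match e with
  | Noop => pred0
  | Forbid c ka => [pred s | [exists i, ka i == s]]
  | Code u y => pred1 y
  end.

Lemma wfe_occ n e : wfe n e <-> forall s, occ e s -> size s = n.
Proof.
case: e => [|c ka|u y] //=.
  split=> [w s /existsP [i /eqP <-] //|w i]; apply: w; apply/existsP; by exists i.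
by split=> [w s /eqP ->|w] //; apply: w.
Qed.

Lemma occ_emap h e s : occ (emap h e) s -> exists2 s', occ e s' & s = h s'.
Proof.
case: e => [|c ka|u y] //= => [/existsP [i]|/eqP ->]; last by exists y => //=.
by rewrite ffunE => /eqP <-; exists (ka i) => //; apply/existsP; exists i.
Qed.

Lemma eq_emap_occ h h' e : emap h e = emap h' e <-> (forall s, occ e s -> h s = h' s).
Proof.
case: e => [|c ka|u y] //=.
  split=> [[/ffunP E] s /existsP [i /eqP <-]|E]; first by have := E i; rewrite !ffunE.
  by congr Forbid; apply/ffunP => i; rewrite !ffunE E //=; apply/existsP; exists i.
by split=> [[E] s /eqP -> //|->].
Qed.

Lemma valid_move (e : event) es es' (g : word -> word) :
  valid es' ->
  (forall (T : Type) (B : bstr S T) (la : T -> word), (forall x, occ e (la x)) ->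
     allowed es B la -> allowed es' B (g \o la)) ->
  valid (e :: es) -> valid (emap g e :: es').
Proof.
case: e => [|c ka|u y] //=.
  move=> v _ _; split=> // -[f _]; by have := f (Ordinal (ltnW (wid1 S))).
move=> v mv; rewrite /valid /= => al.
have {}al : allowed es (addv (vstr S) u (fun=> ord0)) (fun=> y).
  by congr (allowed _ _ _): al; apply/funext => -[[]|].
have q := mv _ _ (fun=> y) (fun=> eqxx y) al.
by congr (allowed _ _ _): q; apply/funext => -[[]|].
Qed.

Lemma sfx_inj (T : Type) (s1 s2 s : seq T) : size s1 = size s2 -> sfx s1 s -> sfx s2 s ->
  s1 = s2.
Proof. by move=> z /sfx_drop <- /sfx_drop <-; rewrite z. Qed.

Lemma gen_match ev n m0 i (g : word -> word) : valid ([::] : seq event) ->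
  wfe i (ev i) -> valid (ev i :: hist ev i) ->
  (forall s, size s = i -> size (g s) = n) ->
  (forall (T : Type) (B : bstr S T) (la : T -> word), (forall x, size (la x) = i) ->
     allowed (hist ev i) B la -> allowed (hist (@gen S) n) B (g \o la)) ->
  exists m, [/\ m0 <= m, n <= m & gen S m = emap (@padto S m \o g) (ev i)].
Proof.
move=> v0 w v zg mv.
have [||m [h1 h2 h3]] := @gen_often S n (emap g (ev i)) m0 v0.
- exact: wfe_map w zg.
- apply: valid_move v; first exact: valid_gen.
  by move=> T B la lo; apply: mv => x; exact: (wfe_occ _ _).1 w _ (lo x).
- by exists m; rewrite h3 emap_comp.
Qed.

End Words.

Section Pigeonhole.
Variable S : setup.
Local Notation word := (word S).
Local Notation event := (event S).
Local Notation G := (@gen S).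
Variable ev : nat -> event.
Hypothesis w : wfev ev.
Variables (J : nat) (Ne : nat -> nat) (he : word -> word) (C : finType).
Variable chi : (word -> word) -> C.
Hypothesis chi_loc : forall f f', (forall s, size s <= J -> f s = f' s) -> chi f = chi f'.
Hypothesis p0 : pemb J ev G Ne he.
Hypothesis v0 : valid ([::] : seq event).
Variables (Nx : nat -> nat) (hx : word -> word).
Hypothesis px : pemb J.+1 ev G Nx hx.
Variables (Z : Type) (z0 : Z).

Let N := base Ne J.
Let sg := cfor he.
Let Ws := words S J.
Let E := ev J.

(* Indices of the nodes of a condition: participants of the event [E], spare
   names, and copies of the other words of length [J] indexed by [Z]. *)
Definition index_type : Type := ((word + nat) + (word * Z))%type.
Local Notation ind := {classic index_type}.
Definition part (s : word) : ind := inl (inl s).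
Definition spare (n : nat) : ind := inl (inr n).
Definition copy (s : word) (z : Z) : ind := inr (s, z).

Lemma part_spare s n : part s <> spare n. Proof. by move=> e; have : (inl (inl s) : index_type) = inl (inr n) := e. Qed.
Lemma spare_part s n : spare n <> part s. Proof. by move/esym/part_spare. Qed.
Lemma part_copy s s' z : part s <> copy s' z.
Proof. by move=> e; have : (inl (inl s) : index_type) = inr (s', z) := e. Qed.
Lemma copy_part s s' z : copy s' z <> part s. Proof. by move/esym/part_copy. Qed.
Lemma copy_spare s n z : copy s z <> spare n.
Proof. by move=> e; have : (inr (s, z) : index_type) = inl (inr n) := e. Qed.
Lemma spare_copy s n z : spare n <> copy s z. Proof. by move/esym/copy_spare. Qed.
Lemma part_inj : injective part.
Proof. by move=> s s' e; have : (inl (inl s) : index_type) = inl (inl s') := e; case. Qed.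
Lemma spare_inj : injective spare.
Proof. by move=> s s' e; have : (inl (inr s) : index_type) = inl (inr s') := e; case. Qed.
Lemma copy_inj s z s' z' : copy s z = copy s' z' -> s = s' /\ z = z'.
Proof. by move=> e; have : (inr (s, z) : index_type) = inr (s', z') := e; case. Qed.

(** A condition is a finite approximation of the self-embedding under construction: it places the
    nodes [dm] at level [lv] of the generic diary. *)
Record cond := Cond { lv : nat; dm : seq ind; va : ind -> word }.

Definition wfc p := forall i, i \in dm p -> size (va p i) = lv p.

(** Since the final map has to preserve [allowed], an extension may not destroy any structure still
    possible over the old nodes. *)
Definition ext p q :=
  [/\ {subset dm p <= dm q}, lv p <= lv q,
      forall i, i \in dm p -> sfx (va p i) (va q i)
    & forall (T : Type) (B : bstr S T) (la : T -> ind), (forall x, la x \in dm p) ->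
        allowed (hist G (lv p)) B (va p \o la) -> allowed (hist G (lv q)) B (va q \o la)].

Lemma ext_refl p : ext p p.
Proof. by split=> // i _; exact: sfx_refl. Qed.

Lemma ext_trans p q r : ext p q -> ext q r -> ext p r.
Proof.
move=> [a1 a2 a3 a4] [b1 b2 b3 b4]; split.
- by move=> i /a1 /b1.
- exact: leq_trans b2.
- by move=> i ip; apply: sfx_trans (a3 i ip) (b3 i (a1 i ip)).
- by move=> T B la lp al; apply: b4 (a4 _ _ _ lp al) => x; exact: a1.
Qed.

Definition pos s := index s Ws.
(** A word occurring in [E] has one index for all [zs], because the event found in the generic diary
    dictates its image; any other word uses its own coordinate of [zs]. *)
Definition idx (zs : seq Z) s : ind :=
  if occ E s then part s else copy s (nth z0 zs (pos s)).

Definition wd_of (i : ind) : word :=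
  match i with inl (inl s) => s | inl (inr _) => [::] | inr (s, _) => s end.

Definition root zs := Cond N (map (idx zs) Ws) (sg \o wd_of).
Definition root0 := Cond N (map part [seq s <- Ws | occ E s]) (sg \o wd_of).

Lemma wd_idx zs s : wd_of (idx zs s) = s.
Proof. by rewrite /idx; case: ifP. Qed.

Lemma size_sg s : size s = J -> size (sg s) = N.
Proof. exact: size_cfor p0. Qed.

Lemma root_root0 zs : ext root0 (root zs).
Proof.
split=> //= [i /mapP [s]|i _]; last exact: sfx_refl.
rewrite mem_filter => /andP [os sW ->]; apply/mapP; exists s => //.
by rewrite /idx os.
Qed.

(** At a hit the participants are the nodes of a copy of [E], so [fill q zs] prolongs the copy [he]
    by one level whenever [q] extends [root zs]. *)
Definition hit q := G (lv q) = emap (va q \o part) E.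
Definition fill q zs s := if size s < J then he s else va q (idx zs s).

Lemma base_agr Nf hf : agr J Ne he Nf hf -> base Nf J = N.
Proof. by rewrite /N; case: (J) => //= j [-> //]. Qed.

Lemma cfor_agr Nf hf s : agr J Ne he Nf hf -> size s = J -> cfor hf s = sg s.
Proof. by move=> [_ a]; rewrite /sg; case: s => //= l s zs; rewrite a // -zs. Qed.

Lemma pemb_above Nf hf s : pemb J.+1 ev G Nf hf -> agr J Ne he Nf hf -> size s = J ->
  size (hf s) = Nf J /\ sfx (sg s) (hf s).
Proof.
move=> p a zs; split; first by case: p => _ b _ _ _; rewrite b zs.
rewrite -(cfor_agr a zs); have [_ _ c _ _] := p.
case: s zs => [|l s] /= zs; last by apply: c; rewrite zs.
by exists (hf [::]); rewrite cats0.
Qed.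

Lemma pemb_base Nf hf : pemb J.+1 ev G Nf hf -> agr J Ne he Nf hf -> N <= Nf J.
Proof.
move=> p a; have [|z1 z2] := @pemb_above Nf hf (nseq J l0) p a; first by rewrite size_nseq.
rewrite -z1 -(@size_sg (nseq J l0)) ?size_nseq //; exact: sfx_size.
Qed.

Lemma root_validE : valid (hist ev J) /\ valid (E :: hist ev J).
Proof.
have [a b c d e] := px.
have vJ : valid (hist ev J).
  apply/(e J (ltnSn J)) => //.
  by apply: allowed_void (valid_gen (Nx J) v0).
split=> //.
have Hx : emap hx E = G (Nx J) by rewrite d.
have vx := valid_gen (Nx J).+1 v0; move: vx; rewrite /= -Hx.
move: vJ; rewrite /valid; have := w J; rewrite -/E; case: (E) => [|cc ka|u y] //= wy vJ.
  by move=> _; split=> // -[f _]; have := f (Ordinal (ltnW (wid1 S))).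
move=> al; apply/(e J (ltnSn J)); first by move=> [[]|].
by congr (allowed _ _ _): al; apply/funext => -[[]|].
Qed.

(** Extending [root0] keeps [E] legal at the present places of its participants, and the generic
    diary performs a padded copy of every legal event. *)
Lemma hit_exists p : wfc p -> ext root0 p -> exists q, [/\ wfc q, ext p q & hit q].
Proof.
move=> wp [e1 e2 e3 e4].
have wo s : occ E s -> part s \in dm root0.
  move=> os; apply/mapP; exists s => //; rewrite mem_filter os mem_words.
  by apply/eqP; apply: (wfe_occ J E).1 os; exact: w.
have [m [_ le gm]] : exists m, [/\ 0 <= m, lv p <= m &
    G m = emap (@padto S m) (emap (va p \o part) E)].
  apply: gen_often => //.
    apply/wfe_occ => s /occ_emap [s' os ->] /=; apply: wp; exact/e1/wo.
  have [_] := root_validE; apply: valid_move; first exact: valid_gen.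
  move=> T B la lo al; apply: (e4 _ _ (part \o la)); first by move=> x; apply: wo.
  move: al; rewrite (forced_iff B w p0) // => x.
  by apply: (wfe_occ J E).1 (lo x); exact: w.
exists (Cond m (dm p) (@padto S m \o va p)); split.
- by move=> i ip /=; rewrite size_padto ?wp // (wp i ip).
- split=> //= [i _|T B la lp al]; first exact: sfx_padto.
  apply: (@allowed_pad _ _ _ _ _ _ (va p \o la)) al => //; first exact: valid_gen.
  by move=> x; exact: wp.
- by rewrite /hit /= gm emap_comp.
Qed.

Record dec := Dec { d_p : cond; d_zs : seq Z; d_c : C }.

(** A forcing relation without a generic filter: a decision promises colour [d_c] for the copy
    [d_zs] beyond [d_p]. Finitely many promises whose conditions all lie below one [p] must be kept
    simultaneously by a single hit extending [p]. *)
Definition consis (D : set dec) :=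
  (forall d, D d -> wfc (d_p d) /\ ext (root (d_zs d)) (d_p d)) /\
  forall p (L : seq {classic dec}), wfc p -> ext root0 p ->
    (forall d : {classic dec}, d \in L -> D d /\ ext (d_p d) p) ->
    exists q, [/\ wfc q, ext p q, hit q &
      forall d : {classic dec}, d \in L -> chi (fill q (d_zs d)) = d_c d].

(** Consistency has finite character, so it passes to unions of chains. *)
Lemma consis_max : exists D, consis D /\ forall D', (D `<` D')%classic -> ~ consis D'.
Proof.
apply: Zorn_bigcup => F FC tot; split.
  by move=> d [D FD Dd]; exact: (FC D FD).1.
move=> p L wp ep LP.
have [L0|[D FD DP]] : L = [::] \/ exists2 D, F D & forall d : {classic dec}, d \in L -> D d.
- elim: L LP => [|d L IH] LP; first by left.
  right; have [|L0|[D FD DP]] := IH.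
  + by move=> d' d'L; apply: LP; rewrite in_cons d'L orbT.
  + have [[D FD Dd] _] := LP d (mem_head _ _); exists D => // d'.
    by rewrite L0 mem_seq1 => /eqP ->.
  + have [[D' FD' Dd] _] := LP d (mem_head _ _).
    have [DD|DD] := tot _ _ FD FD'.
      exists D' => // d'; rewrite in_cons => /predU1P [->|/DP] //; exact: DD.
    exists D => // d'; rewrite in_cons => /predU1P [->|/DP] //; exact: DD.
- by subst L; have [q [a b c]] := hit_exists wp ep; exists q; split.
- apply: (FC D FD).2 => // d dL; split; [exact: DP|exact: (LP d dL).2].
Qed.

(** If [zs] were undecided, each colour in turn could not be promised at the current condition. This
    leads to a stronger condition and finitely many old promises which together exclude all colours
    for [zs]; but consistency gives a hit keeping those promises, and it has a colour. *)
Lemma decided D zs : consis D -> (forall D', (D `<` D')%classic -> ~ consis D') ->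
  exists d, D d /\ d_zs d = zs.
Proof.
move=> [D1 D2] mx; apply: contrapT => /forallNP nd.
have wr : wfc (root zs).
  move=> i /mapP [s sW ->] /=; rewrite wd_idx; apply: size_sg.
  by apply/eqP; rewrite -mem_words.
have st (cs : seq C) : exists p (L : seq {classic dec}), [/\ wfc p, ext (root zs) p,
    forall d : {classic dec}, d \in L -> D d /\ ext (d_p d) p &
    forall q, wfc q -> ext p q -> hit q ->
      (forall d : {classic dec}, d \in L -> chi (fill q (d_zs d)) = d_c d) ->
      chi (fill q zs) \notin cs].
  elim: cs => [|c cs [p [L [wp rp LP LQ]]]].
    by exists (root zs), [::]; split=> //; exact: ext_refl.
  pose d0 := Dec p zs c.
  have nd0 : ~ D d0 by move=> Dd; apply: (nd d0).
  pose D' := (D `|` [set d0])%classic.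
  have : ~ consis D'.
    apply: mx; split; first by move=> d Dd; left.
    by move=> sub; apply: nd0; apply: sub; right.
  move=> /not_andP [nc|].
    by case: nc => d; rewrite /D' => -[/D1 //|-> /=].
  move=> /existsNP [p' /existsNP [L' /not_implyP [wp' /not_implyP [ep' /not_implyP [LP' nq]]]]].
  have [d0L|nd0L] := boolP ((d0 : {classic dec}) \in L'); last first.
    case: nq; apply: D2 => // d dL; have [[Dd|d0d] e] := LP' d dL; split=> //.
    by have dE : d = d0 := d0d; move: nd0L; rewrite -dE dL.
  have pp' : ext p p' := (LP' d0 d0L).2.
  exists p', (L ++ [seq d <- L' | d != (d0 : {classic dec})]); split=> //.
  - exact: ext_trans rp pp'.
  - move=> d; rewrite mem_cat mem_filter => /orP [/LP [Dd e]|/andP [ne dL]].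
      by split=> //; exact: ext_trans e pp'.
    by have [[Dd|d0d] e] := LP' d dL; split=> //; case/eqP: ne.
  - move=> q wq eq hq LQq; rewrite in_cons negb_or LQ //; last first.
    + by move=> d dL; apply: LQq; rewrite mem_cat dL.
    + exact: ext_trans pp' eq.
    rewrite andbT; apply/eqP => E1; apply: nq; exists q; split=> // d dL.
    have [->//|ne] := eqVneq (d : {classic dec}) d0.
    by apply: LQq; rewrite mem_cat mem_filter /= ne dL orbT.
have [p [L [wp rp LP LQ]]] := st (enum C).
have [q [wq eq hq Lq]] := D2 p L wp (ext_trans (root_root0 zs) rp) LP.
by have := LQ q wq eq hq Lq; rewrite mem_enum.
Qed.

Hypothesis polZ : forall f : seq Z -> nat, exists a : nat -> nat -> Z,
  (forall i, injective (a i)) /\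
  exists c, forall g : nat -> nat, f (mkseq (fun i => a i (g i)) (size Ws)) = c.

Lemma pos_lt s : s \in Ws -> pos s < size Ws. Proof. by rewrite index_mem. Qed.

(** The shape of the chosen decision, recorded in [data], takes countably many values, so
    [polarized] makes it constant on a grid. [no_clash] then puts an index common to two conditions
    at the same place of both domains, where it has the same value. [c], [l] and [t0] are fixed
    before [M], because the grid has to grow with the level treated. *)
Lemma grids D : consis D -> (forall D', (D `<` D')%classic -> ~ consis D') ->
  exists (c : C) (l : nat) (t0 : word -> word), forall M,
  exists (P : seq nat -> cond) (zz : seq nat -> seq Z) (A : nat -> nat -> Z),
  let gd u := size u = size Ws /\ all (fun m => m < M) u in
  [/\ forall i, injective (A i),
      forall u i, i < size Ws -> nth z0 (zz u) i = A i (nth 0 u i),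
      forall u, [/\ wfc (P u), ext (root (zz u)) (P u), lv (P u) = l,
         (forall s, s \in Ws -> va (P u) (idx (zz u) s) = t0 s)
         & D (Dec (P u) (zz u) c)],
      forall u u' i, gd u -> gd u' -> i \in dm (P u) -> i \in dm (P u') ->
         va (P u) i = va (P u') i
    & forall u u' s, gd u -> gd u' -> s \in Ws -> idx (zz u') s \in dm (P u) ->
         idx (zz u') s = idx (zz u) s].
Proof.
move=> cD mD.
have [d dP] := choice (fun zs => decided zs cD mD).
pose p zs := d_p (d zs).
pose nd zs := undup (dm (p zs)).
pose data zs := ((lv (p zs), d_c (d zs)), ([seq va (p zs) (idx zs s) | s <- Ws],
  [seq va (p zs) i | i <- nd zs], [seq index (idx zs s) (nd zs) | s <- Ws])).
have [a [ai [c0 ac]]] := polZ (fun zs => pickle (data zs)).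
pose n := size Ws.
pose zs0 := mkseq (fun i => a i 0) n.
have same g : data (mkseq (fun i => a i (g i)) n) = data zs0.
  by apply: (pcan_inj pickleK); rewrite ac -(ac (fun=> 0)).
exists (d_c (d zs0)), (lv (p zs0)), (fun s => va (p zs0) (idx zs0 s)) => M.
pose k := size (nd zs0).
pose be (u : seq nat) (j : 'I_k) : ind :=
  nth (spare 0) (nd (mkseq (fun i => a i (nth 0 u i)) n)) j.
have szk g : size (nd (mkseq (fun i => a i (g i)) n)) = k.
  have /(congr1 (fun x => size x.2.1.2)) := same g; by rewrite /= !size_map.
have [|b [bi bP]] := @no_clash _ n k be M.
  move=> u zu j j' /eqP; rewrite /be nth_uniq ?szk ?ltn_ord ?undup_uniq //.
  by move=> /eqP /val_inj.
pose zz (u : seq nat) := mkseq (fun i => a i (b i (nth 0 u i))) n.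
have beE u : be (mkseq (fun i => b i (nth 0 u i)) n) =1
    fun j => nth (spare 0) (nd (zz u)) j.
  move=> j; rewrite /be; suff -> : mkseq (fun i => a i (nth 0 (mkseq (fun i => b i (nth 0 u i)) n) i)) n = zz u by [].
  rewrite /zz /mkseq; apply/eq_in_map => i; rewrite mem_iota /= add0n => lt.
  by rewrite (nth_map 0) ?size_iota // nth_iota.
have szz u : size (nd (zz u)) = k by exact: szk.
have clash u u' j j' : size u = n -> size u' = n ->
      all (fun m => m < M) u -> all (fun m => m < M) u' -> j < k -> j' < k ->
      nth (spare 0) (nd (zz u)) j = nth (spare 0) (nd (zz u')) j' -> j = j'.
  move=> zu zu' bu bu' jk jk' e.
  have := bP u u' zu zu' bu bu' (Ordinal jk) (Ordinal jk').
  by rewrite !beE /= => /(_ e) [].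
have Dz u : D (Dec (p (zz u)) (zz u) (d_c (d zs0))).
  have [Dd Ez] := dP (zz u); have /(congr1 (fun x => x.1.2)) /= := same (fun i => b i (nth 0 u i)).
  rewrite -/(zz u) => <-; have eta (x : dec) : x = Dec (d_p x) (d_zs x) (d_c x) by case: x.
  by move: Dd; rewrite {1}[d _]eta Ez.
exists (fun u => p (zz u)), zz, (fun i m => a i (b i m)); split.
- by move=> i m m' /ai /bi.
- by move=> u i lt; rewrite nth_mkseq.
- move=> u; have [wf e] := cD.1 _ (Dz u); split=> //.
  + by have /(congr1 (fun x => x.1.1)) := same (fun i => b i (nth 0 u i)).
  + move=> s sW; have /(congr1 (fun x => nth [::] x.2.1.1 (index s Ws))) :=
      same (fun i => b i (nth 0 u i)).
    by rewrite /= !(nth_map [::]) ?index_mem // nth_index.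
- move=> u u' i [zu bu] [zu' bu'].
  rewrite -mem_undup -[i \in dm (p (zz u'))]mem_undup => iu iu'.
  have j1 : index i (nd (zz u)) < k by rewrite -(szz u) index_mem.
  have j2 : index i (nd (zz u')) < k by rewrite -(szz u') index_mem.
  have jj := clash u u' _ _ zu zu' bu bu' j1 j2.
  rewrite !nth_index // in jj; have {}jj := jj erefl.
  have /(congr1 (fun x => nth [::] x.2.1.2 (index i (nd (zz u))))) := same (fun i => b i (nth 0 u i)).
  have /(congr1 (fun x => nth [::] x.2.1.2 (index i (nd (zz u'))))) := same (fun i => b i (nth 0 u' i)).
  rewrite /= -/(zz u) -/(zz u') ![nth _ (map _ _) _](nth_map (spare 0)) ?szz ?jj ?index_mem //.
  by rewrite nth_index // => -> ; rewrite -jj nth_index // => ->.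
- move=> u u' s [zu bu] [zu' bu'] sW.
  rewrite -mem_undup => iu.
  have iu' : idx (zz u') s \in nd (zz u').
    by rewrite mem_undup; have [_ [sub _ _ _]] := cD.1 _ (Dz u'); apply: sub; exact: map_f.
  have j1 : index (idx (zz u') s) (nd (zz u)) < k by rewrite -(szz u) index_mem.
  have j2 : index (idx (zz u') s) (nd (zz u')) < k by rewrite -(szz u') index_mem.
  have jj := clash u u' _ _ zu zu' bu bu' j1 j2.
  rewrite !nth_index // in jj; have {}jj := jj erefl.
  have /(congr1 (fun x => nth 0 x.2.2 (index s Ws))) := same (fun i => b i (nth 0 u i)).
  have /(congr1 (fun x => nth 0 x.2.2 (index s Ws))) := same (fun i => b i (nth 0 u' i)).
  rewrite /= -/(zz u) -/(zz u') !(nth_map [::]) ?index_mem // !nth_index // => <-.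
  rewrite -jj => e.
  have iu2 : idx (zz u) s \in nd (zz u).
    by rewrite mem_undup; have [_ [sub _ _ _]] := cD.1 _ (Dz u); apply: sub; exact: map_f.
  by rewrite -(nth_index (spare 0) iu2) e nth_index.
Qed.

(** Both copies read off the same event of the generic diary. *)
Lemma occ_above Nf hf Nf' hf' s : pemb J.+1 ev G Nf hf -> pemb J.+1 ev G Nf' hf' ->
  Nf J = Nf' J -> occ E s -> hf s = hf' s.
Proof.
move=> [_ _ _ d _] [_ _ _ d' _] NN; apply: (eq_emap_occ _ _ E).1.
by rewrite /E -(d J) // -(d' J) // NN.
Qed.

Lemma sg_inj s s' : s \in Ws -> s' \in Ws -> sg s = sg s' -> s = s'.
Proof.
rewrite !mem_words => /eqP zs /eqP zs'; rewrite /sg; have := p0.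
case: s s' zs zs' => [|l s] [|l' s'] //= zs zs' p; rewrite -?zs // in zs'.
move=> [-> e]; congr cons; apply: (pemb_inj p) e; rewrite -?zs //.
by case: zs'.
Qed.

Section Step.
Variables (c : C) (l : nat) (t0 : word -> word).
Variable i : nat.
Variables (Ni : nat -> nat) (h : word -> word).
Hypothesis Nle : N <= i.
Hypothesis pi_ : pemb i G G Ni h.
Hypothesis agi : agr N id id Ni h.
(* A provisional image of the words of length [i]. *)
Variables (b' : nat) (g0 : word -> word).
Hypothesis le_b : base Ni i <= b'.
Hypothesis le_l : l <= b'.
Hypothesis g0P : forall s, size s = i -> size (g0 s) = b' /\ sfx (cfor h s) (g0 s).
Hypothesis g0a : forall (T : Type) (B : bstr S T) (la : T -> word), (forall x, size (la x) = i) ->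
    allowed (hist G (base Ni i)) B (cfor h \o la) -> allowed (hist G b') B (g0 \o la).
Hypothesis g0t : forall s s', s \in Ws -> size s' = i -> sfx (sg s) s' -> sfx (t0 s) (g0 s').

Let Wi := words S i.
Let n := size Ws.
Variables (P : seq nat -> cond) (zz : seq nat -> seq Z) (A : nat -> nat -> Z).
Let gd u := size u = n /\ all (fun m => m < size Wi) u.
Variable D : set dec.
Hypothesis cD : consis D.
Hypothesis Ai : forall j, injective (A j).
Hypothesis zA : forall u j, j < n -> nth z0 (zz u) j = A j (nth 0 u j).
Hypothesis PP : forall u, [/\ wfc (P u), ext (root (zz u)) (P u), lv (P u) = l,
         (forall s, s \in Ws -> va (P u) (idx (zz u) s) = t0 s)
         & D (Dec (P u) (zz u) c)].
Hypothesis Pva : forall u u' j, gd u -> gd u' -> j \in dm (P u) -> j \in dm (P u') ->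
         va (P u) j = va (P u') j.
Hypothesis Pidx : forall u u' s, gd u -> gd u' -> s \in Ws -> idx (zz u') s \in dm (P u) ->
         idx (zz u') s = idx (zz u) s.
Variables (Ny : nat -> nat) (hy : word -> word).
Hypothesis py : pemb J.+1 ev G Ny hy.
Hypothesis ay : agr J Ne he Ny hy.
Hypothesis Nyi : Ny J = i.

Definition grid_ok u := exists Nf hf, [/\ pemb J.+1 ev G Nf hf, agr J Ne he Nf hf, Nf J = i
  & u = [seq index (hf s) Wi | s <- Ws]].

Lemma grid_ok_gd u : grid_ok u -> gd u.
Proof.
move=> [Nf [hf [p a Nfi ->]]]; split; first by rewrite size_map.
apply/allP => _ /mapP [s sW ->]; rewrite index_mem mem_words -Nfi; apply/eqP.
by apply: (pemb_above p a _).1; apply/eqP; rewrite -mem_words.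
Qed.

(** Every extension with [J]-th level [i] is a point of a grid with one value per word of length
    [i]. The conditions [P u] at these points agree on common indices and amalgamate into one
    condition [Q] placing the words at [g0]. Consistency yields a hit beyond [Q] keeping all the
    promises, hence colour [c] for all these extensions. *)
Lemma step_exists : exists m t,
  [/\ forall s, size s = i -> size (t s) = m /\ sfx (g0 s) (t s), b' <= m,
    G m = emap t (G i),
    forall (T : Type) (B : bstr S T) (la : T -> word), (forall x, size (la x) = i) ->
      allowed (hist G b') B (g0 \o la) -> allowed (hist G m) B (t \o la)
  & forall Nf hf, pemb J.+1 ev G Nf hf -> agr J Ne he Nf hf -> Nf J = i ->
      chi (fun s => if size s < J then he s else t (hf s)) = c].
Proof.
have goody : grid_ok [seq index (hy s) Wi | s <- Ws] by exists Ny, hy.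
pose gds := [seq map val (u : seq 'I_(size Wi)) | u : n.-tuple 'I_(size Wi)].
have gdsP u : gd u -> u \in gds.
  move=> [zu bu]; apply/mapP.
  have [v vE] : exists v : seq 'I_(size Wi), map val v = u.
    elim: u bu {zu} => [|m u IH] /=; first by exists [::].
    by move=> /andP [lt /IH [v <-]]; exists (Ordinal lt :: v).
  have zv : size v == n by rewrite -zu -vE size_map.
  by exists (Tuple zv); rewrite ?mem_enum.
pose gl := [seq u <- gds | `[< grid_ok u >]].
have glP u : (u \in gl) <-> grid_ok u.
  rewrite mem_filter; split=> [/andP [/asboolP //]|gu].
  by apply/andP; split; [exact/asboolP|apply: gdsP; exact: grid_ok_gd].
pose dmU := flatten [seq dm (P u) | u <- gl].
have dmUP j : reflect (exists2 u, grid_ok u & j \in dm (P u)) (j \in dmU).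
  apply: (iffP flatten_mapP) => -[u /glP gu ju]; by exists u => //; apply/glP.
have sel0 s' : exists o : option word, match o with
    | Some s => s \in Ws /\ sfx (sg s) s'
    | None => forall s, s \in Ws -> ~ sfx (sg s) s' end.
  have [[s sP]|ns] := pselect (exists s, s \in Ws /\ sfx (sg s) s').
    by exists (Some s).
  by exists None => s sW sf; apply: ns; exists s.
have [sel selP] := choice sel0.
have selE s s' : s \in Ws -> sfx (sg s) s' -> sel s' = Some s.
  move=> sW sf; have := selP s'; case: (sel s') => [s''|/(_ s sW)] // [s''W sf'].
  congr Some; apply: sg_inj => //; apply: sfx_inj sf' sf.
  by rewrite !size_sg //; apply/eqP; rewrite -mem_words.
have [n0 n0P] : exists n0, forall m, spare m \in dmU -> m < n0.
  elim: (dmU) => [|j js [n0 IH]]; first by exists 0.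
  pose q := if j is inl (inr m) then m.+1 else 0.
  exists (maxn q n0) => m; rewrite in_cons => /predU1P [jE|/IH lt].
    by rewrite /q -jE /= leq_maxl.
  by rewrite leq_max lt orbT.
pose fresh s' : ind := spare (n0 + index s' Wi).
(* The index under which the conditions know a word of length [i]. Words above no [sg s], and words
   above an occurring [s] other than its actual image [hy s], belong to no condition and get fresh
   spare names. *)
pose jdx s' := if sel s' is Some s then
    if occ E s then if s' == hy s then part s else fresh s'
    else copy s (A (pos s) (index s' Wi))
  else fresh s'.
have fr s' : fresh s' \notin dmU.
  by apply/negP => /n0P; rewrite ltnNge leq_addr.
have jdx_inj s1 s2 : size s1 = i -> size s2 = i -> jdx s1 = jdx s2 -> s1 = s2.
  move=> z1 z2; have W1 : s1 \in Wi by rewrite mem_words z1.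
  have W2 : s2 \in Wi by rewrite mem_words z2.
  have frE : fresh s1 = fresh s2 -> s1 = s2.
    move=> /spare_inj /addnI e; by rewrite -(nth_index [::] W1) e nth_index.
  rewrite /jdx; case: (sel s1) => [r1|]; case: (sel s2) => [r2|] //.
  - case: (occ E r1); case: (occ E r2).
    + case e1 : (s1 == hy r1); case e2 : (s2 == hy r2).
      * by move=> /part_inj rr; rewrite (eqP e1) (eqP e2) rr.
      * by move/part_spare.
      * by move/spare_part.
      * exact: frE.
    + by case: (s1 == hy r1) => [/part_copy|/spare_copy].
    + by case: (s2 == hy r2) => [/copy_part|/copy_spare].
    + move=> /copy_inj [-> /Ai e].
      by rewrite -(nth_index [::] W1) e nth_index.
  - case: (occ E r1) => [|/copy_spare //].
    by case: (s1 == hy r1) => [/part_spare //|]; exact: frE.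
  - case: (occ E r2) => [|/spare_copy //].
    by case: (s2 == hy r2) => [/spare_part //|]; exact: frE.
have jgood Nf hf s : pemb J.+1 ev G Nf hf -> agr J Ne he Nf hf -> Nf J = i -> s \in Ws ->
    jdx (hf s) = idx (zz [seq index (hf s) Wi | s <- Ws]) s.
  move=> pf af Ji sW; rewrite /jdx /idx (selE s) //; last first.
    by apply: (pemb_above pf af _).2; apply/eqP; rewrite -mem_words.
  case: ifP => [os|nos].
    by rewrite (occ_above pf py) ?Nyi // eqxx.
  by rewrite zA ?pos_lt // (nth_map [::]) ?nth_index ?pos_lt.
have jin u s' : grid_ok u -> size s' = i -> jdx s' \in dm (P u) ->
    exists2 s, s \in Ws & jdx s' = idx (zz u) s /\ sel s' = Some s.
  move=> gu zs' ju; have jU : jdx s' \in dmU by apply/dmUP; exists u.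
  move: ju jU; rewrite /jdx; have := selP s'; case: (sel s') => [s [sW sf]|_]; last first.
    by move=> _ jU; have := fr s'; rewrite jU.
  case: ifP => [os|nos].
    case: ifP => [_|_ _ jU]; last by have := fr s'; rewrite jU.
    by move=> _ _; exists s => //; rewrite /idx os.
  move=> ju _; exists s => //; split=> //.
  (* Placing [s'] in coordinate [pos s] of [u] gives a grid point with [jdx s'] as root index, so
     [Pidx] applies. *)
  pose u' := set_nth 0 u (pos s) (index s' Wi).
  have [zu bu] := grid_ok_gd gu.
  have zu' : size u' = n.
    rewrite size_set_nth zu; apply/maxn_idPr; exact: pos_lt.
  have gu' : gd u'.
    split=> //; apply/(all_nthP 0) => j; rewrite zu' => lt.
    rewrite nth_set_nth /=; case: eqP => _; first by rewrite index_mem mem_words zs'.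
    by apply: (allP bu); apply: mem_nth; rewrite zu.
  have iE : idx (zz u') s = copy s (A (pos s) (index s' Wi)).
    by rewrite /idx nos zA ?pos_lt // nth_set_nth /= eqxx.
  rewrite -iE; apply: Pidx => //; by rewrite iE.
have vv0 j : exists v, forall u, grid_ok u -> j \in dm (P u) -> v = va (P u) j.
  have [/dmUP [u gu ju]|nj] := boolP (j \in dmU).
    by exists (va (P u) j) => u' gu' ju'; apply: Pva; rewrite ?ju //; exact: grid_ok_gd.
  by exists [::] => u gu ju; case/negP: nj; apply/dmUP; exists u.
have [vv vvQ] := choice vv0.
have vvP j u : grid_ok u -> j \in dm (P u) -> vv j = va (P u) j by move=> gu; exact: vvQ.
pose js := map jdx Wi.
have [wo woP] : exists wo : ind -> word, forall s', size s' = i -> wo (jdx s') = s'.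
  exists (fun j => nth [::] Wi (index j js)) => s' zs'.
  have W1 : s' \in Wi by rewrite mem_words zs'.
  have jj : jdx s' \in js by exact: map_f.
  apply: jdx_inj => //.
    by apply/eqP; rewrite -mem_words mem_nth // -(size_map jdx) index_mem.
  by rewrite -(nth_map _ (spare 0)) ?nth_index // -(size_map jdx) index_mem.
have jsP j : reflect (exists2 s', size s' = i & j = jdx s') (j \in js).
  apply: (iffP mapP) => -[s' h1 h2]; exists s' => //.
    by apply/eqP; rewrite -mem_words.
  by rewrite mem_words h1.
pose Q := Cond b' (js ++ dmU) (fun j => if j \in js then g0 (wo j) else padto b' (vv j)).
have szP u j : grid_ok u -> j \in dm (P u) -> size (vv j) = l.
  by move=> gu ju; rewrite (vvP j u) //; have [wf _ <- _ _] := PP u; exact: wf.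
have wQ : wfc Q.
  move=> j; rewrite mem_cat /=; case: ifP => [/jsP [s' zs' ->] _|_ /= /dmUP [u gu ju]].
    by rewrite woP // (g0P zs').1.
  by rewrite size_padto // (szP u).
have PQ u : grid_ok u -> ext (P u) Q.
  move=> gu; have [wf eR lvE tE _] := PP u; split=> /=.
  - by move=> j ju; rewrite mem_cat; apply/orP; right; apply/dmUP; exists u.
  - by rewrite lvE.
  - move=> j ju; case: ifP => [/jsP [s' zs' jE]|_]; last first.
      by rewrite (vvP j u) //; exact: sfx_padto.
    subst j; rewrite woP //; have [s sW [-> sE]] := jin _ _ gu zs' ju.
    rewrite tE //; apply: g0t => //; have := selP s'; by rewrite sE => -[].
  - move=> T B la lp al.
    have zva x : size ((va (P u) \o la) x) = l by rewrite /= -lvE wf.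
    rewrite lvE in al.
    (* Nodes outside [js] are padded. On [js], allowedness goes down from [t0] to [sg], across to
       [ev] at level [J], and up again through [hf] and [g0]. *)
    apply: (allowed_up (P := fun x => la x \in js) le_l zva _ _ _ al).
    + move=> x /=; apply: wQ; rewrite mem_cat; apply/orP; right; apply/dmUP.
      by exists u.
    + move=> x /=; case: ifP => [/jsP [s' zs' jE]|_]; last first.
        by rewrite (vvP (la x) u) //; exact: sfx_padto.
      have := lp x; rewrite jE woP // => ju; have [s sW [-> sE]] := jin _ _ gu zs' ju.
      rewrite tE //; apply: g0t => //; have := selP s'; by rewrite sE => -[].
    + by move=> x /negP /negbTE /= ->; rewrite (vvP (la x) u).
    + have [Nf [hf [pf af Ji uE]]] := gu.
      have wx (x : {x | la x \in js}) : exists s, s \in Ws /\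
          (la (sval x) = idx (zz u) s /\ wo (la (sval x)) = hf s).
        case: x => x /= /jsP [s' zs' jE]; have := lp x; rewrite jE => ju.
        have [s sW [jE2 sE]] := jin _ _ gu zs' ju; exists s; split=> //; split=> //.
        rewrite woP //; apply: jdx_inj => //.
          by rewrite -Ji; apply: (pemb_above pf af _).1; apply/eqP; rewrite -mem_words.
        by rewrite (jgood Nf hf) // jE2 uE.
      have [sx sxP] := choice wx.
      have zsx x : size (sx x) = J by apply/eqP; rewrite -mem_words; exact: (sxP x).1.
      pose B' := pull B (fun x : {x | la x \in js} => sval x).
      have a1 : allowed (hist G l) B' (t0 \o sx).
        move: al => /(allowed_pull (fun x : {x | la x \in js} => sval x)).
        congr allowed; apply/funext => x /=; have [sW [-> _]] := sxP x.
        by rewrite tE.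
      have lN : N <= l by have [_ le _ _] := eR; rewrite -lvE.
      have zt x : size ((t0 \o sx) x) = l.
        by have [sW _] := sxP x; rewrite /= -lvE -(tE _ sW); apply: wf;
          have [sub _ _ _] := eR; apply: sub; exact: map_f.
      have a2 : allowed (hist G N) B' (sg \o sx).
        apply: allowed_down lN _ zt _ a1 => x /=; first exact: size_sg.
        have [sW _] := sxP x; rewrite -(tE _ sW); have [sub _ sf _] := eR.
        by have := sf (idx (zz u) (sx x)); rewrite /= wd_idx; apply; exact: map_f.
      have a3 : allowed (hist ev J) B' sx by apply/(forced_iff _ w p0 zsx).
      have [_ _ _ _ e] := pf.
      have a4 : allowed (hist G i) B' (hf \o sx) by rewrite -Ji; apply/(e J (ltnSn J) _ _ _ zsx).
      have zh x : size ((hf \o sx) x) = i.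
        by rewrite -Ji; exact: (pemb_above pf af (zsx x)).1.
      have a5 := g0a zh ((forced_iff B' (@wfev_gen S) pi_ zh).1 a4).
      congr (allowed _ _ _): a5; apply/funext => -[x xj] /=.
      by rewrite xj; have [_ [_ ->]] := sxP (exist _ x xj).
have rQ : ext root0 Q.
  apply: ext_trans (PQ _ goody); have [_ eR _ _ _] := PP [seq index (hy s) Wi | s <- Ws].
  exact: ext_trans (root_root0 _) eR.
have [|q [wq eq hq chq]] := cD.2 Q [seq (Dec (P u) (zz u) c : {classic dec}) | u <- gl] wQ rQ.
  move=> d /mapP [u /glP gu ->] /=; split; last exact: PQ.
  by have [_ _ _ _] := PP u.
have [e1 e2 e3 e4] := eq.
have inQ s' : size s' = i -> jdx s' \in dm Q.
  by move=> zs'; rewrite mem_cat; apply/orP; left; apply/jsP; exists s'.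
have vaQ s' : size s' = i -> va Q (jdx s') = g0 s'.
  by move=> zs' /=; case: ifP => [_|/negP []]; [rewrite woP|apply/jsP; exists s'].
exists (lv q), (va q \o jdx); split=> //.
- move=> s' zs' /=; split; first by apply: wq; apply: e1; exact: inQ.
  by rewrite -vaQ //; apply: e3; exact: inQ.
- rewrite hq; have [_ _ _ d _] := py; rewrite -Nyi d // emap_comp.
  apply/eq_emap_occ => s os /=.
  have zs : size s = J by apply: (wfe_occ J E).1 os; exact: w.
  rewrite /jdx (selE s) ?os ?eqxx // ?mem_words ?zs //.
  exact: (pemb_above py ay zs).2.
- move=> T B la zl al; apply: (e4 _ _ (jdx \o la)); first by move=> x; exact: inQ.
  by congr (allowed _ _ _): al; apply/funext => x /=; have /= -> := vaQ _ (zl x).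
- move=> Nf hf pf af Ji.
  pose u := [seq index (hf s) Wi | s <- Ws].
  have gu : grid_ok u by exists Nf, hf.
  have := chq (Dec (P u) (zz u) c) (map_f _ ((glP u).2 gu)); rewrite /= => <-.
  apply: chi_loc => s; rewrite /fill leq_eqVlt => /predU1P [zs|-> //].
  by rewrite zs ltnn /= (jgood Nf hf) // mem_words zs.
Qed.

End Step.

Lemma pigeonhole_spec : exists N' g, [/\ demb G G N' g, agr N id id N' g
  & exists c, forall Nf hf, pemb J.+1 ev G Nf hf -> agr J Ne he Nf hf -> chi (g \o hf) = c].
Proof.
have [D [cD mD]] := consis_max.
have [c [l [t0 gridP]]] := grids cD mD.
have zt0 s : s \in Ws -> size (t0 s) = l /\ sfx (sg s) (t0 s).
  have [P [zz [A [_ _ PP _ _]]]] := gridP 0; have [wf [sub le sf _] <- tE _] := PP [::].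
  move=> sW; rewrite -(tE _ sW); split.
    by apply: wf; apply: sub; exact: map_f.
  by have := sf (idx (zz [::]) s); rewrite /= wd_idx; apply; exact: map_f.
have lN : N <= l.
  by have [P [zz [A [_ _ PP _ _]]]] := gridP 0; have [_ [_ le _ _] <- _ _] := PP [::].
have at0 (T : Type) (B : bstr S T) (la : T -> word) : (forall x, la x \in Ws) ->
    allowed (hist G N) B (sg \o la) -> allowed (hist G l) B (t0 \o la).
  have [P [zz [A [_ _ PP _ _]]]] := gridP 0; have [wf [sub le sf ha] lE tE _] := PP [::].
  move=> lW al; rewrite -lE.
  have := ha T B (idx (zz [::]) \o la) (fun x => map_f _ (lW x)).
  have -> : va (root (zz [::])) \o (idx (zz [::]) \o la) = sg \o la.
    by apply/funext => x /=; rewrite wd_idx.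
  have -> : va (P [::]) \o (idx (zz [::]) \o la) = t0 \o la.
    by apply/funext => x /=; rewrite tE.
  exact.
(* The embedding must pass through [t0] above each [sg s], since this is where the grid conditions
   place those nodes; and the extensions already met have colour [c]. *)
pose Inv i (Ni : nat -> nat) (h : word -> word) :=
  (forall s s', s \in Ws -> size s' < i -> sfx (sg s) s' -> sfx (t0 s) (h s')) /\
  (forall Nf hf, pemb J.+1 ev G Nf hf -> agr J Ne he Nf hf -> Nf J < i -> chi (h \o hf) = c).
have szW s : s \in Ws -> size (sg s) = N.
  by rewrite mem_words => /eqP; exact: size_sg.
have [||||N' [g [dg ag IP]]] := @pemb_limit S G G N id id Inv.
- exact: wfev_gen.
- exact: pemb_id.
- split.
    by move=> s s' sW lt sf; have := sfx_size sf; rewrite szW // leqNgt lt.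
  by move=> Nf hf pf af; rewrite ltnNge (pemb_base pf af).
- move=> i Ni h Nle pi_ agi [I1 I2].
  (* Words of length [N] are first stretched to their prescribed images [t0]. *)
  have [b' [g0 [le_b le_l g0P g0a g0t]]] : exists b' g0, [/\ base Ni i <= b', l <= b',
      forall s, size s = i -> size (g0 s) = b' /\ sfx (cfor h s) (g0 s),
      forall (T : Type) (B : bstr S T) (la : T -> word), (forall x, size (la x) = i) ->
        allowed (hist G (base Ni i)) B (cfor h \o la) -> allowed (hist G b') B (g0 \o la)
      & forall s s', s \in Ws -> size s' = i -> sfx (sg s) s' -> sfx (t0 s) (g0 s')].
    move: Nle; rewrite leq_eqVlt => /predU1P [iN|lt]; last first.
      exists (base Ni i), (cfor h).
      have tt s s' : s \in Ws -> size s' = i -> sfx (sg s) s' -> sfx (t0 s) (cfor h s').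
        move=> sW zs' [[|e d] E1]; first by move: lt; rewrite -zs' E1 szW // ltnn.
        rewrite E1 /=; apply: sfx_trans (I1 s (d ++ sg s) sW _ _) _.
        - by rewrite -zs' E1 /=.
        - by exists d.
        - by exists [:: e].
      split=> //.
      + have [s0 s0W _] : exists2 s, s \in Ws & true.
          by exists (nseq J l0); rewrite // mem_words size_nseq.
        have z1 : size (nseq (i - N) l0 ++ sg s0) = i.
          by rewrite size_cat size_nseq szW // subnK // ltnW.
        rewrite -(size_cfor pi_ z1) -(zt0 s0 s0W).1; apply: sfx_size; apply: tt => //.
        by exists (nseq (i - N) l0).
      + by move=> s zs; split; [exact: (size_cfor pi_)|exact: sfx_refl].
    have cE s : size s = i -> cfor h s = s.
      have [_ ah] := agi; case: s => //= a s zs; by rewrite -ah // iN -zs.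
    have bE : base Ni i = N.
      by have [aN _] := agi; rewrite iN /base; case ij : i => [|j] //=; rewrite -aN // iN ij.
    have sel0 s' : exists t, (forall s, s \in Ws -> sg s = s' -> t = t0 s) /\
        ((forall s, s \in Ws -> sg s <> s') -> t = padto l s').
      have [[s [sW sE]]|ns] := pselect (exists s, s \in Ws /\ sg s = s').
        exists (t0 s); split; last by move=> /(_ s sW).
        by move=> s1 s1W; rewrite -sE => /(sg_inj s1W sW) ->.
      exists (padto l s'); split=> // s sW sE; by case: ns; exists s.
    have [g0 g0P] := choice sel0.
    have g0z s : size s = i -> size (g0 s) = l /\ sfx s (g0 s).
      move=> zs; have [[s1 [sW sE]]|ns] := pselect (exists s1, s1 \in Ws /\ sg s1 = s).
        by rewrite ((g0P s).1 s1 sW sE) -sE; exact: zt0.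
      rewrite (g0P s).2; last by move=> s1 sW sE; case: ns; exists s1.
      by split; [rewrite size_padto // zs -iN|exact: sfx_padto].
    exists l, g0; split=> //.
    + by rewrite bE.
    + by move=> s zs; rewrite cE //; exact: g0z.
    + move=> T B la zl; rewrite bE.
      have -> : cfor h \o la = la by apply/funext => x /=; rewrite cE.
      move=> al; rewrite -iN in zl.
      apply: (allowed_up (P := fun x => exists s, s \in Ws /\ sg s = la x) lN zl _ _ _ al).
      * by move=> x; apply: (g0z _ _).1; rewrite zl.
      * by move=> x; apply: (g0z _ _).2; rewrite zl.
      * move=> x nP; apply: (g0P _).2 => s sW sE; apply: nP; by exists s.
      * have [sx sxP] := choice (fun x : {x | exists s, s \in Ws /\ sg s = la x} => svalP x).
        have a1 : allowed (hist G N) (pull B (fun x : {x | exists s, s \in Ws /\ sg s = la x} => sval x)) (sg \o sx).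
          move: al => /(allowed_pull (fun x : {x | exists s, s \in Ws /\ sg s = la x} => sval x)).
          congr allowed; apply/funext => x /=; by rewrite (sxP x).2.
        have := at0 _ _ _ (fun x => (sxP x).1) a1.
        congr allowed; apply/funext => x /=.
        by rewrite ((g0P _).1 (sx x)) //; [exact: (sxP x).1|exact: (sxP x).2].
    + move=> s s' sW zs' [d E1]; rewrite ((g0P s').1 s) //; first exact: sfx_refl.
      have : size s' = size d + N by rewrite E1 size_cat szW.
      by rewrite zs' iN -{1}[i]add0n => /addIn/esym/size0nil d0; rewrite E1 d0.
  have [m [t [tz bm Gm ta tc]]] : exists m t,
    [/\ forall s, size s = i -> size (t s) = m /\ sfx (g0 s) (t s), b' <= m,
      G m = emap t (G i),
      forall (T : Type) (B : bstr S T) (la : T -> word), (forall x, size (la x) = i) ->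
        allowed (hist G b') B (g0 \o la) -> allowed (hist G m) B (t \o la)
    & forall Nf hf, pemb J.+1 ev G Nf hf -> agr J Ne he Nf hf -> Nf J = i ->
        chi (fun s => if size s < J then he s else t (hf s)) = c].
    have [[Ny [hy [py ay Nyi]]]|none] := pselect (exists Ny hy,
      [/\ pemb J.+1 ev G Ny hy, agr J Ne he Ny hy & Ny J = i]).
      have [P [zz [A [Ai zA PP Pva Pidx]]]] := gridP (size (words S i)).
      exact: (step_exists pi_ le_l g0P g0a g0t cD Ai zA PP Pva Pidx py ay Nyi).
    (* No extension has its [J]-th level at [i], so no colour is at stake and any later copy of the
       event [G i] will do. *)
    have [||||m [_ le Gm]] := @gen_match S G b' 0 i g0 v0.
    - exact: wfev_gen.
    - exact: (valid_gen i.+1).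
    - by move=> s zs; exact: (g0P s zs).1.
    - move=> T B la zl al; apply: g0a => //.
      by apply/(forced_iff B (@wfev_gen S) pi_ zl).
    exists m, (@padto S m \o g0); split=> //.
    - move=> s zs /=; split; last exact: sfx_padto.
      by rewrite size_padto // (g0P s zs).1.
    - move=> T B la zl al; apply: (@allowed_pad S G b' m _ _ (g0 \o la)) => //.
      + exact: valid_gen.
      + by move=> x; exact: (g0P _ (zl x)).1.
    - by move=> Nf hf pf af Ji; case: none; exists Nf, hf.
  exists (fun j => if j == i then m else Ni j), (fun s => if size s == i then t s else h s).
  have ag' := agr_upd i Ni h m t.
  split=> //.
  + apply: pemb_extend => //.
    * exact: wfev_gen.
    * exact: leq_trans bm.
    * move=> s zs; have [z1 z2] := tz s zs; split=> //.
      exact: sfx_trans (g0P s zs).2 z2.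
    * by move=> T B la zl al; apply: ta => //; exact: g0a.
  + split.
      move=> s s' sW; rewrite ltnS leq_eqVlt => /predU1P [zs'|lt] sf.
        by rewrite zs' eqxx; apply: sfx_trans (g0t s s' sW zs' sf) (tz s' zs').2.
      by rewrite ltn_eqF //; exact: I1.
    move=> Nf hf pf af; rewrite ltnS leq_eqVlt => /predU1P [Ji|lt].
      rewrite -(tc Nf hf pf af Ji); apply: chi_loc => s; have [a b _ _ _] := pf.
      rewrite leq_eqVlt => /predU1P [zs|lts] /=.
        by rewrite b ?zs // Ji eqxx ltnn.
      have bl : size (hf s) < N.
        rewrite b; last exact: ltnW.
        rewrite -(base_agr af); case: (J) lts a => //= j lts a; rewrite ltnS.
        by move: lts; rewrite ltnS leq_eqVlt => /predU1P [->//|lts]; apply/ltnW/a.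
      rewrite ltn_eqF ?(leq_trans bl) // lts; have [_ ah] := agi.
      by rewrite -ah //; have [_ af'] := af; rewrite af'.
    rewrite -(I2 Nf hf pf af lt); apply: chi_loc => s zs /=.
    rewrite ltn_eqF //; have [a b _ _ _] := pf; rewrite b //.
    move: zs; rewrite leq_eqVlt => /predU1P [->//|zs].
    exact: leq_ltn_trans (ltnW (a _ _ zs (ltnSn J))) lt.
- exists N', g; split=> //; exists c => Nf hf pf af.
  have [N1 [g1 [ag1 [_ I2]]]] := IP (Nf J).+1 (leqW (pemb_base pf af)).
  rewrite -(I2 Nf hf pf af (ltnSn _)); apply: chi_loc => s zs /=.
  have [_ ag2] := ag1; rewrite ag2 //; have [a b _ _ _] := pf; rewrite b // ltnS.
  move: zs; rewrite leq_eqVlt => /predU1P [->//|zs].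
  exact: ltnW (a _ _ zs (ltnSn J)).
Qed.

End Pigeonhole.

Lemma pigeonhole (S : setup) ev J Ne he (C : finType) (chi : (word S -> word S) -> C) (c0 : C) :
  wfev ev -> (forall f f', (forall s, size s <= J -> f s = f' s) -> chi f = chi f') ->
  valid ([::] : seq (event S)) -> pemb J ev (@gen S) Ne he ->
  exists N' g, [/\ demb (@gen S) (@gen S) N' g, agr (base Ne J) id id N' g
  & exists c, forall Nf hf, pemb J.+1 ev (@gen S) Nf hf -> agr J Ne he Nf hf ->
      chi (g \o hf) = c].
Proof.
move=> w loc v0 p.
have [[Nx [hx [px ax]]]|none] := pselect (exists Nx hx,
    pemb J.+1 ev (@gen S) Nx hx /\ agr J Ne he Nx hx).
  have [Z [z0 polZ]] := polarized (size (words S J)).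
  exact: (pigeonhole_spec w loc p v0 px z0 polZ).
exists id, id; split; [exact: pemb_id|exact: agr_refl|].
by exists c0 => Nf hf pf af; case: none; exists Nf, hf.
Qed.

(** * Fusion and the Ramsey theorem *)

Lemma finitely_many_functions (A B : eqType) (D : seq A) (R : seq B) (b0 : B) :
  exists es : seq {classic A -> B}, forall h : A -> B, (forall a, a \in D -> h a \in R) ->
    exists2 e : {classic A -> B}, e \in es & forall a, a \in D -> h a = (e : A -> B) a.
Proof.
elim: D => [|a D [es esP]].
  by exists [:: (fun=> b0) : {classic A -> B}] => h _; exists (fun=> b0) => //; rewrite mem_head.
exists [seq (fun x => if x == a then b else (e : A -> B) x) : {classic A -> B} | e <- es, b <- R].
move=> h hR; have [|e ees he] := esP h.
  by move=> x xD; apply: hR; rewrite in_cons xD orbT.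
exists (fun x => if x == a then h a else (e : A -> B) x).
  by apply/allpairsP; exists (e, h a); split=> //=; apply: hR; rewrite mem_head.
by move=> x; rewrite in_cons; case: eqP => [->|_] //= /he.
Qed.

Section Fusion.
Variable S : setup.
Local Notation word := (word S).
Local Notation event := (event S).
Local Notation G := (@gen S).
Hypothesis v0 : valid ([::] : seq event).

Lemma pemb_agr J ev ev1 ev' N h N' h' : pemb J ev ev' N h -> pemb J ev1 ev' N' h' ->
  (forall s, size s < J -> h s = h' s) -> agr J N h N' h' (S := S).
Proof.
move=> [_ b _ _ _] [_ b' _ _ _] E; split=> // i iJ.
have z : size (nseq i l0 : word) < J by rewrite size_nseq.
by have := b _ z; rewrite E // b' // size_nseq.
Qed.

Section Ext.
Variables (ev : nat -> event) (J : nat) (C : finType).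
Variable chi : (word -> word) -> C.
Hypothesis w : wfev ev.
Hypothesis loc : forall f f', (forall s, size s <= J -> f s = f' s) -> chi f = chi f'.

Let settled n (L : word -> word) := forall Ne he, pemb J ev G Ne he -> base Ne J = n ->
  exists c, forall Nf hf, pemb J.+1 ev G Nf hf -> agr J Ne he Nf hf -> chi (L \o hf) = c.

Lemma size_below Ne he n s : pemb J ev G Ne he -> base Ne J = n -> size s < J ->
  size (he s) < n.
Proof.
move=> [a b _ _ _] <- lt; rewrite b //; case: (J) lt a => // j; rewrite ltnS => lt a.
by rewrite ltnS; move: lt; rewrite leq_eqVlt => /predU1P [->//|lt]; apply/ltnW/a.
Qed.

Lemma ext_comp Ne he n Nf hf N' g : pemb J ev G Ne he -> base Ne J = n ->
  pemb J.+1 ev G Nf hf -> agr J Ne he Nf hf -> demb G G N' g -> agr n id id N' g ->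
  pemb J.+1 ev G (N' \o Nf) (g \o hf) /\ agr J Ne he (N' \o Nf) (g \o hf).
Proof.
move=> p bn pf af dg ag; have pg := pemb_comp pf dg; split=> //.
apply: (pemb_agr p (pemb_le (leqnSn J) pg)) => s sJ /=.
have [_ <- //] := af; have [_ <- //] := ag; exact: (size_below p bn).
Qed.

(** Up to agreement, finitely many copies of the first [J] levels have base [n]. They are treated
    one after another by maps that fix everything below [n], so a copy once settled stays
    settled. *)
Lemma settle n (L : word -> word) : exists N' g, [/\ demb G G N' g, agr n id id N' g
  & settled n (L \o g)].
Proof.
pose D := flatten [seq words S j | j <- iota 0 J].
have DP s : (s \in D) = (size s < J).
  apply/flatten_mapP/idP => [[j]|lt]; first by rewrite mem_iota mem_words => /= jJ /eqP ->.
  by exists (size s); rewrite ?mem_iota // mem_words.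
pose R := flatten [seq words S j | j <- iota 0 n].
have RP s : (s \in R) = (size s < n).
  apply/flatten_mapP/idP => [[j]|lt]; first by rewrite mem_iota mem_words => /= jJ /eqP ->.
  by exists (size s); rewrite ?mem_iota // mem_words.
have [es esP] := finitely_many_functions D R ([::] : word).
suff [N' [g [dg ag gP]]] : exists N' g, [/\ demb G G N' g, agr n id id N' g
    & forall e : {classic word -> word}, e \in es -> forall Ne he, pemb J ev G Ne he -> base Ne J = n ->
      (forall s, size s < J -> he s = (e : word -> word) s) ->
      exists c, forall Nf hf, pemb J.+1 ev G Nf hf -> agr J Ne he Nf hf ->
        chi (L \o g \o hf) = c].
  exists N', g; split=> // Ne he p bn.
  have [s|e ees eE] := esP he; first by rewrite DP RP; exact: size_below p bn.
  by apply: (gP e ees Ne he p bn) => s sJ; apply: eE; rewrite DP.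
elim: (es) => [|e es' [N1 [g1 [d1 a1 gP1]]]].
  by exists id, id; split=> //; exact: pemb_id.
have [[Ne [he [p bn heE]]]|ne] := pselect (exists Ne he, [/\ pemb J ev G Ne he, base Ne J = n &
  forall s, size s < J -> he s = (e : word -> word) s]); last first.
  exists N1, g1; split=> // e'; rewrite in_cons => /predU1P [->|/gP1 //] Ne he p bn heE.
  by case: ne; exists Ne, he.
have [|N2 [g2 [d2 a2 [c cP]]]] := @pigeonhole S ev J Ne he C (fun f => chi (L \o g1 \o f))
    (chi id) w _ v0 p.
  by move=> f f' E; apply: loc => s zs /=; rewrite E.
rewrite bn in a2.
exists (N1 \o N2), (g1 \o g2); split.
- exact: demb_comp d2 d1.
- have [x1 y1] := a1; have [x2 y2] := a2.
  by split=> [i|s] lt /=; [rewrite -x2 // -x1|rewrite -y2 // -y1].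
- move=> e'; rewrite in_cons => /predU1P [->|e'es] Ne' he' p' bn' heE'.
    exists c => Nf hf pf af; apply: (cP Nf hf pf).
    have eq : @agr S J Ne he Ne' he' by apply: (pemb_agr p p') => s sJ; rewrite heE // heE'.
    exact: agr_trans eq af.
  have [c' c'P] := gP1 e' e'es Ne' he' p' bn' heE'; exists c' => Nf hf pf af.
  have [pg ag] := ext_comp p' bn' pf af d2 a2.
  exact: c'P pg ag.
Qed.

(** Stage [n] settles base [n] and fixes all that lies below, so the stages converge. On the words
    of one extension the limit is the settling stage followed on the right by an embedding that
    fixes the base, and this again yields an extension of the same copy. *)
Lemma fusion : exists N' g, demb G G N' g /\ forall Ne he, pemb J ev G Ne he ->
  exists c, forall Nf hf, pemb J.+1 ev G Nf hf -> agr J Ne he Nf hf -> chi (g \o hf) = c.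
Proof.
pose X := ((nat -> nat) * (word -> word))%type.
pose P (n : nat) (x : X) := demb G G x.1 x.2.
pose R n (x y : X) := exists N' g, [/\ demb G G N' g, agr n id id N' g,
  y.1 = x.1 \o N', y.2 = x.2 \o g & settled n y.2].
have [|f [_ fP]] := @dep_choice X P R (id, id) (@pemb_id _ _).
  move=> n [N1 g1] /= d1; have [N' [g [dg ag st]]] := settle n g1.
  exists (N1 \o N', g1 \o g); split; first exact: demb_comp dg d1.
  by exists N', g.
have tail n k : exists N' g, [/\ demb G G N' g, agr n id id N' g, (f (n + k)).1 = (f n).1 \o N'
    & (f (n + k)).2 = (f n).2 \o g].
  elim: k => [|k [N1 [g1 [d1 [x1 y1] e1 e1']]]].
    by rewrite addn0; exists id, id; split=> //; exact: pemb_id.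
  have [_ [N2 [g2 [d2 [x2 y2] e2 e2' _]]]] := fP (n + k).
  exists (N1 \o N2), (g1 \o g2); split.
  - exact: demb_comp d2 d1.
  - split=> [i|s] lt /=.
      rewrite -x2; [exact: x1|exact: leq_trans lt (leq_addr _ _)].
    rewrite -y2; [exact: y1|exact: leq_trans lt (leq_addr _ _)].
  - by rewrite addnS e2 e1.
  - by rewrite addnS e2' e1'.
pose N i := (f i.+1).1 i; pose g s := (f (size s).+1).2 s.
have agf n : agr n (f n).1 (f n).2 N g.
  split=> [i|s] lt; rewrite /N /g.
    have [N' [g' [_ [x _] e _]]] := tail i.+1 (n - i.+1).
    by rewrite subnKC // in e; rewrite e /= -x.
  have [N' [g' [_ [_ y] _ e]]] := tail (size s).+1 (n - (size s).+1).
  by rewrite subnKC // in e; rewrite e /= -y.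
exists N, g; split.
  by move=> k; apply: (eq_pemb (@wfev_gen S) (fun _ _ => erefl) (agf k)); exact: (fP k).1.
move=> Ne he p; pose n := base Ne J.
have [_ [_ [_ [_ _ _ _ st]]]] := fP n.
have [c cP] := st Ne he p erefl; exists c => Nf hf pf af.
pose k := (Nf J).+1.
have [N' [g' [d' a' _ e']]] := tail n.+1 k.
have [pg ag] := ext_comp p erefl pf af d' (agr_le (leqnSn n) a').
rewrite -(cP _ _ pg ag); apply: loc => s zs /=.
have [_ <-] := agf (n.+1 + k); first by rewrite e'.
have [a b _ _ _] := pf; rewrite b //; apply: (@leq_trans k); last exact: leq_addl.
rewrite ltnS; move: zs; rewrite leq_eqVlt => /predU1P [->//|zs]; apply: ltnW; exact: a.
Qed.

End Ext.

(** After [fusion] the colour of a copy with [J.+1] levels depends only on its first [J] levels, and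
    [chi'] turns this dependence into a colouring of shorter copies. *)
Lemma ramsey_diary ev J (C : finType) (chi : (word -> word) -> C) : wfev ev ->
  (forall f f', (forall s, size s < J -> f s = f' s) -> chi f = chi f') ->
  exists N' g, demb G G N' g /\ exists c, forall Nf hf, pemb J ev G Nf hf ->
    chi (g \o hf) = c.
Proof.
move=> w; elim: J chi => [|J IH] chi loc.
  exists id, id; split; first exact: pemb_id.
  by exists (chi id) => Nf hf _; exact: loc.
have [N1 [g1 [d1 fu]]] := fusion w loc.
pose cs (e : word -> word) := [set c | exists Nf hf, [/\ pemb J.+1 ev G Nf hf,
  (forall s, size s < J -> e s = hf s) & chi (g1 \o hf) = c]]%classic.
pose chi' e := xget (chi id) (cs e).
have [|N2 [g2 [d2 [c cP]]]] := IH chi'.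
  move=> e e' E; rewrite /chi'; suff -> : cs e = cs e' by [].
  apply/seteqP; split=> c [Nf [hf [pf eq cE]]]; exists Nf, hf; split=> // s sJ.
    by rewrite -E ?eq.
  by rewrite E ?eq.
exists (N1 \o N2), (g1 \o g2); split; first exact: demb_comp d2 d1.
exists c => Nf hf pf; rewrite -(cP _ _ (pemb_le (leqnSn J) pf)) /chi'.
have pg := pemb_comp pf d2.
case: xgetP => [c' _ [Nf' [hf' [pf' eq cE]]]|/(_ (chi (g1 \o g2 \o hf)))]; last first.
  by case; exists (N2 \o Nf), (g2 \o hf).
rewrite -cE; have [c1 c1P] := fu _ _ (pemb_le (leqnSn J) pg).
rewrite (c1P _ _ pf'); first by rewrite -(c1P _ _ pg) //; exact: agr_refl.
exact: (pemb_agr (pemb_le (leqnSn J) pg) (pemb_le (leqnSn J) pf')).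
Qed.

Lemma ramsey_diaries (T : finType) (ev : T -> nat -> event) (J : T -> nat) (C : finType)
    (chi : T -> (word -> word) -> C) : (forall t, wfev (ev t)) ->
  (forall t f f', (forall s, size s < J t -> f s = f' s) -> chi t f = chi t f') ->
  exists N' g, demb G G N' g /\ forall t, exists c, forall Nf hf, pemb (J t) (ev t) G Nf hf ->
    chi t (g \o hf) = c.
Proof.
move=> w loc.
suff [N' [g [dg gP]]] : exists N' g, demb G G N' g /\ forall t, t \in enum T -> exists c,
    forall Nf hf, pemb (J t) (ev t) G Nf hf -> chi t (g \o hf) = c.
  by exists N', g; split=> // t; apply: gP; rewrite mem_enum.
elim: (enum T) => [|t ts [N1 [g1 [d1 gP1]]]].
  by exists id, id; split=> //; exact: pemb_id.
have [|N2 [g2 [d2 [c cP]]]] := @ramsey_diary (ev t) (J t) C (fun f => chi t (g1 \o f)) (w t).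
  by move=> f f' E; apply: loc => s zs /=; rewrite E.
exists (N1 \o N2), (g1 \o g2); split; first exact: demb_comp d2 d1.
move=> t'; rewrite in_cons => /predU1P [->|t'ts]; first by exists c.
have [c' c'P] := gP1 t' t'ts; exists c' => Nf hf pf.
exact: c'P (pemb_comp pf d2).
Qed.

End Fusion.

(** * Thin diaries and compression *)

Section Prefixes.
Variable S : setup.
Local Notation word := (word S).
Implicit Types (s : word) (m n : nat).

Definition pre s n : word := drop (size s - n) s.
Definition lat s n : letter S := head l0 (pre s n.+1).

Lemma size_pre s n : n <= size s -> size (pre s n) = n.
Proof. by move=> le; rewrite size_drop subKn. Qed.

Lemma pre_size s : pre s (size s) = s.
Proof. by rewrite /pre subnn drop0. Qed.

Lemma pre_sfx s' s : sfx s' s -> pre s (size s') = s'.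
Proof. exact: sfx_drop. Qed.

Lemma sfx_pre s n : sfx (pre s n) s.
Proof. by exists (take (size s - n) s); rewrite cat_take_drop. Qed.

Lemma pre_pre s m n : m <= n -> n <= size s -> pre (pre s n) m = pre s m.
Proof.
move=> mn ns; rewrite /pre drop_drop size_drop; congr drop; lia.
Qed.

Lemma lat_pre s m n : m < n -> n <= size s -> lat (pre s n) m = lat s m.
Proof. by move=> mn ns; rewrite /lat pre_pre. Qed.

Lemma preS s n : n < size s -> pre s n.+1 = lat s n :: pre s n.
Proof.
move=> lt; rewrite /lat; have := size_pre lt; have := pre_pre (leqnSn n) lt.
case: (pre s n.+1) => //= l s' <- [zs']; congr cons.
by rewrite /pre /= zs' subSnn /= drop0.
Qed.

Lemma sfx_preP s m n : m <= n -> n <= size s -> sfx (pre s m) (pre s n).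
Proof. by move=> mn ns; rewrite -(pre_pre mn ns); exact: sfx_pre. Qed.

Lemma behead_pre s n : n < size s -> behead (pre s n.+1) = pre s n.
Proof. by move=> lt; rewrite preS. Qed.

Lemma eq_lat s s' : size s = size s' -> (forall n, n < size s -> lat s n = lat s' n) ->
  s = s'.
Proof.
move=> z E; rewrite -(pre_size s) -(pre_size s') -z.
suff H n : n <= size s -> pre s n = pre s' n by exact: H.
elim: n => [|n IH] le.
  by rewrite /pre !subn0 z drop_size -z drop_size.
have le' : n < size s' by rewrite -z.
by rewrite (preS le) (preS le') E // IH //; exact: ltnW.
Qed.

Lemma lat_cfor J ev ev' N h s n : pemb J ev ev' N h -> n < size s -> size s < J ->
  lat (h s) (N n) = lat s n.
Proof.
move=> p lt sJ; have [a b c _ _] := p.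
have sf : sfx (h (pre s n.+1)) (h s) by apply: (pemb_sfx p) sJ; exact: sfx_pre.
have zp : size (pre s n) = n by rewrite size_pre // ltnW.
have := c (lat s n) (pre s n); rewrite zp -preS // => /(_ (leq_ltn_trans lt sJ)) sf'.
have := pre_sfx (sfx_trans sf' sf); rewrite /= b zp; last exact: ltn_trans sJ.
by rewrite /lat => ->.
Qed.

End Prefixes.

(** * Thin diaries, their relevant levels and compression *)

Section Thin.
Variable S : setup.
Local Notation word := (word S).
Local Notation event := (event S).

(** These clauses make irrelevant levels removable: used nodes split only at [Noop] levels, a
    [Forbid] binds every vertex passing through its nodes, and by [th_na] coding a vertex imposes
    nothing new on the vertices still to come. *)
Record thin (A : Type) (B : bstr S A) (ev : nat -> event) (wd : A -> word) : Prop := Thin {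
  th_w : wfev ev;
  th_v : forall n, valid (hist ev n);
  th_code : forall a, ev (size (wd a)) = Code (un B a) (wd a);
  th_inj : forall a b, size (wd a) = size (wd b) -> a = b;
  th_re : forall a b, size (wd b) < size (wd a) -> re B a b = (lat (wd a) (size (wd b))).2;
  th_split : forall n a b, ev n <> Noop -> n < size (wd a) -> n < size (wd b) ->
    pre (wd a) n = pre (wd b) n -> lat (wd a) n = lat (wd b) n;
  th_bit : forall n c ka i a, ev n = Forbid c ka -> n < size (wd a) ->
    pre (wd a) n = ka i -> (lat (wd a) n).1;
  th_na : forall n u y, ev n = Code u y -> forall (T : Type) (B' : bstr S T) (x : T -> A),
    (forall t, n < size (wd (x t))) ->
    allowed (hist ev n) B' (fun t => pre (wd (x t)) n) ->
    allowed (hist ev n.+1) B' (fun t => pre (wd (x t)) n.+1) }.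

Lemma thin_pull (A' A : Type) (B : bstr S A) ev wd (x : A' -> A) : injective x ->
  thin B ev wd -> thin (pull B x) ev (wd \o x).
Proof.
move=> xi [a b c d e f g h]; split=> //=.
- by move=> a1 a2 /d /xi.
- by move=> a1 a2 /e.
- by move=> n a1 a2; exact: f.
- by move=> n cc ka i a1; exact: g.
- by move=> n u y E T B' x' lt; exact: (h n u y E T B' (x \o x') lt).
Qed.

Definition kind : Type := option (option (constr S)).
HB.instance Definition _ := Finite.copy kind (option (option (constr S))).
Definition i0 : 'I_(wid S) := Ordinal (ltnW (wid1 S)).
Definition i1 : 'I_(wid S) := Ordinal (wid1 S).

Section Levels.
Variables (A : Type) (ev : nat -> event) (wd : A -> word).

Definition fb c (phi : 'I_(wid S) -> A) n := (forall i, n < size (wd (phi i))) /\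
  ev n = Forbid c [ffun i => pre (wd (phi i)) n].

(* [None] stands for the splitting level of the first two entries of [phi],
   [Some None] for the coding level of the first entry, and [Some (Some c)] for
   the first level at which the nodes of [phi] are forbidden to realize [c]. *)
Definition Lvl (q : kind) (phi : 'I_(wid S) -> A) n : Prop :=
  match q with
  | None => [/\ n < size (wd (phi i0)), n < size (wd (phi i1)),
      pre (wd (phi i0)) n = pre (wd (phi i1)) n
      & lat (wd (phi i0)) n <> lat (wd (phi i1)) n]
  | Some None => n = size (wd (phi i0))
  | Some (Some c) => fb c phi n /\ forall m, m < n -> ~ fb c phi m
  end.

Lemma Lvl_uniq q phi n n' : Lvl q phi n -> Lvl q phi n' -> n = n'.
Proof.
case: q => [[c|]|] /=.
- by move=> [a b] [a' b']; case: (ltngtP n n') => // [/b'|/b].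
- by move=> -> ->.
- have asym m m' : m < m' -> m' < size (wd (phi i0)) -> m' < size (wd (phi i1)) ->
      pre (wd (phi i0)) m' = pre (wd (phi i1)) m' ->
      lat (wd (phi i0)) m = lat (wd (phi i1)) m.
    move=> lt lt0 lt1 E; rewrite -(lat_pre lt (ltnW lt0)) E lat_pre //; exact: ltnW.
  move=> [a b c d] [a' b' c' d']; case: (ltngtP n n') => // lt.
    by case: d; exact: asym lt a' b' c'.
  by case: d'; exact: asym lt a b c.
Qed.

Definition Rel n : bool := `[< exists q phi, Lvl q phi n >].
Definition rk n := count Rel (iota 0 n).

Lemma rkS n : rk n.+1 = rk n + Rel n.
Proof. by rewrite /rk -addn1 iotaD count_cat /= addn0. Qed.

Lemma rk_le m n : m <= n -> rk m <= rk n.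
Proof.
elim: n => [|n IH]; first by rewrite leqn0 => /eqP ->.
rewrite leq_eqVlt => /predU1P [->//|/IH le]; rewrite rkS; exact: leq_trans (leq_addr _ _).
Qed.

Lemma rk_lt m n : m < n -> Rel m -> rk m < rk n.
Proof. by move=> lt Rm; apply: leq_trans (rk_le lt); rewrite rkS Rm addn1. Qed.

Lemma rk_inj m n : Rel m -> Rel n -> rk m = rk n -> m = n.
Proof.
move=> Rm Rn E; case: (ltngtP m n) => // lt.
  by have := rk_lt lt Rm; rewrite E ltnn.
by have := rk_lt lt Rn; rewrite E ltnn.
Qed.

Lemma rk_onto j n : j < rk n -> exists m, [/\ m < n, Rel m & rk m = j].
Proof.
elim: n => // n IH; rewrite rkS; case: (boolP (Rel n)) => [Rn|_]; last first.
  by rewrite addn0 => /IH [m [mn Rm E]]; exists m; split=> //; exact: ltnW.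
rewrite addn1 ltnS leq_eqVlt => /predU1P [->|/IH [m [mn Rm E]]]; first by exists n.
by exists m; split=> //; exact: ltnW.
Qed.

Fixpoint cw (s : word) : word :=
  if s is l :: s' then if Rel (size s') then l :: cw s' else cw s' else [::].

Lemma size_cw s : size (cw s) = rk (size s).
Proof. by elim: s => //= l s IH; rewrite rkS; case: ifP => _; rewrite /= IH ?addn1 ?addn0. Qed.

Lemma cw_sfx s s' : sfx s s' -> sfx (cw s) (cw s').
Proof.
move=> [d ->]; elim: d => [|l d IH] /=; first exact: sfx_refl.
by case: ifP => _ //; apply: sfx_trans IH _; exists [:: l].
Qed.

Lemma pre_cw s n : n <= size s -> pre (cw s) (rk n) = cw (pre s n).
Proof.
move=> le; have := pre_sfx (cw_sfx (sfx_pre s n)).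
by rewrite size_cw size_pre.
Qed.

Lemma lat_cw s n : n < size s -> Rel n -> lat (cw s) (rk n) = lat s n.
Proof.
move=> lt Rn; rewrite {1}/lat; have -> : (rk n).+1 = rk n.+1 by rewrite rkS Rn addn1.
by rewrite pre_cw // preS //= size_pre ?Rn // ltnW.
Qed.

Lemma cw_quiet s m n : m <= n -> n <= size s -> (forall k, m <= k -> k < n -> ~~ Rel k) ->
  cw (pre s n) = cw (pre s m).
Proof.
elim: n => [|n IH]; first by rewrite leqn0 => /eqP ->.
rewrite leq_eqVlt => /predU1P [->//|mn] ns q.
rewrite preS //= size_pre ?(ltnW ns) // (negbTE (q n _ _)) // IH //.
- exact: ltnW.
- by move=> k mk kn; apply: q => //; exact: ltnW.
Qed.

Definition cev j : event :=
  let n := xget 0 [set n | Rel n /\ rk n = j]%classic in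
  if Rel n && (rk n == j) then emap cw (ev n) else Noop.

Lemma cev_rel n : Rel n -> cev (rk n) = emap cw (ev n).
Proof.
move=> Rn; rewrite /cev; case: xgetP => [m -> [Rm E]|/(_ n) []//].
by rewrite Rm E eqxx (rk_inj Rm Rn E).
Qed.

Lemma cev_non j : (forall n, Rel n -> rk n <> j) -> cev j = Noop.
Proof.
by move=> H; rewrite /cev; set n := xget _ _; case: ifP => // /andP [/H ne /eqP].
Qed.

Lemma cevP j : cev j = Noop \/ exists2 n, Rel n & rk n = j.
Proof.
have [[n Rn E]|ne] := pselect (exists2 n, Rel n & rk n = j); first by right; exists n.
by left; apply: cev_non => n Rn E; apply: ne; exists n.
Qed.

End Levels.

Section Compression.
Variables (A : Type) (B : bstr S A) (ev : nat -> event) (wd : A -> word).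
Hypothesis th : thin B ev wd.
Local Notation Rel := (Rel ev wd).
Local Notation rk := (rk ev wd).
Local Notation cw := (cw ev wd).
Local Notation cev := (cev ev wd).
Local Notation Lvl := (Lvl ev wd).

(** Any constant tuple names a coding level. *)
Lemma rel_code a : Rel (size (wd a)).
Proof. by apply/asboolP; exists (Some None), (fun=> a). Qed.

Lemma rel_meet a b n : n < size (wd a) -> n < size (wd b) ->
  pre (wd a) n = pre (wd b) n -> lat (wd a) n <> lat (wd b) n -> Rel n.
Proof.
move=> na nb pn ln; apply/asboolP.
by exists None, (fun i => if i == i0 then a else b); split.
Qed.

Lemma occ_rel n : Rel n -> forall s, occ (ev n) s ->
  exists a, n <= size (wd a) /\ pre (wd a) n = s.
Proof.
move=> /asboolP [[[c|]|] [phi]] /=.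
- move=> [[lt ->] _] s /existsP [i /eqP]; rewrite ffunE => <-.
  by exists (phi i); split=> //; exact: ltnW.
- by move=> ->; rewrite (th_code th) => s /eqP ->; exists (phi i0); rewrite pre_size.
- move=> [a b c d] s; case E : (ev n) => [|cc ka|u y] //=; case: d;
    apply: (th_split th) => //; by rewrite E.
Qed.

(** Two used nodes part at a relevant level, and its letters survive compression. *)
Lemma cw_node_inj n a b : n <= size (wd a) -> n <= size (wd b) ->
  cw (pre (wd a) n) = cw (pre (wd b) n) -> pre (wd a) n = pre (wd b) n.
Proof.
elim: n => [|n IH] na nb.
  by rewrite /pre !subn0 !drop_size.
rewrite !preS //= !size_pre ?(ltnW na) ?(ltnW nb) //; case: (boolP (Rel n)) => Rn E.
  by case: E => -> /IH -> //; exact: ltnW.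
have p := IH (ltnW na) (ltnW nb) E; rewrite p; congr cons.
by apply: contrapT => ne; case/negP: Rn; exact: (rel_meet na nb p ne).
Qed.

(** A [Forbid] met at an irrelevant level repeats an earlier one on the same vertices, whose
    constraint is already obeyed; a [Code] is harmless by [th_na]. *)
Lemma quiet m n (T : Type) (B' : bstr S T) (x : T -> A) : m <= n ->
  (forall k, m <= k -> k < n -> ~~ Rel k) -> (forall t, n <= size (wd (x t))) ->
  allowed (hist ev m) B' (fun t => pre (wd (x t)) m) ->
  allowed (hist ev n) B' (fun t => pre (wd (x t)) n).
Proof.
elim: n => [|n IH]; first by rewrite leqn0 => /eqP ->.
rewrite leq_eqVlt => /predU1P [->//|mn] q lt al0.
have al : allowed (hist ev n) B' (fun t => pre (wd (x t)) n).
  apply: IH al0 => // [k mk kn|t]; last exact: ltnW.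
  by apply: q => //; exact: ltnW.
have bE : behead \o (fun t => pre (wd (x t)) n.+1) = fun t => pre (wd (x t)) n.
  by apply/funext => t /=; exact: behead_pre.
case E : (ev n) => [|c ka|u y] /=.
- by rewrite E bE.
- rewrite E bE; split=> // -[f [rf fE]].
  pose phi := x \o f.
  have fbn : fb ev wd c phi n.
    split=> [i|]; first exact: lt.
    rewrite E; congr Forbid; apply/ffunP => i; rewrite ffunE -(fE i).1.
    exact: behead_pre.
  have [n' [nn' fb' mi]] : exists n', [/\ n' <= n, fb ev wd c phi n' &
      forall k, k < n' -> ~ fb ev wd c phi k].
    have ex : exists k, `[< fb ev wd c phi k >] by exists n; apply/asboolP.
    exists (ex_minn ex); case: ex_minnP => k /asboolP fk mk; split=> //.
      by apply: mk; apply/asboolP.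
    by move=> k' lt' fk'; have := mk k' (asboolT fk'); rewrite leqNgt lt'.
  have Rn' : Rel n' by apply/asboolP; exists (Some (Some c)), phi.
  move: nn'; rewrite leq_eqVlt => /predU1P [nE|lt'].
    by have /negP := q n mn (ltnSn n); rewrite -nE.
  have [lts' ev'] := fb'.
  have : allowed (hist ev n'.+1) B' (fun t => pre (wd (x t)) n'.+1).
    apply: allowed_down al => //.
    + by move=> t; apply: size_pre; apply: leq_trans (lt t); exact: ltnW.
    + by move=> t; apply: size_pre; exact: ltnW.
    + by move=> t; apply: sfx_preP => //; exact: ltnW.
  rewrite /= ev' => -[_]; apply; exists f; split=> // i; split.
    by rewrite ffunE; apply: behead_pre; exact: lts'.
  rewrite -[head l0 _]/(lat (wd (x (f i))) n').
  by apply: (th_bit th ev' (lts' i) (i := i)); rewrite ffunE.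
- have := th_na th E lt al; by rewrite /= E.
Qed.

Lemma base_rel N i : (forall j, j < i.+1 -> Rel (N j) /\ rk (N j) = j) ->
  [/\ base N i <= N i, rk (base N i) = i & forall k, base N i <= k -> k < N i -> ~~ Rel k].
Proof.
case: i => [|i] NP /=.
  split=> // k _ lt; apply/negP => Rk; have := rk_lt lt Rk.
  by rewrite (NP 0 _).2.
have [Ri ri] := NP i (leqnSn _); have [Ri' ri'] := NP i.+1 (ltnSn _); split.
- by rewrite ltnNge; apply/negP => /(@rk_le A ev wd); rewrite ri ri' ltnn.
- by rewrite rkS ri Ri addn1.
- move=> k le lt; apply/negP => Rk; have := rk_lt lt Rk; rewrite ri' ltnS => le'.
  by have := rk_lt le Ri; rewrite ri ltnNge le'.
Qed.

Lemma wfev_cev : wfev cev.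
Proof.
move=> j; have [->//|[n Rn <-]] := cevP ev wd j; rewrite cev_rel //.
by apply: (wfe_map (th_w th n)) => s zs; rewrite size_cw zs.
Qed.

(** The compressed diary sits in the original one at the relevant levels: used nodes return to their
    places, all other words are padded by [l0], and [quiet] bridges the gaps. *)
Lemma comp_pemb J N : (forall j, j < J -> Rel (N j) /\ rk (N j) = j) ->
  exists h, pemb J cev ev N h /\ forall a n, Rel n -> rk n < J -> n <= size (wd a) ->
    h (cw (pre (wd a) n)) = pre (wd a) n.
Proof.
elim: J => [|J IH] NP; first by exists id; split=> //; split.
have [|h [p hP]] := IH; first by move=> j jJ; apply: NP; exact: ltnW.
have [bN rb q] := base_rel NP; have [RJ rJ] := NP J (ltnSn J).
have cbase a : N J <= size (wd a) ->
    cfor h (cw (pre (wd a) (N J))) = pre (wd a) (base N J).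
  move=> le; rewrite (cw_quiet bN) //; move: le bN {q rb p RJ rJ}; case: J hP NP {IH} => [|j] hP NP le /= bN.
    by rewrite /pre subn0 drop_size.
  have [Rj rj] := NP j (leqnSn _).
  have lt : N j < size (wd a) by exact: leq_trans le.
  by rewrite preS //= size_pre ?(ltnW lt) // Rj /= hP ?rj // ltnW.
have t0 s : exists t, (forall a, N J <= size (wd a) -> cw (pre (wd a) (N J)) = s ->
      t = pre (wd a) (N J)) /\
    ((forall a, N J <= size (wd a) -> cw (pre (wd a) (N J)) <> s) ->
      t = padto (N J) (cfor h s)).
  have [[a [na aE]]|ne] := pselect (exists a, N J <= size (wd a) /\ cw (pre (wd a) (N J)) = s).
    exists (pre (wd a) (N J)); split; last by move=> /(_ a na).
    by move=> b nb bE; apply: cw_node_inj => //; rewrite aE bE.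
  exists (padto (N J) (cfor h s)); split=> // a na aE; by case: ne; exists a.
have [t tP] := choice t0.
have tz s : size s = J -> size (t s) = N J /\ sfx (cfor h s) (t s).
  move=> zs; have [[a [na aE]]|ne] := pselect (exists a, N J <= size (wd a) /\ cw (pre (wd a) (N J)) = s).
    rewrite ((tP s).1 a na aE) size_pre //; split=> //.
    by rewrite -aE cbase //; exact: sfx_preP.
  rewrite (tP s).2; last by move=> a na aE; apply: ne; exists a.
  by rewrite size_padto ?(size_cfor p zs) //; split=> //; exact: sfx_padto.
exists (fun s => if size s == J then t s else h s); split; last first.
  move=> a n Rn; rewrite ltnS leq_eqVlt => /predU1P [rn|lt] na.
    have nN : n = N J by apply: (rk_inj Rn RJ); rewrite rn rJ.
    rewrite size_cw size_pre // rn eqxx; subst n.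
    exact: (tP _).1.
  by rewrite size_cw size_pre // ltn_eqF //; exact: hP.
apply: (@eq_pemb S J.+1 cev cev ev (fun j => if j == J then N J else N j) _ N).
- exact: wfev_cev.
- by [].
- by split=> // i _; case: eqP => [->|].
apply: pemb_extend => //; first exact: wfev_cev.
- rewrite -{2}rJ cev_rel // emap_comp -{1}(emap_id (ev (N J))).
  apply/eq_emap_occ => s os /=; have [a [na <-]] := occ_rel RJ os.
  by rewrite ((tP _).1 a).
- move=> T B' la zl al.
  apply: (allowed_up (la := cfor h \o la)
    (P := fun x => exists a, N J <= size (wd a) /\ cw (pre (wd a) (N J)) = la x) bN _ _ _ _ al).
  + by move=> x; exact: (size_cfor p).
  + by move=> x; exact: (tz _ (zl x)).1.
  + by move=> x; exact: (tz _ (zl x)).2.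
  + by move=> x nP; apply: (tP _).2 => a na aE; apply: nP; exists a.
  + set P := fun x => _; have [ax axP] := choice (fun x : {x | P x} => svalP x).
    have : allowed (hist ev (N J)) (pull B' (fun x : {x | P x} => sval x))
        (fun x => pre (wd (ax x)) (N J)).
      apply: (quiet bN q) => [x|]; first exact: (axP x).1.
      move: al => /(allowed_pull (fun x : {x | P x} => sval x)).
      congr allowed; apply/funext => x /=; have [na aE] := axP x.
      by rewrite -aE cbase.
    congr allowed; apply/funext => x /=; have [na aE] := axP x.
    by rewrite ((tP _).1 (ax x)).
Qed.

End Compression.
End Thin.

(** * The data of a diary *)

Section CompressionThin.
Variable S : setup.
Local Notation word := (word S).
Local Notation event := (event S).
Variables (A : Type) (B : bstr S A) (ev : nat -> event) (wd : A -> word).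
Hypothesis th : thin B ev wd.
Local Notation Rel := (Rel ev wd).
Local Notation rk := (rk ev wd).
Local Notation cw := (cw ev wd).
Local Notation cev := (cev ev wd).

Lemma Lvl_rel q phi n : Lvl ev wd q phi n -> Rel n.
Proof. by move=> L; apply/asboolP; exists q, phi. Qed.

Lemma rk_lt_inv m n : rk m < rk n -> m < n.
Proof. by move=> lt; rewrite ltnNge; apply/negP => /(@rk_le S A ev wd); rewrite leqNgt lt. Qed.

Lemma rank_levels J : (exists2 n, Rel n & J <= (rk n).+1) ->
  exists N : nat -> nat, forall j, j < J -> Rel (N j) /\ rk (N j) = j.
Proof.
move=> [n Rn le].
have ex j : exists m, j < J -> Rel m /\ rk m = j.
  have [lt|] := boolP (j < J); last by exists 0.
  have : j < rk n.+1 by rewrite rkS Rn addn1; exact: leq_trans lt le.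
  by move=> /(@rk_onto S A ev wd) [m [_ Rm E]]; exists m.
by have [N NP] := choice ex; exists N.
Qed.

Lemma valid_cev n : valid (hist cev n).
Proof.
elim: n => [|n IH] /=; first by have := th_v th 0.
have [->|[m Rm rm]] := cevP ev wd n; first by apply: allowed_void IH; case.
have [|N NP] := @rank_levels n.+1; first by exists m => //; rewrite rm.
have [h [p _]] := comp_pemb th NP.
have := forced_iff (vstr S) (wfev_cev th) p (la := fun x : void => match x with end).
move=> H; have /H [_ H'] : forall x : void, size (match x with end : word) = n.+1 by case.
have vv : forall (la la' : void -> word) es, allowed es (vstr S) la -> allowed es (vstr S) la'.
  by move=> la la' es; apply: allowed_void; case.
apply: (vv _ _ (hist cev n.+1)); apply: H'; apply: vv; exact: (th_v th (N n).+1).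
Qed.

Lemma occ_inj n a s : Rel n -> n <= size (wd a) -> occ (ev n) s ->
  cw (pre (wd a) n) = cw s -> pre (wd a) n = s.
Proof.
move=> Rn na /(occ_rel th Rn) [b [nb <-]]; exact: (cw_node_inj na nb).
Qed.

(** For the clause on [Code], allowedness is carried to the original diary along [comp_pemb], pushed
    over the coding level there, and carried back by [forced_iff]. *)
Lemma thin_comp : thin B cev (cw \o wd).
Proof.
split.
- exact: (wfev_cev th).
- exact: valid_cev.
- by move=> a /=; rewrite size_cw cev_rel ?(rel_code ev wd a) // (th_code th).
- move=> a b /=; rewrite !size_cw => /(rk_inj (rel_code ev wd a) (rel_code ev wd b)).
  exact: (th_inj th).
- move=> a b /=; rewrite !size_cw => /rk_lt_inv lt.
  by rewrite lat_cw ?(rel_code ev wd b) //; exact: (th_re th).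
- move=> j a b; have [->//|[n Rn <-]] := cevP ev wd j; rewrite cev_rel // => ne.
  rewrite /= !size_cw => /rk_lt_inv na /rk_lt_inv nb.
  rewrite !pre_cw ?(ltnW na) ?(ltnW nb) // => /(cw_node_inj (ltnW na) (ltnW nb)) E.
  by rewrite !lat_cw //; apply: (th_split th) => // en; apply: ne; rewrite en.
- move=> j c ka i a; have [->//|[n Rn <-]] := cevP ev wd j; rewrite cev_rel //.
  case E : (ev n) => [|c' ka'|] //= [_ <-]; rewrite size_cw ffunE => /rk_lt_inv na.
  rewrite pre_cw ?(ltnW na) // => /(occ_inj Rn (ltnW na)) E'.
  rewrite lat_cw //; apply: (th_bit th E na); apply: E'.
  by rewrite E /=; apply/existsP; exists i.
- move=> j u y; have [->//|[n Rn <-]] := cevP ev wd j; rewrite cev_rel //.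
  case E : (ev n) => [| |u' y'] //= _ T B' x lt al.
  have lt' t : n < size (wd (x t)) by apply: rk_lt_inv; rewrite -size_cw.
  have [|N NP] := @rank_levels (rk n).+1; first by exists n.
  have [Rr rr] := NP (rk n) (ltnSn _); have Nn := rk_inj Rr Rn rr.
  have [h [p hP]] := comp_pemb th NP; have [_ _ _ _ e] := p.
  have nE : (fun t => pre (cw (wd (x t))) (rk n)) = (fun t => cw (pre (wd (x t)) n)).
    by apply/funext => t; rewrite pre_cw // ltnW.
  have hE : h \o (fun t => pre (cw (wd (x t))) (rk n)) = fun t => pre (wd (x t)) n.
    by rewrite nE; apply/funext => t /=; rewrite hP // ltnW.
  have al1 : allowed (hist ev n) B' (fun t => pre (wd (x t)) n).
    move: al; rewrite (e (rk n) (ltnSn _)); last first.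
      by move=> t; rewrite size_pre // ltnW.
    by rewrite Nn hE.
  have al2 := th_na th E lt' al1.
  apply/(forced_iff B' (wfev_cev th) p).
    by move=> t; apply: size_pre.
  rewrite /= Nn; congr (allowed _ _ _): al2; apply/funext => t /=.
  rewrite !preS //= lat_cw //; congr cons.
  by have := congr1 (fun g => g t) hE => /= ->.
Qed.

Lemma fb_comp c phi j : fb cev (cw \o wd) c phi j <->
  exists n, [/\ Rel n, rk n = j & fb ev wd c phi n].
Proof.
split=> [[]|[n [Rn <- [lt E]]]].
  have [->//|[n Rn <-]] := cevP ev wd j; rewrite cev_rel // => lt.
  case E : (ev n) => [|c' ka'|] //= [cc kk]; subst c'; exists n; split=> //.
  have lt' i : n < size (wd (phi i)) by apply: rk_lt_inv; rewrite -size_cw; exact: lt.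
  split=> //; rewrite E; congr Forbid; apply/ffunP => i; rewrite ffunE.
  apply/esym/(occ_inj Rn (ltnW (lt' i))); first by rewrite E; apply/existsP; exists i.
  have /= := congr1 (fun g : {ffun 'I_(wid S) -> word} => g i) kk; rewrite !ffunE => ->.
  by rewrite /= pre_cw //; exact: (ltnW (lt' i)).
split=> [i|]; first by rewrite /= size_cw; apply: rk_lt.
rewrite cev_rel // E /=; congr Forbid; apply/ffunP => i; rewrite !ffunE /= pre_cw //.
exact: ltnW.
Qed.

Lemma fb_first c phi n : fb ev wd c phi n -> exists m,
  m <= n /\ Lvl ev wd (Some (Some c)) phi m.
Proof.
move=> f; have ex : exists k, `[< fb ev wd c phi k >] by exists n; apply/asboolP.
exists (ex_minn ex); case: ex_minnP => k /asboolP fk mk; split.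
  by apply: mk; apply/asboolP.
by split=> // k' lt' fk'; have := mk k' (asboolT fk'); rewrite leqNgt lt'.
Qed.

Lemma Lvl_comp q phi j : Lvl cev (cw \o wd) q phi j <->
  exists2 n, Lvl ev wd q phi n & rk n = j.
Proof.
case: q => [[c|]|] /=.
- split=> [[/fb_comp [n [Rn rn f]] mi]|[n L <-]].
    (* An earlier [fb] level need not be relevant, but the first one for the same tuple is. *)
    exists n => //; split=> // m lt fm; have [m' [le L]] := fb_first fm.
    have lt' : rk m' < rk n by apply: rk_lt; [exact: leq_ltn_trans lt|exact: Lvl_rel L].
    rewrite rn in lt'; apply: (mi _ lt'); apply/fb_comp; exists m'; split=> //.
      exact: Lvl_rel L.
    by case: L.
  have Rn := Lvl_rel (q := Some (Some c)) L; case: L => f mi.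
  split; first by apply/fb_comp; exists n.
  move=> m lt /fb_comp [m' [Rm' rm fm]]; apply: (mi m') fm.
  by apply: rk_lt_inv; rewrite rm.
- split=> [->|[n -> <-]]; last by rewrite size_cw.
  by exists (size (wd (phi (i0 S)))) => //; rewrite size_cw.
- split=> [[l1 l2 E D]|[n [l1 l2 E D] <-]].
    rewrite size_cw in l1; have [n [n1 Rn rn]] := rk_onto l1; subst j.
    rewrite size_cw in l2; have n2 := rk_lt_inv l2; exists n => //; split=> //.
      by apply: (@cw_node_inj S A ev wd n _ _ (ltnW n1) (ltnW n2)); rewrite -(pre_cw ev wd (ltnW n1)) -(pre_cw ev wd (ltnW n2)); exact: E.
    by move: D; rewrite !lat_cw.
  have Rn : Rel n by exact: rel_meet l1 l2 E D.
  split; [by rewrite size_cw rk_lt|by rewrite size_cw rk_lt| |by rewrite !lat_cw].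
  by rewrite !pre_cw ?E //; exact: ltnW.
Qed.

End CompressionThin.

(** * Relations that determine the compressed diary *)

Section Data.
Variable S : setup.
Local Notation word := (word S).
Local Notation event := (event S).

Definition dsym : Type := ((kind S * kind S) + (kind S * letter S))%type.
HB.instance Definition _ := Finite.copy dsym ((kind S * kind S) + (kind S * letter S))%type.

(* The relations of the big Ramsey structure: comparison of two levels, and the
   letter of a vertex at a level. *)
Definition dat (A : Type) (ev : nat -> event) (wd : A -> word) (s : dsym)
    (phi psi : 'I_(wid S) -> A) : Prop :=
  match s with
  | inl (q, q') => exists n n', [/\ Lvl ev wd q phi n, Lvl ev wd q' psi n' & n <= n']
  | inr (q, l) => exists n, [/\ Lvl ev wd q phi n, n < size (wd (psi (i0 S)))
      & lat (wd (psi (i0 S))) n = l]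
  end.

Lemma dat_comp (A : Type) (B : bstr S A) ev wd s phi psi : thin B ev wd ->
  (dat (cev ev wd) (cw ev wd \o wd) s phi psi <-> dat ev wd s phi psi).
Proof.
move=> th; case: s => [[q q']|[q l]] /=; split.
- move=> [_ [_ [/(Lvl_comp th) [n L <-] /(Lvl_comp th) [n' L' <-] le]]].
  exists n, n'; split=> //; rewrite leqNgt; apply/negP => lt.
  by have := rk_lt lt (Lvl_rel L'); rewrite ltnNge le.
- move=> [n [n' [L L' le]]]; exists (rk ev wd n), (rk ev wd n'); split.
  + by apply/(Lvl_comp th); exists n.
  + by apply/(Lvl_comp th); exists n'.
  + exact: rk_le.
- move=> [_ [/(Lvl_comp th) [n L <-]]]; rewrite size_cw => /rk_lt_inv lt.
  by rewrite lat_cw ?(Lvl_rel L) // => <-; exists n.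
- move=> [n [L lt lE]]; exists (rk ev wd n); split.
  + by apply/(Lvl_comp th); exists n.
  + by rewrite size_cw; apply: rk_lt (Lvl_rel L).
  + by rewrite lat_cw // (Lvl_rel L).
Qed.

Lemma Lvl_eq (A : Type) ev ev' (wd : A -> word) q phi n :
  (forall m a, m < size (wd a) -> ev m = ev' m) ->
  Lvl ev wd q phi n <-> Lvl ev' wd q phi n.
Proof.
move=> E; case: q => [[c|]|] //=.
have fE m : fb ev wd c phi m <-> fb ev' wd c phi m.
  split=> -[lt e]; split=> //; first by rewrite -(E m _ (lt (i0 S))).
  by rewrite (E m _ (lt (i0 S))).
by split=> -[/fE f mi]; split=> // m lt /fE; exact: mi.
Qed.

Lemma dat_eq (A : Type) ev ev' (wd : A -> word) s phi psi :
  (forall m a, m < size (wd a) -> ev m = ev' m) ->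
  dat ev wd s phi psi <-> dat ev' wd s phi psi.
Proof.
move=> E; case: s => [[q q']|[q l]] /=; split.
- by move=> [n [n' [L L' le]]]; exists n, n'; split=> //; apply/(Lvl_eq _ _ _ E).
- by move=> [n [n' [L L' le]]]; exists n, n'; split=> //; apply/(Lvl_eq _ _ _ E).
- by move=> [n [L lt lE]]; exists n; split=> //; apply/(Lvl_eq _ _ _ E).
- by move=> [n [L lt lE]]; exists n; split=> //; apply/(Lvl_eq _ _ _ E).
Qed.

Section Same.
Variables (A : Type) (B : bstr S A).

Lemma same_level ev1 wd1 ev2 wd2 q (phi : 'I_(wid S) -> A) n :
  (forall s phi psi, dat ev1 wd1 s phi psi -> dat ev2 wd2 s phi psi) ->
  Lvl ev1 wd1 q phi n -> exists n', Lvl ev2 wd2 q phi n'.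
Proof.
move=> D L; have [|n' [_ [L' _ _]]] := D (inl (q, q)) phi phi; last by exists n'.
by exists n, n.
Qed.

Lemma same_lt ev1 wd1 ev2 wd2 q (phi : 'I_(wid S) -> A) n q' phi' n' m m' :
  (forall s phi psi, dat ev2 wd2 s phi psi -> dat ev1 wd1 s phi psi) ->
  Lvl ev1 wd1 q phi n -> Lvl ev1 wd1 q' phi' n' ->
  Lvl ev2 wd2 q phi m -> Lvl ev2 wd2 q' phi' m' -> n < n' -> m < m'.
Proof.
move=> D L L' M M' lt; rewrite ltnNge; apply/negP => le.
have [|k' [k [K' K le']]] := D (inl (q', q)) phi' phi; first by exists m', m.
by move: lt; rewrite (Lvl_uniq L K) (Lvl_uniq L' K') ltnNge le'.
Qed.

(** Equal data turn the names of levels into an order-preserving injection from the relevant levels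
    below [n] to those below [n']. *)
Lemma same_rk_le ev1 wd1 ev2 wd2 q (phi : 'I_(wid S) -> A) n n' :
  (forall s phi psi, dat ev1 wd1 s phi psi <-> dat ev2 wd2 s phi psi) ->
  Lvl ev1 wd1 q phi n -> Lvl ev2 wd2 q phi n' -> rk ev1 wd1 n <= rk ev2 wd2 n'.
Proof.
move=> D L L'.
have D12 s p p' : dat ev1 wd1 s p p' -> dat ev2 wd2 s p p' by move/D.
have D21 s p p' : dat ev2 wd2 s p p' -> dat ev1 wd1 s p p' by move/D.
have ex m : exists m', Rel ev1 wd1 m -> exists q phi, Lvl ev1 wd1 q phi m /\ Lvl ev2 wd2 q phi m'.
  have [/asboolP [q1 [phi1 M]]|_] := boolP (Rel ev1 wd1 m); last by exists 0.
  by have [m' M'] := same_level D12 M; exists m' => _; exists q1, phi1.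
have [f fP] := choice ex.
pose R ev wd k := [seq m <- iota 0 k | @Rel S A ev wd m].
have zR ev wd k : size (R ev wd k) = rk ev wd k by rewrite size_filter.
rewrite -!zR -(size_map f); apply: uniq_leq_size.
  rewrite map_inj_in_uniq ?filter_uniq ?iota_uniq // => m1 m2.
  rewrite !mem_filter => /andP [R1 _] /andP [R2 _] E.
  have [q1 [p1 [M1 M1']]] := fP m1 R1; have [q2 [p2 [M2 M2']]] := fP m2 R2.
  case: (ltngtP m1 m2) => // lt.
    by have := same_lt D21 M1 M2 M1' M2' lt; rewrite E ltnn.
  by have := same_lt D21 M2 M1 M2' M1' lt; rewrite E ltnn.
move=> _ /mapP [m + ->]; rewrite !mem_filter !mem_iota /= !add0n => /andP [Rm lt].
have [q1 [p1 [M M']]] := fP m Rm.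
rewrite (same_lt D21 M L M' L' lt) andbT; exact: (Lvl_rel M').
Qed.

Lemma same_rk ev1 wd1 ev2 wd2 q (phi : 'I_(wid S) -> A) n n' :
  (forall s phi psi, dat ev1 wd1 s phi psi <-> dat ev2 wd2 s phi psi) ->
  Lvl ev1 wd1 q phi n -> Lvl ev2 wd2 q phi n' -> rk ev1 wd1 n = rk ev2 wd2 n'.
Proof.
move=> D L L'; apply/eqP; rewrite eqn_leq (same_rk_le D L L') /=.
by apply: (same_rk_le _ L' L) => s p p'; split=> /D.
Qed.

Lemma same_cw ev1 wd1 ev2 wd2 : 
  (forall s (phi psi : 'I_(wid S) -> A), dat ev1 wd1 s phi psi <-> dat ev2 wd2 s phi psi) ->
  forall a, cw ev1 wd1 (wd1 a) = cw ev2 wd2 (wd2 a).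
Proof.
move=> D a.
have L1 : Lvl ev1 wd1 (Some None) (fun=> a) (size (wd1 a)) by [].
have L2 : Lvl ev2 wd2 (Some None) (fun=> a) (size (wd2 a)) by [].
have D12 s p p' : dat ev1 wd1 s p p' -> dat ev2 wd2 s p p' by move/D.
have D21 s p p' : dat ev2 wd2 s p p' -> dat ev1 wd1 s p p' by move/D.
apply: eq_lat; first by rewrite !size_cw (same_rk D L1 L2).
move=> j; rewrite size_cw => /(@rk_onto S A ev1 wd1) [m [lt Rm <-]].
have /asboolP [q [phi M]] := Rm; have [m' M'] := same_level D12 M.
have lt' : m' < size (wd2 a) by exact: (same_lt D21 M L1 M' L2 lt).
rewrite lat_cw // (same_rk D M M') lat_cw //; last exact: Lvl_rel M'.
have [|k [K _ <-]] := D12 (inr (q, lat (wd1 a) m)) phi (fun=> a); first by exists m.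
by rewrite (Lvl_uniq K M').
Qed.

(** At a splitting level neither diary records an event, by [th_split]; at the other relevant levels
    the name and the compressed words determine the event. *)
Lemma same_cev ev1 wd1 ev2 wd2 : thin B ev1 wd1 -> thin B ev2 wd2 ->
  (forall s (phi psi : 'I_(wid S) -> A), dat ev1 wd1 s phi psi <-> dat ev2 wd2 s phi psi) ->
  cev ev1 wd1 = cev ev2 wd2.
Proof.
move=> th1 th2 D; apply/funext => j.
have D12 s p p' : dat ev1 wd1 s p p' -> dat ev2 wd2 s p p' by move/D.
have [[n R1 <-]|ne1] := pselect (exists2 n, Rel ev1 wd1 n & rk ev1 wd1 n = j); last first.
  rewrite cev_non => [|n Rn E]; last by apply: ne1; exists n.
  rewrite cev_non // => n R2 E; have /asboolP [q [phi M]] := R2.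
  have [m M'] := same_level (fun s p p' => (D s p p').2) M.
  by apply: ne1; exists m; [exact: Lvl_rel M'|rewrite (same_rk D M' M)].
have /asboolP [q [phi M]] := R1; have [n' M'] := same_level D12 M.
rewrite cev_rel // (same_rk D M M') cev_rel; last exact: Lvl_rel M'.
have node a : n <= size (wd1 a) -> n' <= size (wd2 a) ->
    cw ev1 wd1 (pre (wd1 a) n) = cw ev2 wd2 (pre (wd2 a) n').
  by move=> le le'; rewrite -!pre_cw // (same_cw D) (same_rk D M M').
case: q M M' => [[c|]|] /=.
- move=> [[lt ->] _] [[lt' ->] _] /=; congr Forbid; apply/ffunP => i.
  by rewrite !ffunE node //; exact: ltnW.
- by move=> -> ->; rewrite (th_code th1) (th_code th2) /= (same_cw D).
- move=> [a b c d] [a' b' c' d'].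
  have -> : ev1 n = Noop by apply: contrapT => ne; apply: d; exact: (th_split th1 ne).
  suff -> : ev2 n' = Noop by [].
  by apply: contrapT => ne; apply: d'; exact: (th_split th2 ne).
Qed.

End Same.
End Data.

(** * Existence of thin diaries *)

Section Existence.
Variable S : setup.
Local Notation word := (word S).
Local Notation event := (event S).
Local Notation letter := (letter S).

Definition symmetric_str (A : Type) (B : bstr S A) :=
  (forall a, re B a a = ord0) /\ (forall a b, re B b a = flip (re B a b)).

Variables (V : Type) (K : bstr S V).
Hypothesis sK : symmetric_str K.
Hypothesis fK : forb K.
Variable cd : V -> nat.
Hypothesis cd_inj : injective cd.

Lemma pre_cons l (s : word) n : n <= size s -> pre (l :: s) n = pre s n.
Proof. by move=> le; rewrite /pre /= subSn. Qed.

Lemma lat_cons l (s : word) n : n < size s -> lat (l :: s) n = lat s n.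
Proof. by move=> lt; rewrite /lat pre_cons. Qed.

Lemma lat_last l (s : word) : lat (l :: s) (size s) = l.
Proof. by rewrite /lat /pre /= subnn. Qed.

Lemma pre_last l (s : word) : pre (l :: s) (size s) = s.
Proof. by rewrite pre_cons // pre_size. Qed.

Lemma pre_id (s : word) n : n = size s -> pre s n = s.
Proof. by move=> ->; exact: pre_size. Qed.

Definition sub_la (P : V -> Prop) (la : V -> word) : {x | P x} -> word := fun x => la (sval x).
Definition sub_str (P : V -> Prop) : bstr S {x | P x} := pull K (fun x => sval x).

(** The invariant of the construction: [P] holds the vertices not yet coded, and by [g_al] they may
    still form what they form in [K]. *)
Record good (N : nat) (ev : nat -> event) (la : V -> word) (P : V -> Prop) : Prop := Good {
  g_size : forall x, size (la x) = N;
  g_wf : forall n, n < N -> wfe n (ev n);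
  g_al : allowed (hist ev N) (sub_str P) (sub_la la);
  g_split : forall n x y, n < N -> ev n <> Noop -> P x -> P y ->
    pre (la x) n = pre (la y) n -> lat (la x) n = lat (la y) n;
  g_bit : forall n c ka i x, n < N -> ev n = Forbid c ka -> P x -> pre (la x) n = ka i ->
    (lat (la x) n).1;
  g_na : forall n u y, n < N -> ev n = Code u y -> forall (T : Type) (B' : bstr S T) (x : T -> V),
    (forall t, P (x t)) -> allowed (hist ev n) B' (fun t => pre (la (x t)) n) ->
    allowed (hist ev n.+1) B' (fun t => pre (la (x t)) n.+1) }.

Lemma push N ev la (P P' : V -> Prop) e (l : V -> letter) : good N ev la P ->
  (forall x, P' x -> P x) -> wfe N e ->
  allowed (e :: hist ev N) (sub_str P') (sub_la (P := P') (fun x => l x :: la x)) ->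
  (e <> Noop -> forall x y, P' x -> P' y -> la x = la y -> l x = l y) ->
  (forall c ka i x, e = Forbid c ka -> P' x -> la x = ka i -> (l x).1) ->
  (forall u y, e = Code u y -> forall (T : Type) (B' : bstr S T) (x : T -> V),
    (forall t, P' (x t)) -> allowed (hist ev N) B' (la \o x) ->
    allowed (e :: hist ev N) B' (fun t => l (x t) :: la (x t))) ->
  good N.+1 (fun n => if n == N then e else ev n) (fun x => l x :: la x) P'.
Proof.
move=> [z w al sp bi na] sub we al' sp' bi' na'.
have hE n : n <= N -> hist (fun n => if n == N then e else ev n) n = hist ev n.
  move=> le; apply: eq_hist => i lt; rewrite ltn_eqF //; exact: leq_trans le.
have lN x : lat (l x :: la x) N = l x by rewrite -(z x) lat_last.
have pN x : pre (l x :: la x) N = la x by rewrite -(z x) pre_last.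
have pN' x : pre (l x :: la x) N.+1 = l x :: la x by apply: pre_id; rewrite /= z.
split.
- by move=> x /=; rewrite z.
- by move=> n; rewrite ltnS leq_eqVlt => /predU1P [->|lt]; rewrite ?eqxx ?ltn_eqF //; exact: w.
- by rewrite /= eqxx hE.
- move=> n x y; rewrite ltnS leq_eqVlt => /predU1P [->|lt].
    by rewrite eqxx !pN !lN; move=> ne; exact: sp'.
  rewrite ltn_eqF // => ne Px Py; rewrite !pre_cons ?z ?(ltnW lt) // !lat_cons ?z //.
  by apply: sp => //; exact: sub.
- move=> n c ka i x; rewrite ltnS leq_eqVlt => /predU1P [->|lt].
    by rewrite eqxx pN lN; exact: bi'.
  rewrite ltn_eqF // => ne Px; rewrite pre_cons ?z ?(ltnW lt) // lat_cons ?z //.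
  by apply: bi ne _ => //; exact: sub.
- move=> n u y; rewrite ltnS leq_eqVlt => /predU1P [->|lt].
    rewrite eqxx => E T B' x Px al0.
    have -> : hist (fun n => if n == N then e else ev n) N.+1 = e :: hist ev N.
      by rewrite [LHS]/= eqxx hE.
    have -> : (fun t => pre (l (x t) :: la (x t)) N.+1) = fun t => l (x t) :: la (x t).
      by apply/funext => t; rewrite pN'.
    apply: na' E _ _ _ Px _.
    move: al0; rewrite hE //; congr allowed; apply/funext => t; exact: pN.
  rewrite ltn_eqF // => E T B' x Px al0.
  rewrite hE //; have := na n u y lt E T B' x (fun t => sub _ (Px t)).
  move: al0; rewrite hE ?(ltnW lt) //.
  have -> : (fun t => pre (l (x t) :: la (x t)) n) = fun t => pre (la (x t)) n.
    by apply/funext => t; rewrite pre_cons ?z // ltnW.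
  have -> : (fun t => pre (l (x t) :: la (x t)) n.+1) = fun t => pre (la (x t)) n.+1.
    by apply/funext => t; rewrite pre_cons ?z.
  by move=> al0; apply.
Qed.

Definition tr : letter := (true, ord0).
Definition stretch k (la : V -> word) (x : V) : word := nseq k tr ++ la x.

(** A tuple realized over its nodes by uncoded vertices has to stay; every other tuple of [L] is
    forbidden, one per level. All vertices take the letter [tr], so that they are bound by each
    prohibition and no split occurs. *)
Lemma forbid_all N ev la (P : V -> Prop) (L : seq (constr S * {ffun 'I_(wid S) -> word})) :
  good N ev la P -> (forall p, p \in L -> forall i, size (p.2 i) = N) ->
  exists k ev', [/\ good (N + k) ev' (stretch k la) P, forall n, n < N -> ev' n = ev n
    & forall p, p \in L ->
      (exists f, [/\ forall i, P (f i), realize p.1 K f & forall i, la (f i) = p.2 i]) \/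
      exists2 t, t < k & ev' (N + t) = Forbid p.1 [ffun i => nseq t tr ++ p.2 i]].
Proof.
move=> g; elim: L => [|[c ka] L IH] zL; first by exists 0, ev; rewrite addn0.
have [|k [ev' [g' e' L']]] := IH; first by move=> p pL; apply: zL; rewrite in_cons pL orbT.
have [r|nr] := pselect (exists f, [/\ forall i, P (f i), realize c K f & forall i, la (f i) = ka i]).
  by exists k, ev'; split=> // p; rewrite in_cons => /predU1P [->|/L' //]; left.
exists k.+1, (fun n => if n == N + k then Forbid c [ffun i => nseq k tr ++ ka i] else ev' n); split.
- rewrite addnS; apply: (push (P' := P) (l := fun=> tr) g') => //.
  + by move=> i; rewrite ffunE size_cat size_nseq (zL (c, ka) (mem_head _ _) i) addnC.
  + split; first exact: (g_al g').
    move=> [f [[r1 r2] fE]]; apply: nr; exists (fun i => sval (f i)); split.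
    * by move=> i; exact: svalP.
    * split=> [i|i j]; first exact: r1.
      by have [e1 e2] := r2 i j; split=> // /e2 ->.
    * move=> i; have [/= + _] := fE i; rewrite ffunE /sub_la /= => /eqP.
      by rewrite eqseq_cat // => /andP [_ /eqP].
- move=> n lt; rewrite ltn_eqF ?e' //; exact: ltn_addr.
- move=> p; rewrite in_cons => /predU1P [->|/L' [r|[t lt E]]]; first 1 last.
  + by left.
  + by right; exists t; [exact: ltnW|rewrite ltn_eqF ?ltn_add2l].
  + by right; exists k => //; rewrite eqxx.
Qed.

Lemma lat_stretch k la x N t : size (la x) = N -> t < k ->
  pre (stretch k la x) (N + t) = nseq t tr ++ la x /\ lat (stretch k la x) (N + t) = tr.
Proof.
move=> z lt.
have sf n : n <= k -> pre (stretch k la x) (N + n) = nseq n tr ++ la x.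
  move=> le; have sz : size (nseq n tr ++ la x) = N + n by rewrite size_cat size_nseq z addnC.
  rewrite -sz; apply: pre_sfx; exists (nseq (k - n) tr).
  by rewrite /stretch catA cat_nseq -[ncons _ _ _]cat_nseq /= -nseqD subnK.
split; first by apply: sf; exact: ltnW.
by rewrite /lat -addnS sf.
Qed.

(** A [Noop] level isolates [v] and splits the others by their relation to [v]; then all unrealized
    tuples are forbidden, which makes coding [v] free. Indeed the points other than [v] in a new
    obstruction realize a tuple that is not forbidden, so vertices of [K] imitate them, with the
    same relations to [v]; but [K] itself is allowed. *)
Lemma stage N ev la (P : V -> Prop) v : good N ev la P -> P v ->
  exists M ev' la', [/\ N <= M, good M.+1 ev' la' (fun x => P x /\ x <> v),
   (forall n, n < N -> ev' n = ev n) /\ (forall x, sfx (la x) (la' x)),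
   good M ev' (fun x => pre (la' x) M) P &
   ev' M = Code (un K v) (pre (la' v) M) /\
   forall x, P x -> x <> v -> (lat (la' x) M).2 = re K x v].
Proof.
move=> g Pv; have [z _ _ _ _ _] := g.
pose la1 x : word := (`[< x = v >], re K x v) :: la x.
pose ev1 n := if n == N then Noop else ev n.
have g1 : good N.+1 ev1 la1 P.
  by apply: (push (P' := P) g) => //; exact: (g_al g).
pose mkp (p : constr S * {ffun 'I_(wid S) -> (N.+1).-tuple letter}) :
  constr S * {ffun 'I_(wid S) -> word} := (p.1, [ffun i => tval (p.2 i)]).
pose L := map mkp (enum {: constr S * {ffun 'I_(wid S) -> (N.+1).-tuple letter}}).
have [|k [ev2 [g2 e2 L2]]] := forbid_all (L := L) g1.
  by move=> _ /mapP [p _ ->] i; rewrite /= ffunE size_tuple.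
set M := N.+1 + k in g2; set la2 := stretch k la1 in g2.
have z2 x : size (la2 x) = M by exact: (g_size g2).
pose la3 x := (false, re K x v) :: la2 x.
pose ev3 n := if n == M then Code (un K v) (la2 v) else ev2 n.
have p3 x : pre (la3 x) M = la2 x by rewrite -(z2 x) pre_last.
have la2_inj x y : la2 x = la2 y -> la1 x = la1 y.
  by move=> /eqP; rewrite /la2 /stretch eqseq_cat // => /andP [_ /eqP].
have NM : N <= M by rewrite /M addSn; apply: leqW; exact: leq_addr.
have key (T : Type) (B' : bstr S T) (x : T -> V) : (forall t, P (x t) /\ x t <> v) ->
    allowed (hist ev2 M) B' (la2 \o x) ->
    allowed (hist ev2 M) (addv B' (un K v) (fun t => re K (x t) v))
      (fun a => if a is Some t then la2 (x t) else la2 v).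
  move=> Px al; apply: contrapT => /not_allowed_local [X [f [cX irr nal]]].
  pose Tf := {classic T}.
  pose ts : seq Tf := undup (pmap (fun a => f a : option Tf) (enum X)).
  have tsP a t : f a = Some t -> (t : Tf) \in ts.
    by move=> fa; rewrite mem_undup mem_pmap; apply/mapP; exists a; rewrite ?mem_enum.
  have tsQ (t : Tf) : t \in ts -> exists a, f a = Some t.
    by rewrite mem_undup mem_pmap => /mapP [a _ E]; exists a.
  have [[a0 fa0]|nn] := pselect (exists a, f a = None); last first.
    have ex a : exists t, f a = Some t.
      by case E : (f a) => [t|]; [exists t|case: nn; exists a].
    have [h hP] := choice ex; apply: nal.
    have := allowed_pull h al; have -> : f = Some \o h by apply/funext => a /=.
    by congr (allowed _ _ _); exact: str_eq.
  (* The point [a0] on the coded vertex uses up one of the [(wid S).+1] points, so one constraint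
     can describe the others. *)
  have zts : size ts <= wid S.
    apply: leq_trans (size_undup _) _; rewrite size_pmap.
    have : count (fun a => isSome (f a)) (enum X) < #|X|.
      rewrite cardE -(count_predC (fun a => isSome (f a)) (enum X)) -addn1 leq_add2l.
      rewrite -has_count; apply/hasP; exists a0; first by rewrite mem_enum.
      by rewrite /= fa0.
    by move=> lt; rewrite count_map -ltnS; apply: leq_trans cX; move: lt; rewrite enumT.
  have [q [q1 q2]] : exists q : X -> {x | P x}, (forall a, un K (sval (q a)) = un (addv B' (un K v) (fun t => re K (x t) v)) (f a) /\
       la2 (sval (q a)) = (if f a is Some t then la2 (x t) else la2 v)) /\
      forall a b, re K (sval (q a)) (sval (q b)) = re (addv B' (un K v) (fun t => re K (x t) v)) (f a) (f b).
    have [ts0|[t0 t0s]] : ts = [::] \/ exists t0 : Tf, t0 \in ts.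
      by case: (ts) => [|t0 ts']; [left|right; exists t0; exact: mem_head].
      have fN a : f a = None.
        by case E : (f a) => [t|] //; have := tsP a t E; rewrite ts0.
      exists (fun=> exist _ v Pv); split=> [a|a b] /=; rewrite !fN //.
      exact: sK.1.
    pose gt (i : 'I_(wid S)) : Tf := nth t0 ts i.
    have gts i : gt i \in ts.
      rewrite /gt; have [lt|le] := ltnP i (size ts); first exact: mem_nth.
      by rewrite nth_default.
    have gon (t : Tf) : t \in ts -> exists i, gt i = t.
      move=> tt; have lt : index t ts < wid S by apply: leq_trans zts; rewrite index_mem.
      by exists (Ordinal lt); rewrite /gt nth_index.
    pose c : constr S := ([ffun i => un B' (gt i)], [ffun i => [ffun j => re B' (gt i) (gt j)]]).
    have rc : realize c B' gt.
      split=> [i|i j]; first by rewrite ffunE.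
      rewrite !ffunE; split=> // r0; have [a fa] := tsQ _ (gts i); have [b fb] := tsQ _ (gts j).
      have := irr a b; rewrite fa fb /= => /(_ r0) [] //.
    pose ka : {ffun 'I_(wid S) -> (N.+1).-tuple letter} :=
      [ffun i => insubd [tuple of nseq N.+1 l0] (la1 (x (gt i)))].
    have kaE i : tval (ka i) = la1 (x (gt i)).
      by rewrite ffunE val_insubd (g_size g1) eqxx.
    have pL : (c, [ffun i => tval (ka i)] : {ffun 'I_(wid S) -> word}) \in L.
      by apply/mapP; exists (c, ka) => //; rewrite mem_enum.
    have [[psi [Pp [rp1 rp2] pE]]|[t lt E]] := L2 _ pL; last first.
      have al' : allowed (hist ev2 (N.+1 + t).+1) B' (fun s => pre (la2 (x s)) (N.+1 + t).+1).
        apply: allowed_down al => //.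
        - by rewrite /M -addnS leq_add2l.
        - by move=> s; apply: size_pre; rewrite z2 /M -addnS leq_add2l.
        - by move=> s; exact: z2.
        - by move=> s; exact: sfx_pre.
      move: al'; rewrite /= E => -[_]; case; exists gt; split=> // i.
      have [h1 h2] := lat_stretch (g_size g1 (x (gt i))) lt.
      split; last by have := h2; rewrite /lat => ->.
      by rewrite ffunE /= ffunE kaE -h1; apply: behead_pre; rewrite z2 /M ltn_add2l.
    have pE' i : la1 (psi i) = la1 (x (gt i)) by rewrite pE ffunE kaE.
    have [iv ivP] := choice (fun t : {t : Tf | t \in ts} => gon (sval t) (svalP t)).
    have exq a : exists s : {x | P x}, match f a with
        | Some t => exists2 i, gt i = t & sval s = psi i | None => sval s = v end.
      case E : (f a) => [t|]; last by exists (exist _ v Pv).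
      have [i gi] := gon t (tsP a t E).
      by exists (exist _ (psi i) (Pp i)); exists i.
    have [q qP] := choice exq; exists q.
    have reE i : re K (psi i) v = re K (x (gt i)) v by have [_ ->] := pE' i.
    split=> [a|a b].
      have := qP a; case: (f a) => [t [i <- ->]|->] //=; split.
        by rewrite rp1 ffunE.
      by rewrite /la2 /stretch pE'.
    have := qP a; have := qP b.
    case: (f a) => [t|]; case: (f b) => [t'|].
    + move=> [j <- ->] [i <- ->] /=; have [-> _] := rp2 i j; by rewrite !ffunE.
    + by move=> -> [i <- ->] /=; exact: reE.
    + by move=> [i <- ->] -> /=; rewrite sK.2 reE.
    + by move=> -> -> /=; exact: sK.1.
  apply: nal; have := allowed_pull q (g_al g2); congr (allowed _ _ _).
    by apply: str_eq => [a|a b] /=; [rewrite (q1 a).1|rewrite q2].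
  by apply/funext => a; exact: (q1 a).2.
exists M, ev3, la3; split=> //.
- apply: (push (P' := fun x => P x /\ x <> v) (l := fun x => (false, re K x v)) g2).
  + by move=> x [].
  + exact: z2.
  + apply: (key _ (sub_str (fun x => P x /\ x <> v)) (fun t => sval t) (fun t => svalP t)).
    exact: (allowed_pull (fun t : {x | P x /\ x <> v} => exist P (sval t) (proj1 (svalP t))) (g_al g2)).
  + by move=> _ x y _ _ /la2_inj [_ ->].
  + by [].
  + move=> u y [_ _] T B' x Px al; exact: (key _ _ _ Px al).
- split=> [n lt|x].
    rewrite /ev3 ltn_eqF; last exact: leq_trans NM.
    rewrite e2; [by rewrite /ev1 (ltn_eqF lt)|exact: ltnW].
  exists ((false, re K x v) :: rcons (nseq k tr) (`[< x = v >], re K x v)).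
  by rewrite /la3 /la2 /stretch /la1 cat_cons cat_rcons.
- have -> : (fun x => pre (la3 x) M) = la2 by apply/funext.
  have eE n : n < M -> ev3 n = ev2 n by move=> lt; rewrite /ev3 ltn_eqF.
  have hE n : n <= M -> hist ev3 n = hist ev2 n.
    by move=> le; apply: eq_hist => i lt; apply: eE; exact: leq_trans le.
  have [a b c d e f] := g2; split=> //.
  + by move=> n lt; rewrite eE //; exact: b.
  + by rewrite hE.
  + by move=> n x y lt; rewrite eE //; exact: d.
  + by move=> n cc ka i x lt; rewrite eE //; exact: e.
  + by move=> n u y lt; rewrite eE // hE ?(ltnW lt) // hE //; exact: f.
- split; first by rewrite /ev3 eqxx p3.
  by move=> x Px nx; rewrite -(z2 x) lat_last.
Qed.

Lemma stage_opt n N ev la : good N ev la (fun x => n <= cd x) ->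
  exists N' ev' la', [/\ N < N', good N' ev' la' (fun x => n < cd x),
   (forall i, i < N -> ev' i = ev i) /\ (forall x, sfx (la x) (la' x)) &
   forall v, cd v = n -> exists M, [/\ N <= M, M < N',
     good M ev' (fun x => pre (la' x) M) (fun x => n <= cd x),
     ev' M = Code (un K v) (pre (la' v) M) &
     forall x, n < cd x -> (lat (la' x) M).2 = re K x v]].
Proof.
move=> g; have [[v vn]|nv] := pselect (exists v, cd v = n).
  have [|M [ev' [la' [NM g' [e1 e2] gM [cM rM]]]]] := stage (v := v) g; first by rewrite vn.
  exists M.+1, ev', la'; split=> //.
    have -> : (fun x => n < cd x) = (fun x => n <= cd x /\ x <> v) :> (V -> Prop).
      apply/funext => x; apply/propext; rewrite ltn_neqAle; split.
        by move=> /andP [ne le]; split=> // xv; move: ne; rewrite xv vn eqxx.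
      by move=> [-> ne]; rewrite andbT; apply/eqP => e; apply: ne; apply: cd_inj; rewrite -e vn.
    exact: g'.
  move=> v' v'n; have -> : v' = v by apply: cd_inj; rewrite vn.
  exists M; split=> // x lt; apply: rM; first exact: ltnW.
  by move=> xv; move: lt; rewrite xv vn ltnn.
exists N.+1, (fun i => if i == N then Noop else ev i), (fun x => l0 :: la x); split=> //.
- apply: (push (P' := fun x => n < cd x) g) => //; first by move=> x; exact: ltnW.
  exact: (allowed_pull (fun t : {x | n < cd x} => exist (fun x => n <= cd x) (sval t) (ltnW (svalP t))) (g_al g)).
- split=> [i lt|x]; first by rewrite ltn_eqF.
  by exists [:: l0].
- by move=> v vn; case: nv; exists v.
Qed.

Theorem thin_exists : exists ev wd, thin K ev wd.
Proof.
pose X := (nat * (nat -> event) * (V -> word))%type.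
pose P (n : nat) (x : X) := good x.1.1 x.1.2 x.2 (fun v => n <= cd v).
pose R (n : nat) (x y : X) := [/\ x.1.1 < y.1.1,
  (forall i, i < x.1.1 -> y.1.2 i = x.1.2 i) /\ (forall v, sfx (x.2 v) (y.2 v)) &
   forall v, cd v = n -> exists M, [/\ x.1.1 <= M, M < y.1.1,
     good M y.1.2 (fun x => pre (y.2 x) M) (fun x => n <= cd x),
     y.1.2 M = Code (un K v) (pre (y.2 v) M) &
     forall x, n < cd x -> (lat (y.2 x) M).2 = re K x v]].
have [||f [_ fP]] := @dep_choice X P R (0, fun=> Noop, fun=> [::]).
- by split=> //= j [h [h1 h2]]; apply: (fK (j := j)); exists (fun a => sval (h a)).
- move=> n [[N ev] la] /= g; have [N' [ev' [la' [h1 h2 h3 h4]]]] := stage_opt g.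
  by exists (N', ev', la').
pose N n := (f n).1.1; pose e n := (f n).1.2; pose la n := (f n).2.
have Nlt n : N n < N n.+1 by case: (fP n) => _ [].
have Nle m n : m <= n -> N m <= N n.
  move=> /subnKC <-; elim: (n - m) => [|d IH]; first by rewrite addn0.
  by rewrite addnS; apply: leq_trans IH (ltnW (Nlt _)).
have leN n : n <= N n by elim: n => // n IH; exact: leq_ltn_trans IH (Nlt n).
have eE m n i : m <= n -> i < N m -> e n i = e m i.
  move=> /subnKC <-; elim: (n - m) => [|d IH] lt; first by rewrite addn0.
  have [_ [_ [E _] _]] := fP (m + d); rewrite addnS -IH //; apply: E.
  by apply: leq_trans lt (Nle _ _ (leq_addr _ _)).
have laS m n x : m <= n -> sfx (la m x) (la n x).
  move=> /subnKC <-; elim: (n - m) => [|d IH]; first by rewrite addn0; exact: sfx_refl.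
  have [_ [_ [_ E] _]] := fP (m + d); rewrite addnS; exact: sfx_trans IH (E x).
pose ev i := e i.+1 i.
have evE n i : i < N n -> ev i = e n i.
  move=> lt; rewrite /ev; have [le|le] := leqP n i.+1; first exact: eE.
  by rewrite (eE i.+1 n i (ltnW le) (leN i.+1)).
have hE n i : i <= N n -> hist ev i = hist (e n) i.
  by move=> le; apply: eq_hist => j lt; apply: evE; exact: leq_trans le.
have gsz n x : size (la n x) = N n by apply: g_size; exact: (fP n).1.
have exM v : exists M, [/\ N (cd v) <= M, M < N (cd v).+1,
     good M (e (cd v).+1) (fun x => pre (la (cd v).+1 x) M) (fun x => cd v <= cd x),
     e (cd v).+1 M = Code (un K v) (pre (la (cd v).+1 v) M) &
     forall x, cd v < cd x -> (lat (la (cd v).+1 x) M).2 = re K x v].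
  by have [_ [_ _ H]] := fP (cd v); exact: H.
have [M MP] := choice exM.
pose wd v := pre (la (cd v).+1 v) (M v).
have zwd v : size (wd v) = M v.
  by have [_ lt _ _ _] := MP v; rewrite size_pre // gsz ltnW.
have Mlt a b : cd a < cd b -> M a < M b.
  move=> lt; have [_ h1 _ _ _] := MP a; have [h2 _ _ _ _] := MP b.
  exact: leq_trans h1 (leq_trans (Nle _ _ lt) h2).
have cdlt a b : M a < M b -> cd a < cd b.
  move=> lt; rewrite ltnNge leq_eqVlt; apply/negP => /predU1P [/cd_inj E|/Mlt lt'].
    by move: lt; rewrite E ltnn.
  by have := ltn_trans lt lt'; rewrite ltnn.
(* The stage coding [a] already has the final words, up to level [M a], of [a] and all later
   vertices. The clauses of [thin] are read off at such a stage. *)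
have W a x k : cd a <= cd x -> k <= M a -> pre (wd x) k = pre (la (cd a).+1 x) k.
  move=> le kM; have [_ ltM _ _ _] := MP a; have [_ ltMx _ _ _] := MP x.
  move: le; rewrite leq_eqVlt => /predU1P [/cd_inj E|lt].
    by rewrite /wd -E pre_pre // gsz ltnW.
  have lMM := Mlt a x lt.
  rewrite /wd pre_pre ?gsz ?(ltnW ltMx) //; last by rewrite (leq_trans kM) // ltnW.
  have <- := pre_sfx (laS (cd a).+1 (cd x).+1 x (leqW lt)).
  rewrite gsz pre_pre // ?gsz; first by apply: leq_trans kM _; exact: ltnW.
  by apply: Nle; exact: leqW.
have pp a x k : cd a <= cd x -> k <= M a -> pre (pre (la (cd a).+1 x) (M a)) k = pre (wd x) k.
  by move=> le kM; have [_ lt _ _ _] := MP a; rewrite pre_pre ?gsz ?(ltnW lt) // (W a).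
have ll a x k : cd a <= cd x -> k < M a -> lat (pre (la (cd a).+1 x) (M a)) k = lat (wd x) k.
  by move=> le kM; rewrite /lat pp.
have evM a k : k <= M a -> ev k = e (cd a).+1 k.
  by move=> le; have [_ lt _ _ _] := MP a; apply: evE; exact: leq_ltn_trans lt.
have hM a k : k <= M a -> hist ev k = hist (e (cd a).+1) k.
  by move=> le; have [_ lt _ _ _] := MP a; apply: hE; apply: leq_trans le _; exact: ltnW.
have thv n : valid (hist ev n).
  have := valid_allowed (g_al (fP n).1); rewrite -/(N n) -/(e n) -hE //.
  have [ds [-> _]] := hist_cat ev (leN n).
  by move=> /allowed_cat; apply: allowed_void; case.
have sym n a b : ev n <> Noop -> cd a <= cd b -> n < M a -> 
    pre (wd a) n = pre (wd b) n -> lat (wd a) n = lat (wd b) n.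
  move=> ne le lt E; have [_ _ g _ _] := MP a.
  rewrite -(ll a a) // -(ll a b) //; apply: (g_split g) => //; first by rewrite -evM // ltnW.
  by rewrite !pp // ltnW.
exists ev, wd; split=> //.
- move=> n; rewrite (evE n.+1); last exact: leN.
  apply: (g_wf (fP n.+1).1); exact: leN.
- by move=> a; rewrite zwd (evM a) //; have [_ _ _ -> _] := MP a.
- move=> a b; rewrite !zwd => E; apply: cd_inj.
  case: (ltngtP (cd a) (cd b)) => // /Mlt; by rewrite E ltnn.
- move=> a b; rewrite !zwd => lt; have ltc := cdlt b a lt.
  have [_ lt' _ _ <-] := MP b => //.
  rewrite /lat /wd pre_pre ?gsz //; last by have [_ h _ _ _] := MP a; exact: ltnW.
  have <- := pre_sfx (laS (cd b).+1 (cd a).+1 a (leqW ltc)).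
  by rewrite gsz pre_pre // gsz; apply: Nle; exact: leqW.
- move=> n a b ne; rewrite !zwd => la_ lb E.
  case: (leqP (cd a) (cd b)) => le; first exact: sym.
  by apply/esym; apply: sym => //; exact: ltnW.
- move=> n c ka i a E; rewrite zwd => lt pE; have [_ _ g _ _] := MP a.
  rewrite -(ll a a) //; apply: (g_bit g (n := n) (c := c) (ka := ka) (i := i)) => //.
    by rewrite -evM // ltnW.
- move=> n u y E T B' x lt al.
  have [[t0 _]|nT] := pselect (exists t : T, True); last first.
    by apply: allowed_void (thv n.+1) => t; apply: nT; exists t.
  (* The earliest coded of the given vertices determines a stage that sees all of them. *)
  have [t tmin] : exists t, forall t', cd (x t) <= cd (x t').
    have ex : exists k, `[< exists t, cd (x t) = k >] by exists (cd (x t0)); apply/asboolP; exists t0.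
    have := ex_minnP ex; case=> k /asboolP [t tk] mi; exists t => t'.
    by rewrite tk; apply: mi; apply/asboolP; exists t'.
  have ltt := lt t; rewrite zwd in ltt; have [_ _ g _ _] := MP (x t).
  have E' : e (cd (x t)).+1 n = Code u y by rewrite -evM // ltnW.
  have := g_na g ltt E' tmin (B' := B'); rewrite -!hM ?(ltnW ltt) //.
  have -> : (fun t0 => pre (pre (la (cd (x t)).+1 (x t0)) (M (x t))) n) = fun t0 => pre (wd (x t0)) n.
    by apply/funext => t'; rewrite pp // ltnW.
  have -> : (fun t0 => pre (pre (la (cd (x t)).+1 (x t0)) (M (x t))) n.+1) = fun t0 => pre (wd (x t0)) n.+1.
    by apply/funext => t'; rewrite pp.
  by apply.
Qed.

End Existence.

(** * Universality of the generic diary *)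

Section Universal.
Variable S : setup.
Local Notation word := (word S).
Local Notation event := (event S).
Local Notation G := (@gen S).
Hypothesis flipK : involutive (@flip S).

(** Each next event is legal at the forced images, hence performed later by the generic diary up to
    padding. *)
Lemma into_gen ev : wfev ev -> (forall n, valid (hist ev n)) ->
  exists N h, demb ev G N h.
Proof.
move=> w v.
have v0 : valid ([::] : seq event) := v 0.
have [||| |N [h [d _ _]]] := @pemb_limit S ev G 0 id id (fun _ _ _ => True) => //.
  move=> i N h _ p _ _.
  have zc s : size s = i -> size (cfor h s) = base N i by exact: size_cfor p.
  have fi (T : Type) (B : bstr S T) (la : T -> word) : (forall x, size (la x) = i) ->
      allowed (hist ev i) B la -> allowed (hist G (base N i)) B (cfor h \o la).
    by move=> zl /(forced_iff B w p zl).
  have [m [_ le Gm]] := gen_match 0 v0 (w i) (v i.+1) zc fi.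
  exists (fun j => if j == i then m else N j),
    (fun s => if size s == i then padto m (cfor h s) else h s).
  split=> //; last exact: agr_upd.
  apply: (pemb_extend (t := @padto S m \o cfor h)) => //.
    by move=> s zs /=; split; [rewrite size_padto // zc|exact: sfx_padto].
  move=> T B la zl al; apply: (allowed_pad (la := cfor h \o la)) al => //.
    exact: valid_gen.
  by move=> x; exact: zc.
by exists N, h.
Qed.

(** The right summand stands for coded vertices, named by their words; between two of them the
    longer word carries the letter. *)
Definition bigre (T : Type) (B : bstr S T) (la : T -> word) (x y : T + word) : 'I_(s_k S).+1 :=
  match x, y with
  | inl t, inl t' => re B t t'
  | inl t, inr s => (lat (la t) (size s)).2
  | inr s, inl t => flip (lat (la t) (size s)).2
  | inr s, inr s' => if size s' < size s then (lat s (size s')).2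
      else if size s < size s' then flip (lat s' (size s)).2 else ord0
  end.

Lemma lat_behead (s : word) n : n.+1 < size s -> lat (behead s) n = lat s n.
Proof. by case: s => // l s lt; rewrite lat_cons. Qed.

Lemma head_lat (s : word) n : size s = n.+1 -> head l0 s = lat s n.
Proof. by case: s => // l s [<-]; rewrite lat_last. Qed.

(* The vertices coded by an allowed history form, together with any structure
   allowed by it, a structure in the class. *)
Lemma allowed_forb ev n (T : Type) (B : bstr S T) la (Y : Type) (BY : bstr S Y)
    (p : Y -> T + word) : wfev ev ->
  (forall x, size (la x) = n) -> allowed (hist ev n) B la ->
  (forall y, match p y with inl t => un BY y = un B t
     | inr s => size s < n /\ ev (size s) = Code (un BY y) s end) ->
  (forall y y', re BY y y' = bigre B la (p y) (p y')) -> forb BY.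
Proof.
move=> w; elim: n T B la p => [|n IH] T B la p z al hu hr.
  have ex y : exists t, p y = inl t.
    by have := hu y; case: (p y) => [t|s []] //; exists t.
  have [q qP] := choice ex.
  have -> : BY = pull B q.
    apply: str_eq => [y|y y'] /=; last by rewrite hr !qP.
    by have := hu y; rewrite qP.
  exact: forb_pull.
have skip : (forall u s, ev n <> Code u s) -> allowed (hist ev n) B (behead \o la) -> forb BY.
  move=> ne al'; apply: (IH T B (behead \o la) p _ al').
  - by move=> x; rewrite /= size_behead z.
  - move=> y; have := hu y; case: (p y) => // s [lt E]; split=> //.
    move: lt; rewrite ltnS leq_eqVlt => /predU1P [sn|//].
    by case: (ne (un BY y) s); rewrite -sn.
  - have lt' y s : p y = inr s -> size s < n.
      move=> py; have := hu y; rewrite py => -[lt E].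
      move: lt; rewrite ltnS leq_eqVlt => /predU1P [sn|//].
      by case: (ne (un BY y) s); rewrite -sn.
    move=> y y'; rewrite hr; case py : (p y) => [t|s]; case py' : (p y') => [t'|s'] //=.
      by rewrite lat_behead // z ltnS (lt' y').
    by rewrite lat_behead // z ltnS (lt' y).
move: al; rewrite /=; case E : (ev n) => [|c ka|u x].
- by apply: skip => u s; rewrite E.
- by move=> [al _]; apply: skip al => u s; rewrite E.
pose p' y : option T + word := match p y with
  | inl t => inl (Some t)
  | inr s => if size s == n then inl None else inr s end.
have zx : size x = n by have := w n; rewrite E.
move=> al; apply: (IH _ _ _ p' _ al).
- by case=> [t|] //=; rewrite size_behead z.
- move=> y; rewrite /p'; have := hu y; case: (p y) => [t|s] //= [lt Es].
  case: eqP => [sn|/eqP ne]; first by move: Es; rewrite sn E /= => -[].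
  by split=> //; rewrite ltn_neqAle ne.
- have sx y s : p y = inr s -> (size s == n) -> s = x.
    by move=> py /eqP sn; have := hu y; rewrite py sn E => -[_ []].
  have sl y s : p y = inr s -> (size s == n) = false -> size s < n.
    by move=> py ne; have := hu y; rewrite py => -[lt _]; rewrite ltn_neqAle ne.
  move=> y y'; rewrite hr /p'; case py : (p y) => [t|s]; case py' : (p y') => [t'|s'] //.
  + rewrite /bigre; case: ifP => [sn|sn] /=; first by rewrite (eqP sn) (head_lat (z t)).
    by rewrite lat_behead // z ltnS (sl y').
  + rewrite /bigre; case: ifP => [sn|sn] /=; first by rewrite (eqP sn) (head_lat (z t')).
    by rewrite lat_behead // z ltnS (sl y).
  + case: ifP => sn; case: ifP => sn' //; rewrite /bigre.
    * by rewrite (eqP sn) (eqP sn') ltnn.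
    * have lt' := sl y' s' py' sn'.
      by rewrite (eqP sn) lt' (sx y s py sn).
    * have lt := sl y s py sn.
      by rewrite (eqP sn') lt (sx y' s' py' sn') ltnNge (ltnW lt).
Qed.

Variables (V : Type) (K : bstr S V).
Hypothesis sK : symmetric_str K.
Hypothesis Kext : forall (T : finType) (B : bstr S (option T)) (f : T -> V),
  symmetric_str B -> forb B -> injective f -> hom (pull B Some) K f ->
  exists x, [/\ forall t, f t <> x, un K x = un B None
    & forall t, re K (f t) x = re B (Some t) None].

Definition selfemb (th : V -> V) := injective th /\ hom K K th.

Lemma selfemb_comp f g : selfemb f -> selfemb g -> selfemb (f \o g).
Proof.
move=> [fi [f1 f2]] [gi [g1 g2]]; split; first exact: inj_comp.
by split=> [a|a b] /=; rewrite ?f1 ?f2.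
Qed.

Lemma selfemb_id : selfemb id. Proof. by split. Qed.

Definition coded (s : word) := exists u, G (size s) = Code u s.

(** All coded words of the generic diary together form a structure whose finite parts are in the
    class by [allowed_forb]; the extension property of [K] places them level by level. *)
Lemma rho_exists (x0 : V) : valid ([::] : seq event) -> exists rho : word -> V,
  (forall s u, G (size s) = Code u s -> un K (rho s) = u) /\
  (forall s s', coded s -> coded s' -> size s' < size s ->
     re K (rho s) (rho s') = (lat s (size s')).2 /\ rho s <> rho s').
Proof.
move=> v0.
pose P n (rho : word -> V) :=
  (forall s u, size s < n -> G (size s) = Code u s -> un K (rho s) = u) /\
  (forall s s', coded s -> coded s' -> size s < n -> size s' < size s ->
     re K (rho s) (rho s') = (lat s (size s')).2 /\ rho s <> rho s').
pose R n (rho rho' : word -> V) := forall s, size s < n -> rho' s = rho s.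
have [||f [_ fP]] := @dep_choice _ P R (fun=> x0) => //.
  move=> n rho [P1 P2].
  have [[u [y Ey]]|ne] := pselect (exists u y, G n = Code u y); last first.
    have lt s : size s < n.+1 -> coded s -> size s < n.
      rewrite ltnS leq_eqVlt => /predU1P [sn [u Eu]|//].
      by case: ne; exists u, s; rewrite -sn.
    exists rho; split=> //; split=> [s u l E|s s' cs cs' l l'].
      by apply: P1 => //; apply: lt => //; exists u.
    by apply: P2 => //; exact: lt.
  pose cws := flatten [seq (if G i is Code _ s then [:: s] else [::]) | i <- iota 0 n].
  have cwsP s : s \in cws <-> size s < n /\ coded s.
    split=> [/flatten_mapP [i]|[lt [u' E]]].
      rewrite mem_iota /= add0n => lt; have := @wfev_gen S i; case E : (G i) => [| |u' s'] //= zs.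
      by rewrite mem_seq1 => /eqP ->; rewrite zs; split=> //; exists u'; rewrite zs.
    by apply/flatten_mapP; exists (size s); rewrite ?mem_iota // E mem_seq1.
  have zy : size y = n by have := @wfev_gen S n; rewrite Ey.
  pose T : finType := seq_sub cws.
  pose wo (a : option T) : word := if a is Some t then ssval t else y.
  have woC a : coded (wo a).
    case: a => [[s sc]|] /=; first by case/cwsP: sc.
    by exists u; rewrite zy.
  pose B : bstr S (option T) := Str
    (fun a => if G (size (wo a)) is Code u' _ then u' else u)
    (fun a b => bigre (vstr S) (fun=> [::]) (inr (wo a)) (inr (wo b))).
  have szT (t : T) : size (ssval t) < n by case: t => s /= /cwsP [].
  have sB : symmetric_str B.
    split=> [a|a b] /=; first by rewrite ltnn.
    by case: ltngtP => //; rewrite ?flipK // flip0.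
  have fB : forb B.
    apply: (@allowed_forb G n.+1 void (vstr S) (fun x : void => match x with end) _ _ (fun a => inr (wo a))) => //.
    - exact: wfev_gen.
    - by apply: allowed_void (valid_gen n.+1 v0); case.
    - move=> a; split; first by case: a => [t|] /=; [exact: ltnW (szT t)|rewrite zy].
      by have [u' /= E] := woC a; rewrite E.
  have cT (t : T) : coded (ssval t) := woC (Some t).
  have ri : injective (fun t : T => rho (ssval t)).
    move=> t t' /= E; apply: val_inj => /=.
    case: (ltngtP (size (ssval t)) (size (ssval t'))) => lt.
    - by have [_] := P2 _ _ (cT t') (cT t) (szT t') lt; rewrite E.
    - by have [_] := P2 _ _ (cT t) (cT t') (szT t) lt; rewrite E.
    - by have [u1 E1] := cT t; have [u2] := cT t'; rewrite -lt E1 => -[].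
  have rh : hom (pull B Some) K (fun t : T => rho (ssval t)).
    split=> [t|t t'] /=.
      by have [u1 E1] := cT t; rewrite E1; apply: P1.
    case: ltnP => [lt|le]; first by have [-> _] := P2 _ _ (cT t) (cT t') (szT t) lt.
    case: ltnP => [lt|le'].
      by have [E _] := P2 _ _ (cT t') (cT t) (szT t') lt; rewrite sK.2 E.
    have ss : size (ssval t) = size (ssval t') by apply/eqP; rewrite eqn_leq le le'.
    have -> : t = t'.
      by apply: val_inj => /=; have [u1 E1] := cT t; have [u2] := cT t'; rewrite -ss E1 => -[].
    exact: sK.1.
  have [x [xn xu xr]] := Kext sB fB ri rh.
  have yE s : coded s -> size s = n -> s = y by move=> [u' E] sn; move: E; rewrite sn Ey => -[].
  exists (fun s => if s == y then x else rho s); split; last first.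
    by move=> s lt; case: eqP => // sy; move: lt; rewrite sy zy ltnn.
  have lt_ne s : size s < n -> (s == y) = false.
    by move=> lt; apply/eqP => sy; move: lt; rewrite sy zy ltnn.
  split.
    move=> s u'; rewrite ltnS leq_eqVlt => /predU1P [sn|lt] E.
      have sy : s = y by apply: yE => //; exists u'.
      by rewrite sy eqxx xu /= -sy E.
    by rewrite lt_ne // ; apply: P1.
  move=> s s' cs cs'; rewrite ltnS leq_eqVlt => /predU1P [sn|lt] l'; last first.
    by rewrite !lt_ne //; [exact: P2|exact: ltn_trans lt].
  have sy := yE s cs sn; rewrite sn in l'.
  rewrite sy eqxx lt_ne //.
  have s'c : s' \in cws by apply/cwsP.
  have /= xr' := xr (SeqSub s'c); have /= xn' := xn (SeqSub s'c).
  by split; [rewrite sK.2 xr' zy ltnNge (ltnW l') /= l' flipK|move=> E; apply: xn'].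
pose rho s := f (size s).+1 s.
have fE m n s : m <= n -> size s < m -> f n s = f m s.
  move=> /subnKC <-; elim: (n - m) => [|d IH] lt; first by rewrite addn0.
  have [_ rr] := fP (m + d); rewrite addnS rr ?IH //.
  exact: leq_trans lt (leq_addr _ _).
exists rho; split=> [s u E|s s' cs cs' lt].
  by have [[P1 _] _] := fP (size s).+1; exact: P1.
have [[_ P2] _] := fP (size s).+1.
have -> : rho s' = f (size s).+1 s' by rewrite /rho (fE (size s').+1 (size s).+1 s') // ltnW.
exact: P2.
Qed.

Lemma theta_emb ev wd N h rho : thin K ev wd -> demb ev G N h ->
  (forall s u, G (size s) = Code u s -> un K (rho s) = u) ->
  (forall s s', coded s -> coded s' -> size s' < size s ->
     re K (rho s) (rho s') = (lat s (size s')).2 /\ rho s <> rho s') ->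
  selfemb (rho \o h \o wd).
Proof.
move=> th d r1 r2.
have zh s : size (h s) = N (size s) by have [_ b _ _ _] := d (size s).+1; exact: b.
have Gh a : G (size (h (wd a))) = Code (un K a) (h (wd a)).
  have [_ _ _ e _] := d (size (wd a)).+1.
  by rewrite zh e // (th_code th).
have Nlt i j : i < j -> N i < N j by have [a _ _ _ _] := d j.+1; move=> lt; exact: a.
have key a b : size (wd b) < size (wd a) ->
    re K (rho (h (wd a))) (rho (h (wd b))) = re K a b /\ rho (h (wd a)) <> rho (h (wd b)).
  move=> lt; have [|||E ne] := r2 (h (wd a)) (h (wd b)).
  - by exists (un K a).
  - by exists (un K b).
  - by rewrite !zh; exact: Nlt.
  split=> //; rewrite E (th_re th lt) zh (lat_cfor (d (size (wd a)).+1)) //.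
split.
  move=> a b /= E; case: (ltngtP (size (wd a)) (size (wd b))) => [/key [_]|/key [_]|].
  - by rewrite E.
  - by rewrite E.
  - exact: (th_inj th).
split=> [a|a b] /=; first by apply: r1.
case: (ltngtP (size (wd a)) (size (wd b))) => [/key [E _]|/key [E _] //|/(th_inj th) ->].
  by rewrite sK.2 E -sK.2.
by rewrite !sK.1.
Qed.

Definition same (A : Type) ev (wd : V -> word) (f f' : A -> V) :=
  (forall s phi psi, dat ev (wd \o f) s phi psi <-> dat ev (wd \o f') s phi psi) /\
  pull K f = pull K f'.

Definition dtype (A : finType) : finType :=
  ({ffun dsym S * {ffun 'I_(wid S) -> A} * {ffun 'I_(wid S) -> A} -> bool} *
  ({ffun A -> 'I_(s_ku S)} * {ffun A * A -> 'I_(s_k S).+1}))%type.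

Definition ty (A : finType) ev (wd : V -> word) (f : A -> V) : dtype A :=
  ([ffun x : dsym S * {ffun 'I_(wid S) -> A} * {ffun 'I_(wid S) -> A} =>
     `[< dat ev (wd \o f) x.1.1 x.1.2 x.2 >]],
   ([ffun a => un K (f a)], [ffun x : A * A => re K (f x.1) (f x.2)])).

Lemma ty_same (A : finType) ev wd ev' wd' (f f' : A -> V) : ty ev wd f = ty ev' wd' f' <->
  (forall s phi psi, dat ev (wd \o f) s phi psi <-> dat ev' (wd' \o f') s phi psi) /\
  pull K f = pull K f'.
Proof.
split=> [[/ffunP e1 /ffunP e2 /ffunP e3]|[e1 e2]].
  split; last first.
    apply: str_eq => [a|a b] /=; first by have := e2 a; rewrite !ffunE.
    by have := e3 (a, b); rewrite !ffunE.
  move=> s phi psi.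
  have finE (g : 'I_(wid S) -> A) : g = [ffun i => g i] :> ('I_(wid S) -> A).
    by apply/funext => i; rewrite ffunE.
  have := e1 (s, [ffun i => phi i], [ffun i => psi i]); rewrite !ffunE /= -!finE => E.
  by split=> D; apply/asboolP; [rewrite -E|rewrite E]; apply/asboolP.
congr (_, (_, _)); apply/ffunP => x; rewrite !ffunE.
- apply/idP/idP => /asboolP D; apply/asboolP; exact/e1.
- exact: (congr1 (fun B : bstr S A => un B x) e2).
- exact: (congr1 (fun B : bstr S A => re B x.1 x.2) e2).
Qed.

(** All tuples of one type share one finite compressed diary, to which [ramsey_diaries] applies. A
    tuple is a copy of it by [comp_pemb], which [io] carries into the generic diary, where [g] makes
    the colour constant; [rho] leads back to [K]. *)
Lemma homogenize ev wd (A C : finType) (chi : (A -> V) -> C) : thin K ev wd ->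
  exists th, selfemb th /\ forall f f' : A -> V, injective f -> injective f' ->
    same ev wd f f' -> chi (th \o f) = chi (th \o f').
Proof.
move=> tK; have v0 : valid ([::] : seq event) := th_v tK 0.
have [[x0 _]|nV] := pselect (exists x : V, True); last first.
  exists id; split; first exact: selfemb_id.
  move=> f f' _ _ _; congr chi; apply/funext => a; case: nV; by exists (f a).
have [[a0 _]|nA] := pselect (exists a : A, True); last first.
  exists id; split; first exact: selfemb_id.
  move=> f f' _ _ _; congr chi; apply/funext => a; case: nA; by exists a.
have [rho [r1 r2]] := rho_exists x0 v0.
have [Ni [io dio]] := into_gen (th_w tK) (th_v tK).
pose T : finType := dtype A.
pose ty1 (f : A -> V) : T := ty ev wd f.
have tyP f f' : ty1 f = ty1 f' -> same ev wd f f' by move/ty_same.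
have ptyP f f' : same ev wd f f' -> ty1 f = ty1 f' by move=> H; apply/ty_same.
have rep0 t : exists f : A -> V, (exists2 f', injective f' & ty1 f' = t) ->
    injective f /\ ty1 f = t.
  have [[f fi ft]|no] := pselect (exists2 f', injective f' & ty1 f' = t).
    by exists f.
  by exists (fun=> x0).
have [rep repP] := choice rep0.
pose ok t := `[< exists2 f', injective f' & ty1 f' = t >].
pose evt t := if ok t then cev ev (wd \o rep t) else fun=> Noop.
pose lt t a := cw ev (wd \o rep t) (wd (rep t a)).
pose J t := (\max_(a : A) size (lt t a)).+1.
pose chit t (h : word -> word) : C := chi (rho \o h \o lt t).
have thf (f : A -> V) : injective f -> thin (pull K f) ev (wd \o f) by move=> fi; exact: thin_pull.
have ltJ t a : size (lt t a) < J t.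
  by rewrite /J ltnS; apply: (leq_bigmax_cond (F := fun a => size (lt t a))).
have [||N' [g [dg gP]]] := @ramsey_diaries S v0 T evt J C chit.
- move=> t; rewrite /evt /ok; case: asboolP => [/repP [fi _]|_] //.
  exact: wfev_cev (thf _ fi).
- move=> t h h' E; congr chi; apply/funext => a /=; by rewrite E.
have dgi := demb_comp dio dg.
exists (rho \o (g \o io) \o wd); split; first exact: theta_emb tK dgi r1 r2.
suff main f : injective f -> chi (rho \o (g \o io) \o wd \o f) = projT1 (cid (gP (ty1 f))).
  by move=> f f' fi fi' /ptyP E; rewrite !main // E.
move=> fi; case: cid => c /= cP; set t := ty1 f in cP *.
have okt : ok t by apply/asboolP; exists f.
have [ri rt] := repP t (asboolW okt).
have [sd sp] := tyP _ _ rt.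
have th1 := thf _ fi; have th2 := thf _ ri; rewrite sp in th2.
have cE : evt t = cev ev (wd \o f) by rewrite /evt okt; exact: same_cev th2 th1 sd.
have lE a : lt t a = cw ev (wd \o f) (wd (f a)) by exact: (same_cw sd a).
have [a1 a1E] : exists a1, \max_(a : A) size (lt t a) = size (lt t a1).
  by have [|a1 ->] := @eq_bigmax A (fun a => size (lt t a)); [apply/card_gt0P; exists a0|exists a1].
have [|N NP] := @rank_levels S A ev (wd \o f) (J t).
  exists (size (wd (f a1))); first exact: (rel_code ev (wd \o f) a1).
  by rewrite /J a1E lE size_cw.
have [h [p hP]] := comp_pemb th1 NP.
rewrite -cE in p; rewrite -(cP _ _ (pemb_comp p dio)) /chit; congr chi.
apply/funext => a /=; rewrite lE; congr (rho (g (io _))).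
have := hP a (size (wd (f a))) (rel_code ev (wd \o f) a); rewrite /= pre_size => -> //.
by rewrite -size_cw -lE.
Qed.

End Universal.

(** * A recurrent diary *)

(** Compactness of a product of finite sets, as the existence of a cluster point. *)
Lemma cluster (C : eqType) (x : nat -> nat -> C) : (forall n, exists L : seq C, forall i, x i n \in L) ->
  exists y : nat -> C, forall N M, exists2 i, M <= i & forall n, n < N -> x i n = y n.
Proof.
move=> fin; pose c0 := x 0 0.
pose P N (s : seq C) := size s = N /\ forall M, exists2 i, M <= i & forall n, n < N -> x i n = nth c0 s n.
pose R (N : nat) (s s' : seq C) := exists a, s' = rcons s a.
have [||f [_ fP]] := @dep_choice (seq C) P R [::].
- by split=> // M; exists M.
- move=> N s [zs often]; have [L LP] := fin N.
  have [e [ei eP]] := often_increasing often.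
  pose L' : seq {classic C} := undup (L : seq {classic C}).
  have LP' i : (x i N : {classic C}) \in L'.
    rewrite mem_undup; have := LP i; elim: (L) => // a l IH; rewrite !in_cons => /predU1P [->|/IH ->].
      by rewrite eqxx.
    by rewrite orbT.
  have [[a aL] ao] := pigeonhole_often (fun j => SeqSub (LP' (e j))).
  exists (rcons s a); split; last by exists a.
  split; first by rewrite size_rcons zs.
  move=> M; have [j le E] := ao M; exists (e j).
    apply: leq_trans le _; elim: j {E} => // j IH; exact: leq_ltn_trans IH (ei _ _ (ltnSn j)).
  move=> n; rewrite ltnS leq_eqVlt => /predU1P [->|lt].
    by rewrite nth_rcons zs ltnn eqxx; case: E.
  by rewrite nth_rcons zs lt; exact: eP.
have ext m n : m < n -> nth c0 (f n) m = nth c0 (f m.+1) m.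
  move=> /subnKC <-; elim: (n - m.+1) => [|d IH]; first by rewrite addn0.
  have [[zs _] [a E]] := fP (m.+1 + d); rewrite addnS E nth_rcons zs -IH.
  by rewrite (leq_trans (ltnSn m) (leq_addr _ _)).
exists (fun n => nth c0 (f n.+1) n) => N M; have [[_ often] _] := fP N.
by have [i le E] := often M; exists i => // n lt; rewrite E // ext.
Qed.

Section Bounded.
Variable S : setup.
Local Notation word := (word S).
Local Notation event := (event S).
Local Notation G := (@gen S).
Hypothesis flipK : involutive (@flip S).
Variables (V : Type) (K : bstr S V).
Hypothesis sK : symmetric_str K.
Hypothesis fK : forb K.
Hypothesis Kext : forall (T : finType) (B : bstr S (option T)) (f : T -> V),
  symmetric_str B -> forb B -> injective f -> hom (pull B Some) K f ->
  exists x, [/\ forall t, f t <> x, un K x = un B None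
    & forall t, re K (f t) x = re B (Some t) None].
Variable cd : V -> nat.
Hypothesis cd_inj : injective cd.

Local Notation ty := (ty K).
Local Notation dtype := (dtype S).

(** * Relevant levels seen from the nodes at a fixed level *)

Section Truncation.
Variables (ev : nat -> event) (wd : V -> word) (l : nat).

Lemma size_trunc x : size (pre (wd x) l) = minn l (size (wd x)).
Proof. by rewrite size_drop; lia. Qed.

Lemma trunc_node x y n : pre (wd x) l = pre (wd y) l -> n < l ->
  [/\ (n < size (wd x)) = (n < size (wd y)), (n == size (wd x)) = (n == size (wd y)),
    (n < size (wd x) -> pre (wd x) n = pre (wd y) n) & (n < size (wd x) -> lat (wd x) n = lat (wd y) n)].
Proof.
move=> E nl; have zE := congr1 size E; rewrite !size_trunc in zE.
have eqlt : (n < size (wd x)) = (n < size (wd y)) by lia.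
have key z k : k <= l -> k <= size (wd z) -> pre (wd z) k = pre (pre (wd z) l) k.
  move=> kl ks; have [le|lt] := leqP l (size (wd z)); first by rewrite pre_pre.
  by rewrite [pre (wd z) l]/pre (eqP (ltnW lt : (_ - l == 0))) drop0.
split=> //; first by lia.
- by move=> lt; rewrite (key x n (ltnW nl) (ltnW lt)) (key y n (ltnW nl)) ?E // ltnW // -eqlt.
- by move=> lt; rewrite /lat (key x n.+1 nl lt) (key y n.+1 nl) ?E // -eqlt.
Qed.

Lemma trunc_Lvl q (phi phi' : 'I_(wid S) -> V) n : n < l ->
  (forall i, pre (wd (phi i)) l = pre (wd (phi' i)) l) ->
  Lvl ev wd q phi n -> Lvl ev wd q phi' n.
Proof.
move=> nl E.
have fE c m : m < l -> fb ev wd c phi m <-> fb ev wd c phi' m.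
  move=> ml; have tn i := trunc_node (E i) ml.
  have pE : (forall i, m < size (wd (phi i))) -> [ffun i => pre (wd (phi i)) m] =
      [ffun i => pre (wd (phi' i)) m] :> {ffun 'I_(wid S) -> word}.
    by move=> lt; apply/ffunP => i; rewrite !ffunE; have [_ _ H _] := tn i; exact: H.
  split=> -[lt E'].
    by split=> [i|]; [have [<- _ _ _] := tn i|rewrite E' pE].
  have lt' i : m < size (wd (phi i)) by have [-> _ _ _] := tn i.
  by split=> //; rewrite E' pE.
case: q => [[c|]|] /=.
- move=> [f mi]; split; first exact/fE.
  by move=> m lt /(fE _ _ (ltn_trans lt nl)); exact: mi.
- move=> zE; have [_ + _ _] := trunc_node (E (i0 S)) nl.
  by rewrite zE eqxx => /esym/eqP.
- have [s0 _ p0 l0'] := trunc_node (E (i0 S)) nl; have [s1 _ p1 l1'] := trunc_node (E (i1 S)) nl.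
  by move=> [a b c d]; split; rewrite -?s0 -?s1 -?p0 -?p1 -?l0' -?l1'.
Qed.

(** A level named below [l] depends only on the nodes of the naming tuple at level [l], so a tuple
    of representatives names it too. *)
Lemma trunc_bound b (R : 'I_b -> V) : (forall x, exists i, pre (wd x) l = pre (wd (R i)) l) ->
  rk ev wd l <= #|{: kind S * {ffun 'I_(wid S) -> 'I_b}}|.
Proof.
move=> cov; have [r rP] := choice cov.
pose L := [seq n <- iota 0 l | Rel ev wd n].
have ex n : exists t : option (kind S * {ffun 'I_(wid S) -> 'I_b}), n \in L ->
    exists2 t', t = Some t' & Lvl ev wd t'.1 (R \o t'.2) n.
  have [|] := boolP (n \in L); last by exists None.
  rewrite mem_filter mem_iota /= add0n => /andP [/asboolP [q [phi M]] lt].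
  exists (Some (q, [ffun i => r (phi i)])) => _; eexists; first by [].
  apply: (trunc_Lvl lt _ M) => i /=; rewrite ffunE; exact: rP.
have [t tP] := choice ex.
have uL : uniq L by rewrite filter_uniq // iota_uniq.
rewrite /rk -size_filter -/L cardE -(size_map t L) -(size_map Some (enum _)); apply: uniq_leq_size.
  rewrite map_inj_in_uniq // => n m nL mL E.
  have [t1 E1 M1] := tP n nL; have [t2 E2 M2] := tP m mL.
  have t12 : t2 = t1 by move: E; rewrite E1 E2 => -[].
  by rewrite t12 in M2; exact: (Lvl_uniq M1 M2).
move=> _ /mapP [n nL ->]; have [t1 -> _] := tP n nL.
by apply/mapP; exists t1; rewrite ?mem_enum.
Qed.

End Truncation.

Definition v3 (x y v : V) (i : 'I_3) : V := if val i == 0 then x else if val i == 1 then y else v.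

Lemma v3_inj x y v : x <> y -> x <> v -> y <> v -> injective (v3 x y v).
Proof.
by move=> a b c [[|[|[|i]]] ip] [[|[|[|j]]] jp] //= => E; apply: val_inj => //=;
  try (by case: a); try (by case: b); try (by case: c).
Qed.

(* The number of nodes of the copy at the level coding [v] only depends on the
   colours of the types of triples of a fixed diary, hence is bounded. *)
Lemma bounded_copies : exists H : V -> nat, forall ev wd eta, thin K ev wd -> selfemb K eta ->
  exists th, selfemb K th /\ forall v,
    size (cw ev (wd \o (eta \o th)) (wd (eta (th v)))) <= H v.
Proof.
have [ev0 [wd0 t0]] := thin_exists sK fK cd_inj.
pose Q (c : {ffun dtype 'I_3 -> bool}) v b := exists R : 'I_b -> V, forall x, x <> v ->
  exists i, R i <> v /\ (x = R i \/ c (ty ev0 wd0 (v3 x (R i) v))).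
(* Any number of representatives that suffices will do, but it is chosen from [c] and [v] alone,
   before the diary and the copy are given; hence the bound is uniform. *)
have exb (cv : {ffun dtype 'I_3 -> bool} * V) : exists b, (exists b', Q cv.1 cv.2 b') -> Q cv.1 cv.2 b.
  have [[b Qb]|ne] := pselect (exists b', Q cv.1 cv.2 b'); first by exists b.
  by exists 0.
have [b bP] := choice exb.
pose hb n := #|{: kind S * {ffun 'I_(wid S) -> 'I_n}}|.
exists (fun v => \max_(c : {ffun dtype 'I_3 -> bool}) hb (b (c, v)).+1) => ev wd eta tK eE.
pose tr v x := pre (wd (eta x)) (size (wd (eta v))).
pose chi (f : 'I_3 -> V) : bool := `[< tr (f ord_max) (f ord0) = tr (f ord_max) (f (inord 1)) >].
have [th [thE chiE]] := homogenize flipK sK Kext chi t0.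
have [ti th_] := thE.
pose c : {ffun dtype 'I_3 -> bool} := [ffun t =>
  `[< exists f, [/\ injective f, ty ev0 wd0 f = t & chi (th \o f)] >]].
have cE f : injective f -> c (ty ev0 wd0 f) = chi (th \o f).
  move=> fi; rewrite ffunE; apply/asboolP/idP => [[f' [fi' tE cf]]|cf]; last by exists f.
  by rewrite (chiE f f') //; apply/ty_same.
have c3 x y v : x <> y -> x <> v -> y <> v ->
    c (ty ev0 wd0 (v3 x y v)) <-> tr (th v) (th x) = tr (th v) (th y).
  move=> a1 a2 a3; rewrite cE; last exact: v3_inj.
  rewrite /chi /= /v3 /= inordK //=; by split=> /asboolP.
exists th; split=> // v; set l := size (wd (eta (th v))).
have [R RP] : Q c v (b (c, v)).
  apply: (bP (c, v)) => /=.
  pose ws := flatten [seq words S i | i <- iota 0 l.+1].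
  have trw x : tr (th v) (th x) \in ws.
    apply/flatten_mapP; exists (size (tr (th v) (th x))); last by rewrite mem_words.
    by rewrite mem_iota /= add0n ltnS /tr -/l size_trunc geq_minl.
  have exR (i : 'I_(size ws)) : exists r, (exists2 x, x <> v & tr (th v) (th x) = nth [::] ws i) ->
      r <> v /\ tr (th v) (th r) = nth [::] ws i.
    have [[x xv xE]|ne] := pselect (exists2 x, x <> v & tr (th v) (th x) = nth [::] ws i).
      by exists x.
    by exists v.
  have [R RP] := choice exR; exists (size ws), R => x xv.
  have lt : index (tr (th v) (th x)) ws < size ws by rewrite index_mem.
  have [|Rv RE] := RP (Ordinal lt); first by exists x => //; rewrite /= nth_index.
  exists (Ordinal lt); split=> //; have [xR|xR] := pselect (x = R (Ordinal lt)); [by left|right].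
  by apply/c3 => //; rewrite RE /= nth_index.
apply: leq_trans (leq_bigmax c); rewrite size_cw.
pose R' (i : 'I_(b (c, v)).+1) : V := if unlift ord_max i is Some j then R j else v.
apply: (@trunc_bound ev (wd \o (eta \o th)) l _ R') => x.
have [->|xv] := pselect (x = v); first by exists ord_max; rewrite /R' unlift_none.
have [i [Rv xR]] := RP x xv; exists (lift ord_max i); rewrite /R' liftK.
case: xR => [->//|]; have [->//|ne] := pselect (x = R i).
by move/(c3 _ _ _ ne xv Rv).
Qed.

Lemma pull_selfemb th : selfemb K th -> pull K th = K.
Proof. by move=> [_ [h1 h2]]; apply: str_eq. Qed.

(** Using the domains ['I_m] makes the set of types countable, so that all types can be treated one
    after another. *)
Definition age (x : (nat -> event) * (V -> word)) (t : {m : nat & dtype 'I_m}) : Prop :=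
  exists f : 'I_(tag t) -> V, injective f /\ ty x.1 x.2 f = tagged t.

Lemma finitely_many_events n : exists L : seq event, forall e, wfe n e -> e \in L.
Proof.
pose mkf (p : constr S * {ffun 'I_(wid S) -> n.-tuple (letter S)}) : event :=
  Forbid p.1 [ffun i => tval (p.2 i)].
pose mkc (p : 'I_(s_ku S) * n.-tuple (letter S)) : event := Code p.1 (tval p.2).
exists (Noop :: map mkf (enum {: constr S * {ffun 'I_(wid S) -> n.-tuple (letter S)}}) ++
  map mkc (enum {: 'I_(s_ku S) * n.-tuple (letter S)})).
case=> [|c ka|u y] /= w; rewrite in_cons ?eqxx //= mem_cat; apply/orP.
  left; pose ka' : {ffun 'I_(wid S) -> n.-tuple (letter S)} := [ffun i => insubd [tuple of nseq n l0] (ka i)].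
  apply/mapP; exists (c, ka'); rewrite ?mem_enum // /mkf /=; congr Forbid.
  by apply/ffunP => i; rewrite !ffunE val_insubd w eqxx.
right; apply/mapP; exists (u, tcast w (in_tuple y)); rewrite ?mem_enum // /mkc /=.
by rewrite val_tcast.
Qed.

(** Step [i] discards the [i]-th type if some diary bounded by [H] with no other types than the
    current one lacks it. The limit realizes only types of every stage, so its own types could never
    be discarded; in particular the compressed diary [z] of a copy realizes them all. *)
Lemma minimal_diary : exists ev wd, thin K ev wd /\ forall eta, selfemb K eta ->
  forall m (f : 'I_m -> V), injective f -> exists g : 'I_m -> V, injective g /\
    ty ev wd (eta \o g) = ty ev wd f.
Proof.
have [H HP] := bounded_copies.
pose X := ((nat -> event) * (V -> word))%type.
pose P0 (x : X) := thin K x.1 x.2 /\ forall v, size (x.2 v) <= H v.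
(* Compressing a suitable subcopy turns it into a diary of [K] bounded by [H], with the types of
   that subcopy. *)
have refine (x : X) eta : thin K x.1 x.2 -> selfemb K eta -> exists z th, [/\ P0 z, selfemb K th &
    forall t, age z t <-> age (x.1, x.2 \o (eta \o th)) t].
  move=> tx eE; have [th [thE bd]] := HP x.1 x.2 eta tx eE.
  have tE := selfemb_comp eE thE.
  have tp : thin K x.1 (x.2 \o (eta \o th)).
    by have := thin_pull tE.1 tx; rewrite pull_selfemb.
  exists (cev x.1 (x.2 \o (eta \o th)), cw x.1 (x.2 \o (eta \o th)) \o (x.2 \o (eta \o th))), th.
  split=> //; first by split; [exact: thin_comp|].
  have tyE m (f : 'I_m -> V) : ty (cev x.1 (x.2 \o (eta \o th)))
      (cw x.1 (x.2 \o (eta \o th)) \o (x.2 \o (eta \o th))) f = ty x.1 (x.2 \o (eta \o th)) f.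
    apply/ty_same; split=> // s phi psi.
    exact: (dat_comp s (f \o phi) (f \o psi) tp).
  by move=> [m t]; split=> -[f [fi /= fE]]; exists f; split=> //=; rewrite -fE tyE.
pose R (i : nat) (x y : X) := (forall t, age y t -> age x t) /\
  forall t, unpickle i = Some t -> age y t -> forall z, P0 z -> (forall t', age z t' -> age y t') -> age z t.
have [ev0 [wd0 t0]] := thin_exists sK fK cd_inj.
have [x0 [_ [P0x _ _]]] := refine (ev0, wd0) id t0 (selfemb_id K).
have [||x [_ xP]] := @dep_choice X (fun _ => P0) R x0 => //.
  move=> i y Py; case E : (unpickle i : option {m : nat & dtype 'I_m}) => [t|]; last first.
    by exists y; split=> //; split=> // t; rewrite E.
  have [[z [Pz zs nz]]|no] := pselect (exists z, [/\ P0 z, forall t', age z t' -> age y t' & ~ age z t]).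
    by exists z; split=> //; split=> // t'; rewrite E => -[<-].
  exists y; split=> //; split=> // t'; rewrite E => -[<-] _ z Pz zs.
  by apply: contrapT => nz; apply: no; exists z.
have age_le i j t : i <= j -> age (x j) t -> age (x i) t.
  move=> /subnKC <-; elim: (j - i) => [|d IH]; first by rewrite addn0.
  by have [_ [sub _]] := xP (i + d); rewrite addnS => /sub.
have sel0 n : exists o : option V, forall v, cd v = n <-> o = Some v.
  have [[v vn]|nv] := pselect (exists v, cd v = n).
    by exists (Some v) => v'; split=> [e|[<-]] //; congr Some; apply: cd_inj; rewrite vn.
  by exists None => v; split=> // e; case: nv; exists v.
have [sel selP] := choice sel0.
pose co (y : X) n : event * word := (y.1 n, if sel n is Some v then y.2 v else [::]).
have [|y yP] := @cluster (event * word)%type (fun i => co (x i)).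
  move=> n; have [L LP] := finitely_many_events n.
  pose b := if sel n is Some v then H v else 0.
  pose ws := flatten [seq words S i | i <- iota 0 b.+1].
  exists [seq (e, s) | e <- L, s <- ws] => i; have [[ti bi] _] := xP i.
  apply/allpairsP; exists (co (x i) n); split=> //=; first exact: LP (th_w ti n).
  apply/flatten_mapP; exists (size (co (x i) n).2); last by rewrite mem_words.
  rewrite mem_iota /= add0n ltnS /b; case: (sel n) => // v; exact: bi.
pose ev n := (y n).1; pose wd v := (y (cd v)).2.
have near N M : exists i, [/\ M <= i, forall n, n < N -> (x i).1 n = ev n
    & forall v, cd v < N -> (x i).2 v = wd v].
  have [i le E] := yP N M; exists i; split=> // [n lt|v lt].
    by rewrite /ev -E.
  by rewrite /wd -E //= (selP (cd v) v).1.
have hE N i n : (forall n, n < N -> (x i).1 n = ev n) -> n <= N -> hist (x i).1 n = hist ev n.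
  by move=> E le; apply: eq_hist => j lt; apply: E; exact: leq_trans le.
have tK : thin K ev wd.
  split.
  - move=> n; have [i [_ e _]] := near n.+1 0; have [[ti _] _] := xP i.
    by rewrite -e //; exact: (th_w ti).
  - move=> n; have [i [_ e _]] := near n 0; have [[ti _] _] := xP i.
    by rewrite -(hE n i) //; exact: (th_v ti).
  - move=> a; have [i [_ e v]] := near (maxn (cd a) (size (wd a))).+1 0; have [[ti _] _] := xP i.
    by rewrite -e ?ltnS ?leq_maxr // -v ?ltnS ?leq_maxl // (th_code ti).
  - move=> a b; have [i [_ e v]] := near (maxn (cd a) (cd b)).+1 0; have [[ti _] _] := xP i.
    by rewrite -!v ?ltnS ?leq_maxl ?leq_maxr //; exact: (th_inj ti).
  - move=> a b; have [i [_ e v]] := near (maxn (cd a) (cd b)).+1 0; have [[ti _] _] := xP i.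
    by rewrite -!v ?ltnS ?leq_maxl ?leq_maxr //; exact: (th_re ti).
  - move=> n a b; have [i [_ e v]] := near (maxn n (maxn (cd a) (cd b))).+1 0; have [[ti _] _] := xP i.
    rewrite -e ?ltnS ?leq_maxl // -!v ?ltnS; first exact: (th_split ti).
      by lia.
    by lia.
  - move=> n c ka j a; have [i [_ e v]] := near (maxn n (cd a)).+1 0; have [[ti _] _] := xP i.
    rewrite -e ?ltnS ?leq_maxl // -!v ?ltnS ?leq_maxr //; exact: (th_bit ti).
  (* This clause concerns arbitrary [T], while a stage agrees with the limit only on finitely many
     vertices; [not_allowed_local] reduces it to a finite structure. *)
  - move=> n u s E T B' xx lt al; apply: contrapT => /not_allowed_local [Y [f [_ _]]]; apply.
    pose N := (maxn n (\max_(a : Y) cd (xx (f a)))).+1.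
    have [i [_ e v]] := near N 0; have [[ti _] _] := xP i.
    have nN : n < N by rewrite ltnS leq_maxl.
    have vN a : (x i).2 (xx (f a)) = wd (xx (f a)).
      apply: v; rewrite ltnS leq_max; apply/orP; right.
      exact: (leq_bigmax_cond (F := fun a => cd (xx (f a)))).
    have E' : (x i).1 n = Code u s by rewrite e.
    have := th_na ti E' (T := Y) (B' := pull B' f) (x := xx \o f).
    rewrite (hE N i n e (ltnW nN)) (hE N i n.+1 e nN).
    have -> : (fun t => pre ((x i).2 ((xx \o f) t)) n) = (fun t => pre (wd (xx t)) n) \o f.
      by apply/funext => a /=; rewrite vN.
    have -> : (fun t => pre ((x i).2 ((xx \o f) t)) n.+1) = (fun t => pre (wd (xx t)) n.+1) \o f.
      by apply/funext => a /=; rewrite vN.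
    by apply; [move=> a; rewrite /= vN|exact: allowed_pull].
have age_lim j t : age (ev, wd) t -> age (x j) t.
  case: t => m t [f [fi fE]] /=.
  pose N := (maxn (\max_(a : 'I_m) cd (f a)) (\max_(a : 'I_m) size (wd (f a)))).+1.
  have [i [le e v]] := near N j; apply: age_le le _; exists f; split=> //.
  rewrite -fE /=; apply/ty_same; split=> // s phi psi.
  have -> : (x i).2 \o f = wd \o f.
    apply/funext => a /=; apply: v; rewrite ltnS leq_max; apply/orP; left.
    exact: (leq_bigmax_cond (F := fun a => cd (f a))).
  apply: dat_eq => n a /= lt; apply: e; apply: (ltn_trans lt); rewrite ltnS leq_max; apply/orP; right.
  exact: (leq_bigmax_cond (F := fun a => size (wd (f a)))).
exists ev, wd; split=> // eta eE m f fi.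
pose t : {m : nat & dtype 'I_m} := Tagged (fun m => dtype 'I_m) (ty ev wd f).
have at_ : age (ev, wd) t by exists f.
have [z [th [Pz [ti thE] zE]]] := refine (ev, wd) eta tK eE.
have zsub t' : age z t' -> age (ev, wd) t'.
  move=> /zE [g [gi gE]]; exists (eta \o th \o g); split.
    by apply: inj_comp gi; apply: inj_comp ti; exact: eE.1.
  rewrite -gE; apply/ty_same; split=> //.
  by rewrite -(pull_pull K) pull_selfemb //; apply: selfemb_comp => //; split.
have [_ [_ xR]] := xP (pickle t).
have az : age z t.
  by apply: (xR t (pickleK t) (age_lim _ _ at_) z Pz) => t' /zsub; exact: age_lim.
have [g [gi gE]] := (zE t).1 az; exists (th \o g); split; first exact: inj_comp.
rewrite -[RHS]gE; apply/ty_same; split=> //.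
by rewrite -[in RHS](pull_selfemb (selfemb_comp eE (conj ti thE))).
Qed.

(* Every type of finite tuple reappears in each copy of [K]. *)
Theorem recurrent_diary : exists ev wd, thin K ev wd /\ forall eta, selfemb K eta ->
  forall (A : finType) (f : A -> V), injective f -> exists g : A -> V, injective g /\
    same K ev wd (eta \o g) f.
Proof.
have [ev [wd [tK mi]]] := minimal_diary; exists ev, wd; split=> // eta eE A f fi.
have [|g [gi /ty_same [d p]]] := mi eta eE #|A| (f \o enum_val).
  exact: inj_comp fi enum_val_inj.
exists (g \o enum_rank); split; first exact: inj_comp gi enum_rank_inj.
have fE : f = (f \o enum_val) \o enum_rank by apply/funext => a /=; rewrite enum_rankK.
split; last by rewrite [in RHS]fE -(pull_pull K (eta \o g)) p.
by move=> s phi psi; rewrite [in X in _ <-> X]fE; exact: (d s (enum_rank \o phi) (enum_rank \o psi)).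
Qed.

End Bounded.

(** * The big Ramsey structure *)

Section Translation.
Variables (ku k : nat) (Flip : 'I_k.+1 -> 'I_k.+1).
Hypothesis hFlip : involutive Flip.
Hypothesis hFlip0 : Flip ord0 = ord0.
Local Notation L := (binlang ku k).

(** The functional presentation takes the value [0] on the diagonal, where the relational one has no
    relation at all. *)
Definition matches (T : Type) (A : structure L T) (B : str ku k T) :=
  [/\ forall i a, Urel A i a <-> un B a = i,
      forall i a b, Rrel A i a b <-> a <> b /\ re B a b = i
    & (forall a, re B a a = ord0) /\ forall a b, re B b a = Flip (re B a b)].

Lemma conventions_matches (T : Type) (A : structure L T) :
  conventions Flip A -> exists B, matches A B.
Proof.
move=> [c1 c2 c3 c4].
have [u uP] := choice c1.
have ex (ab : T * T) : exists i, (ab.1 = ab.2 -> i = ord0) /\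
    (ab.1 <> ab.2 -> unique (fun i => Rrel A i ab.1 ab.2) i).
  have [e|ne] := pselect (ab.1 = ab.2); first by exists ord0.
  by have [i iP] := c3 _ _ ne; exists i.
have [r rP] := choice ex.
have rE i a b : a <> b -> Rrel A i a b <-> r (a, b) = i.
  by move=> ne; have [_ /(_ ne) [r1 r2]] := rP (a, b); split=> [/r2|<-].
exists (Str u (fun a b => r (a, b))); split=> /=.
- by move=> i a; have [u1 u2] := uP a; split=> [/u2|<-].
- move=> i a b; split=> [R|[ne]]; last by move/(rE _ _ _ ne).
  have ne : a <> b by move=> ab; apply: (c2 i a); rewrite {2}ab.
  by split=> //; apply/(rE _ _ _ ne).
- have r0 a : r (a, a) = ord0 by have [-> ] := rP (a, a).
  split=> [//|a b].
  have [e|ne] := pselect (a = b).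
    by subst b; rewrite r0 hFlip0.
  have ne' : b <> a by move=> e; apply: ne.
  by apply/(rE _ _ _ ne'); rewrite -c4; apply/(rE _ _ _ ne).
Qed.

Definition of_str (T : Type) (B : str ku k T) : structure L T :=
  fun s => match s as s0 return set ((@arity L s0).-tuple T) with
  | inl i => fun t => un B (tnth t ord0) = i
  | inr i => fun t => tnth t ord0 <> tnth t ord_max /\ re B (tnth t ord0) (tnth t ord_max) = i
  end.

Lemma of_str_matches (T : Type) (B : str ku k T) : (forall a, re B a a = ord0) ->
  (forall a b, re B b a = Flip (re B a b)) -> matches (of_str B) B.
Proof. by move=> r0 rf; split=> // i a b; rewrite /Rrel /= !(tnth_nth a). Qed.

Lemma matches_conventions (T : Type) (A : structure L T) B : matches A B -> conventions Flip A.
Proof.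
move=> [m1 m2 [m3 m4]]; split.
- by move=> a; exists (un B a); split=> [|i]; rewrite m1.
- by move=> i a; rewrite m2 => -[].
- by move=> a b ne; exists (re B a b); split=> [|i]; rewrite m2 // => -[].
- move=> i a b; rewrite !m2 m4; split=> -[ne E]; split=> //; try by move=> e; apply: ne.
    by rewrite -E hFlip.
  by rewrite E hFlip.
Qed.

Lemma emb_hom (T T' : Type) (A : structure L T) (A' : structure L T') B B' (e : emb A A') :
  matches A B -> matches A' B' -> injective e /\
  (forall a, un B' (e a) = un B a) /\ (forall a b, re B' (e a) (e b) = re B a b).
Proof.
move=> [m1 m2 [m3 m4]] [n1 n2 [n3 n4]]; split; first exact: emb_inj; split.
  move=> a; apply/n1; have := emb_rel e (inl (un B a)) [tuple a].
  have -> : map_tuple e [tuple a] = [tuple e a] by exact: val_inj.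
  by move=> H; apply/H/m1.
move=> a b; have [<-|ne] := pselect (a = b); first by rewrite m3 n3.
have := emb_rel e (inr (re B a b)) [tuple a; b].
have -> : map_tuple e [tuple a; b] = [tuple e a; e b] by exact: val_inj.
by move=> H; have /H/n2 [] : Rrel A (re B a b) a b by apply/m2.
Qed.

Lemma hom_emb (T T' : Type) (A : structure L T) (A' : structure L T') B B' (f : T -> T') :
  matches A B -> matches A' B' -> injective f ->
  (forall a, un B' (f a) = un B a) -> (forall a b, re B' (f a) (f b) = re B a b) ->
  exists e : emb A A', emb_fun e = f.
Proof.
move=> [m1 m2 _] [n1 n2 _] fi fu fr.
have rel (s : symb L) (t : (arity s).-tuple T) : A s t <-> A' s (map_tuple f t).
  case: s t => i t.
    have -> : t = [tuple tnth t ord0].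
      by apply: eq_from_tnth => j; rewrite (ord1 j).
    have -> : map_tuple f [tuple tnth t ord0] = [tuple f (tnth t ord0)] by exact: val_inj.
    by rewrite [A _ _]m1 [A' _ _]n1 fu.
  have -> : t = [tuple tnth t ord0; tnth t ord_max].
    apply: eq_from_tnth => -[[|[|j]] jp] //.
      by rewrite [RHS](tnth_nth (tnth t ord0)) /=; congr tnth; exact: val_inj.
    by rewrite [RHS](tnth_nth (tnth t ord0)) /=; congr tnth; exact: val_inj.
  set a := tnth t ord0; set b := tnth t ord_max.
  have -> : map_tuple f [tuple a; b] = [tuple f a; f b] by exact: val_inj.
  rewrite [A _ _]m2 [A' _ _]n2 fr; split=> -[ne E]; split=> //; first by move=> /fi.
  by move=> ab; apply: ne; rewrite ab.
by exists (Emb fi rel).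
Qed.

Lemma emb_eq (T T' : Type) (L0 : language) (A : structure L0 T) (A' : structure L0 T') (e e' : emb A A') :
  emb_fun e = emb_fun e' -> e = e'.
Proof.
case: e e' => [f fi fr] [f' fi' fr'] /= E; subst f'.
by congr Emb; exact: Prop_irrelevance.
Qed.

Lemma pullback_emb (L0 : language) (T T' : Type) (A : structure L0 T) (M : structure L0 T')
  (e : emb A M) : pullback M e = A.
Proof. by apply: functional_extensionality_dep => s; apply/funext => t; apply/propext; rewrite (emb_rel e). Qed.

Lemma pullback_id_emb (L0 : language) (T T' : Type) (M : structure L0 T') (f : T -> T') :
  injective f -> exists e : emb (pullback M f) M, emb_fun e = f.
Proof.
move=> fi; have rel s (t : (arity s).-tuple T) : pullback M f t <-> M s (map_tuple f t) by [].
by exists (Emb fi rel).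
Qed.

(** Each convention speaks of at most two vertices, and the substructures of [K] on one or two
    points are in the class. *)
Lemma fraisse_conventions (C : fin_class L) (V : Type) (K : structure L V) :
  fraisse_limit C K -> (forall (T : finType) (A : structure L T), C T A -> conventions Flip A) ->
  conventions Flip K.
Proof.
move=> [_ age _] CC.
have sub (T : finType) (f : T -> V) : injective f -> conventions Flip (pullback K f).
  by move=> fi; apply: CC; apply/age; have [e _] := pullback_id_emb K fi; exists.
have one a : conventions Flip (pullback K (fun _ : unit => a)) by apply: sub => -[] [].
have t1 a : map_tuple (fun _ : unit => a) [tuple tt] = [tuple a] by exact: val_inj.
have t2 a : map_tuple (fun _ : unit => a) [tuple tt; tt] = [tuple a; a] by exact: val_inj.
have irr i a : ~ Rrel K i a a.
  have [_ /(_ i tt) + _ _] := one a.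
  by rewrite /Rrel /pullback t2.
have two a b : a <> b -> (exists! i, Rrel K i a b) /\ forall i, Rrel K i a b <-> Rrel K (Flip i) b a.
  move=> ne; pose f (x : bool) := if x then a else b.
  have [|_ _ c3 c4] := sub bool f.
    by case=> [] [] //= e; case: ne.
  have tab (x y : bool) : map_tuple f [tuple x; y] = [tuple f x; f y] by exact: val_inj.
  have RE i x y : Rrel (pullback K f) i x y = Rrel K i (f x) (f y).
    by rewrite /Rrel /pullback tab.
  split; last by move=> i; have := c4 i true false; rewrite !RE.
  have [//|i [i1 i2]] := c3 true false; exists i; split; first by move: i1; rewrite RE.
  by move=> j Rj; apply: i2; rewrite RE.
split=> //.
- move=> a; have [/(_ tt) [i [i1 i2]] _ _ _] := one a.
  have UE j : Urel (pullback K (fun _ : unit => a)) j tt = Urel K j a.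
    by rewrite /Urel /pullback t1.
  exists i; split; first by rewrite -UE.
  by move=> j; rewrite -UE; exact: i2.
- by move=> a b /two [].
- move=> i a b; have [<-|/two [_]] := pselect (a = b); last exact.
  by split=> /irr.
Qed.

End Translation.

Theorem theorem8p4 (ku k : nat) (Flip : 'I_k.+1 -> 'I_k.+1)
    (hFlip : involutive Flip) (hFlip0 : Flip ord0 = ord0)
    (J : finType) (F : J -> finstr (binlang ku k))
    (hF : forall j : J,
       conventions Flip (interp (F j)) /\ irreducible (interp (F j)))
    (V : Type) (K : structure (binlang ku k) V)
    (hK : fraisse_limit (Forb Flip F) K)
    (D : nat) (hD : D = \max_(j : J) #|F j|) :
  exists E : language,
    (forall s : symb (lang_ext (binlang ku k) E),
       arity s <= maxn (2 * (D - 1)) 4) /\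
    exists K' : structure (lang_ext (binlang ku k) E) V,
      big_ramsey_structure (Forb Flip F) K K'.
Proof.
pose FB j := projT1 (cid (conventions_matches hFlip0 (hF j).1)).
have FBm j : matches Flip (interp (F j)) (FB j) := projT2 (cid (conventions_matches hFlip0 (hF j).1)).
have Firr j a b : re (FB j) a b = ord0 -> a = b.
  move=> r0; apply: contrapT => ne; apply: ((hF j).2 a b ne).
  by have [_ m2 _] := FBm j; apply/m2.
have Fcard j : #|F j| <= (maxn (D - 1) 2).+1.
  have : #|F j| <= D by rewrite hD; apply: leq_bigmax_cond.
  by lia.
have w1 : 1 < maxn (D - 1) 2 by lia.
pose S := @Setup ku k Flip hFlip0 J (fun j => carrier (F j)) FB Firr (maxn (D - 1) 2) w1 Fcard.
have cK : conventions Flip K by apply: (fraisse_conventions hK) => T A [].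
have [KB Km] := conventions_matches hFlip0 cK.
have [Kcount Kage Khom] := hK.
pose KS : bstr S V := KB.
have sK : @symmetric_str S V KS by case: Km => _ _ [].
have forbE (T : Type) (A : structure (binlang ku k) T) (B : bstr S T) : matches Flip A B ->
    (forb B <-> forall j, ~ inhabited (emb (interp (F j)) A)).
  move=> m; split=> H j.
    move=> [e]; have [_ eh] := emb_hom e (FBm j) m.
    by apply: (H j); exists e.
  move=> [f [f1 f2]]; apply: (H j).
  have [|e _] := hom_emb (FBm j) m (f := f) _ f1 f2; last by exists.
  move=> a b ab; apply: (Firr j); rewrite -f2 ab; case: m => _ _ [+ _]; exact.
have fK : @forb S V KS.
  apply/(forbE _ _ _ Km) => j ie; have [_ /(_ j)] := (Kage _ (interp (F j))).2 ie.
  apply; have [|e _] := hom_emb (FBm j) (FBm j) (f := id) _ (fun _ => erefl) (fun _ _ => erefl) => //.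
(* The extension property: [B] embeds into [K] somewhere, and homogeneity moves its part over [T] to
   [f]. *)
have Kext (T : finType) (B : bstr S (option T)) (f : T -> V) :
    symmetric_str B -> forb B -> injective f -> hom (pull B Some) KS f ->
    exists x, [/\ forall t, f t <> x, un KS x = un B None
      & forall t, re KS (f t) x = re B (Some t) None].
  move=> [b1 b2] fB fi [f1 f2].
  have mB : matches Flip (of_str B) B by exact: of_str_matches.
  have mB' : matches Flip (of_str (pull B Some)) (pull B Some).
    by apply: of_str_matches => [a|a b] /=; [exact: b1|exact: b2].
  have [e] : inhabited (emb (of_str B) K).
    by apply/Kage; split; [exact: matches_conventions mB|apply/(forbE _ _ _ mB)].
  have [ei [e1 e2]] := emb_hom e mB Km.
  have [g gE] := hom_emb mB' Km fi f1 f2.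
  have [|g' g'E] := hom_emb mB' Km (f := e \o Some) _ (fun a => e1 (Some a)) (fun a b => e2 (Some a) (Some b)).
    by apply: inj_comp; [exact: ei|move=> ? ? []].
  have [h [_ hE]] := Khom _ _ g' g.
  have [hi [h1 h2]] := emb_hom h Km Km.
  have hf t : h (e (Some t)) = f t by have := hE t; rewrite g'E gE.
  exists (h (e None)); split.
  - by move=> t; rewrite -hf => /hi /ei.
  - by rewrite h1 e1.
  - by move=> t; rewrite -hf h2 e2.
have [cd cdi] : exists cd : V -> nat, injective cd.
  by have /countable_injP [cd cdi] := Kcount; exists cd; exact: in2TT.
have [ev [wd [tK rec]]] := @recurrent_diary S hFlip V KS sK fK Kext cd cdi.
pose w := wid S.
have w_gt0 : 0 < w + w by rewrite /w /=; lia.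
pose E := @Language (dsym S) (fun=> w + w) (fun=> w_gt0).
exists E; split.
  by case=> [[i|i]|s] /=; rewrite /w /=; lia.
pose fst_ T (t : (w + w).-tuple T) (i : 'I_w) := tnth t (lshift w i).
pose snd_ T (t : (w + w).-tuple T) (i : 'I_w) := tnth t (rshift w i).
pose K' : structure (lang_ext (binlang ku k) E) V := fun s =>
  match s as s0 return set ((@arity (lang_ext (binlang ku k) E) s0).-tuple V) with
  | inl s => K s
  | inr s => fun t => dat ev wd s (fst_ V t) (snd_ V t)
  end.
exists K'.
have K'r (T : Type) (f : T -> V) s t : pullback K' f (s := inr s) t <->
    dat ev (wd \o f) s (fst_ T t) (snd_ T t).
  rewrite /pullback /=.
  have -> : fst_ V (map_tuple f t) = f \o fst_ T t by apply/funext => i; exact: tnth_map.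
  by have -> : snd_ V (map_tuple f t) = f \o snd_ T t by apply/funext => i; exact: tnth_map.
have sameE (T : Type) (f f' : T -> V) : pullback K f = pullback K f' ->
    ((forall s phi psi, dat ev (wd \o f) s phi psi <-> dat ev (wd \o f') s phi psi) <->
     pullback K' f = pullback K' f').
  move=> KE; split=> [H|H s phi psi].
    apply: functional_extensionality_dep => -[s|s]; first exact: (congr1 (fun A : structure (binlang ku k) T => A s) KE).
    by apply/funext => t; apply/propext; rewrite !K'r.
  pose t : (w + w).-tuple T := mktuple (fun j => match fintype.split j with inl i => phi i | inr i => psi i end).
  have tf : fst_ T t = phi.
    by apply/funext => i; rewrite /fst_ tnth_mktuple -[lshift w i]/(unsplit (inl i)) unsplitK.
  have ts : snd_ T t = psi.
    by apply/funext => i; rewrite /snd_ tnth_mktuple -[rshift w i]/(unsplit (inr i)) unsplitK.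
  have := congr1 (fun A : structure (lang_ext (binlang ku k) E) T => A (inr s) t) H => /= Ht.
  by have := K'r T f s t; rewrite Ht K'r tf ts => H'; split=> /H'.
have expE (T : Type) (A : structure (binlang ku k) T) :
    expansions K' A = [set pullback K' (f : T -> V) | f in [set: emb A K]]%classic.
  apply/seteqP; split=> A'.
    move=> [rA [e]].
    have KA : pullback K e = A.
      by rewrite -rA; exact: (congr1 (@reduct (binlang ku k) E T) (pullback_emb e)).
    have [e' e'E] := pullback_id_emb K (emb_inj e); rewrite KA in e' e'E.
    by exists e' => //; rewrite e'E pullback_emb.
  move=> [f _ <-]; split; first exact: (pullback_emb f).
  by have [e _] := pullback_id_emb K' (emb_inj f); exists.
have embs (h : emb K K) : @selfemb S V KS h.
  by have [a b] := emb_hom h Km Km.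
(* [rec] gives [g] such that [eta \o g] has the type of [f]. As [eta] preserves the structure, [g]
   is itself an embedding of [A]. *)
have attain (T : finType) (A : structure (binlang ku k) T) (eta : emb K K) : 
    [set pullback K' (emb_comp eta f) | f in [set: emb A K]]%classic = expansions K' A.
  rewrite expE; apply/seteqP; split=> A' [f _ <-]; first by exists (emb_comp eta f).
  have [g [gi [gd gp]]] := rec eta (embs eta) T f (emb_inj f).
  have gK : pull KS g = pull KS f.
    by rewrite -gp -[in LHS](pull_selfemb (embs eta)).
  have ge : exists e : emb A K, emb_fun e = g.
    have [e1 e1E] := pullback_id_emb K (emb_inj f).
    have mA : exists BA, matches Flip A BA.
      apply: (conventions_matches hFlip0); have : Forb Flip F A by apply/Kage; exists.
      by case.
    have [BA mA'] := mA; have [_ [f1 f2]] := emb_hom f mA' Km.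
    apply: (hom_emb mA' Km gi) => [a|a b].
      by rewrite -f1; exact: (congr1 (fun B : bstr S T => un B a) gK).
    by rewrite -f2; exact: (congr1 (fun B : bstr S T => re B a b) gK).
  have [e eE] := ge; exists e => //.
  have -> : pullback K' (emb_comp eta e) = pullback K' (eta \o g) by rewrite /= eE.
  apply/sameE => //.
  by rewrite (pullback_emb f) -eE; exact: (pullback_emb (emb_comp eta e)).
have ty_pull (T : finType) (A : structure (binlang ku k) T) (f f' : emb A K) :
    @ty S V KS T ev wd f = @ty S V KS T ev wd f' -> pullback K' f = pullback K' f'.
  by move=> /ty_same [d _]; apply/sameE => //; rewrite !pullback_emb.
have code (T : finType) (A : structure (binlang ku k) T) :
    exists g : dtype S T -> structure (lang_ext (binlang ku k) E) T,
      forall f : emb A K, g (@ty S V KS T ev wd f) = pullback K' f.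
  have ex t : exists A', forall f : emb A K, @ty S V KS T ev wd f = t -> pullback K' f = A'.
    have [[f ft]|nf] := pselect (exists f : emb A K, @ty S V KS T ev wd f = t).
      by exists (pullback K' f) => f' ft'; apply: ty_pull; rewrite ft ft'.
    by exists (fun _ _ => True) => f ft; case: nf; exists f.
  by have [g gP] := choice ex; exists g => f; rewrite (gP _ f erefl).
have fin (T : finType) (A : structure (binlang ku k) T) : finite_set (expansions K' A).
  have [g gP] := code T A.
  apply: (@sub_finite_set _ _ (g @` setT)%classic); last exact: finite_image finite_finset.
  by rewrite expE => A' [f _ <-]; exists (@ty S V KS T ev wd f).
split=> //.
- move=> T A CA; have [n nE] := fin T A; exists n; split=> //; split; last first.
    (* Lower bound: embeddings are coloured by their types. The colour determines the expansion, and
       by [attain] every copy shows all expansions. *)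
    move=> m bd; have [g gP] := code T A.
    have [eta etaP] := bd _ (fun f => enum_rank (@ty S V KS T ev wd f)).
    rewrite -card_le_II -(card_le_eql nE) -(attain T A eta).
    apply: card_le_trans etaP; apply: card_le_trans (card_image_le (g \o enum_val) _).
    apply: subset_card_le => A' [f _ <-].
    exists (enum_rank (@ty S V KS T ev wd (emb_comp eta f))); first by exists f.
    by rewrite [LHS]/= enum_rankK; exact: (gP (emb_comp eta f)).
  move=> r chi.
  (* [homogenize] colours arbitrary maps, so those that are not embeddings of [A] get [None]. *)
  pose chi' (f : T -> V) : option 'I_r :=
    if pselect (exists e : emb A K, emb_fun e = f) is left P then Some (chi (projT1 (cid P))) else None.
  have chiE (e : emb A K) : chi' e = Some (chi e).
    rewrite /chi'; case: pselect => [P|[]]; last by exists e.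
    by case: cid => e' /= /emb_eq ->.
  have [th [[ti [t1 t2]] thP]] := @homogenize S hFlip V KS sK Kext ev wd T (option 'I_r) chi' tK.
  have [eta etaE] := hom_emb Km Km ti t1 t2.
  have det (f f' : emb A K) : pullback K' f = pullback K' f' ->
      chi (emb_comp eta f) = chi (emb_comp eta f').
    move=> /sameE H; apply: Some_inj; rewrite -!chiE /= etaE.
    have [BA mA] := conventions_matches hFlip0 (CA.1).
    apply: thP; [exact: emb_inj|exact: emb_inj|split].
      by apply: H; rewrite !pullback_emb.
    have [_ [f1 f2]] := emb_hom f mA Km; have [_ [f1' f2']] := emb_hom f' mA Km.
    by apply: str_eq => [a|a b] /=; rewrite ?f1 ?f1' ?f2 ?f2'.
  have [[f0 _]|nf] := pselect (exists f : emb A K, True); last first.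
    exists eta; have -> : [set chi (emb_comp eta f) | f in [set: emb A K]]%classic = set0.
      by apply/seteqP; split=> // c [f _ _]; case: nf; exists f.
    exact: card_ge0.
  have ex A' : exists c : 'I_r, forall f : emb A K, pullback K' f = A' -> chi (emb_comp eta f) = c.
    have [[f fE]|no] := pselect (exists f : emb A K, pullback K' f = A').
      by exists (chi (emb_comp eta f)) => f' f'E; apply: det; rewrite fE f'E.
    by exists (chi f0) => f fE; case: no; exists f.
  have [c cP] := choice ex; exists eta.
  rewrite -(card_le_eqr nE); apply: card_le_trans (card_image_le c _).
  apply: subset_card_le => _ [f _ <-]; exists (pullback K' f); last by rewrite (cP _ f erefl).
  by rewrite expE; exists f.
Qed.
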